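(* For any integer $d \geqslant 6$, there exist exactly $496$ classes of degree $2^{d+1}-1$ in $\mathrm{Ker}\big((\widetilde{Sq}^0_* )_{(5,2^{d}-3)}\big)$ represented by admissible monomials in $P_5$. Consequently, $\dim_{\mathbb F_2}\mathrm{Ker}\big((\widetilde{Sq}^0_* )_{(5,2^{d}-3)}\big)=496$.
   Context: $P_k=\mathbb F_2[x_1,\ldots,x_k]$ is the graded polynomial algebra with each $x_i$ of degree $1$, regarded as a module over the mod-2 Steenrod algebra $\mathcal A$ in the usual way (it is $H^*(B(\mathbb Z/2)^k;\mathbb F_2)$; the action is determined by $Sq^0=\mathrm{id}$, $Sq^1x_i=x_i^2$, $Sq^jx_i=0$ for $j>1$, and the Cartan formula). $\mathcal A^+$ is the augmentation ideal of $\mathcal A$, $QP_k=P_k/\mathcal A^+P_k$, and $(QP_k)_n$ is its degree $n$ part. Kameko's homomorphism $\widetilde{Sq}^0_*:QP_k\to QP_k$ is the map induced by the $\mathbb F_2$-linear map $\phi:P_k\to P_k$ given on monomials by $\phi(x)=y$ if $x=x_1x_2\cdots x_ky^2$ for a monomial $y$, and $\phi(x)=0$ otherwise. Its restriction to degree $2m+k$ is denoted $(\widetilde{Sq}^0_* )_{(k,m)}:(QP_k)_{2m+k}\to(QP_k)_m$. Thus $(\widetilde{Sq}^0_* )_{(5,2^d-3)}:(QP_5)_{2^{d+1}-1}\to(QP_5)_{2^d-3}$. For a monomial $x=x_1^{a_1}\cdots x_k^{a_k}$, let $\alpha_i(a)$ denote the coefficient of $2^i$ in the dyadic expansion of $a$,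 let $\omega_i(x)=\sum_{j=1}^k\alpha_{i-1}(a_j)$ for $i\geqslant1$, let $\omega(x)=(\omega_1(x),\omega_2(x),\ldots)$ (the weight vector) and $\sigma(x)=(a_1,\ldots,a_k)$ (the exponent vector). Weight vectors and exponent vectors are ordered left lexicographically. For monomials $x,y$ of the same degree, $x<y$ means that either $\omega(x)<\omega(y)$, or $\omega(x)=\omega(y)$ and $\sigma(x)<\sigma(y)$. A monomial $x$ in $P_k$ is inadmissible if there exist monomials $y_1,\ldots,y_t$ (of the same degree) with $y_j<x$ for all $j$ and $x-\sum_{j=1}^ty_j\in\mathcal A^+P_k$; it is admissible if it is not inadmissible. *)

(* Defs.v *)
From HB Require Import structures.
From mathcomp Require Import all_boot all_order all_algebra.
From mathcomp Require Import mpoly.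
From mathcomp Require boolp.

Set Implicit Arguments.
Unset Strict Implicit.
Unset Printing Implicit Defensive.

Import GRing.Theory.
Local Open Scope ring_scope.
Local Open Scope quotient_scope.

(* The quotient of a module by a submodule: the library's quotient abelian    *)
(* group, with the induced scaling.                                           *)
Section LmodQuotient.
Variables (R : nzRingType) (V : lmodType R) (S : {pred V}).
Hypothesis S_closed : submod_closed S.

HB.instance Definition _ := GRing.isSubmodClosed.Build R V S S_closed.

Definition lquot : Type := Quotient.quot S.
HB.instance Definition _ := Choice.on lquot.
HB.instance Definition _ := GRing.Zmodule.on lquot.
HB.instance Definition _ := EqQuotient.on lquot.

Definition lquot_pi (v : V) : lquot := \pi_lquot v.

Lemma lquot_pi_eq (u v : V) : lquot_pi u = lquot_pi v <-> u - v \in S.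
Proof.
split=> [/eqP|uv]; first by rewrite /lquot_pi -Quotient.idealrBE.
by apply/eqP; rewrite /lquot_pi -Quotient.idealrBE.
Qed.

Lemma lquot_pi_repr (c : lquot) : lquot_pi (repr c) = c.
Proof. exact: reprK. Qed.

Lemma lquot_piD (u v : V) : lquot_pi (u + v) = lquot_pi u + lquot_pi v.
Proof. exact: (Quotient.pi_add _). Qed.

Definition lquot_scale (a : R) (c : lquot) : lquot := lquot_pi (a *: repr c).

Lemma lquot_piZ a (v : V) : lquot_scale a (lquot_pi v) = lquot_pi (a *: v).
Proof.
apply/lquot_pi_eq; rewrite -scalerBr rpredZ //.
by apply/lquot_pi_eq; rewrite lquot_pi_repr.
Qed.

Fact lquot_scaleA a b c :
  lquot_scale a (lquot_scale b c) = lquot_scale (a * b) c.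
Proof. by rewrite -[c]lquot_pi_repr !lquot_piZ scalerA. Qed.
Fact lquot_scale1 : left_id 1 lquot_scale.
Proof. by move=> c; rewrite -[c]lquot_pi_repr lquot_piZ scale1r. Qed.
Fact lquot_scaleDr : right_distributive lquot_scale +%R.
Proof.
move=> a c c'; rewrite -[c]lquot_pi_repr -[c']lquot_pi_repr.
by rewrite -lquot_piD !lquot_piZ scalerDr lquot_piD.
Qed.
Fact lquot_scaleDl c : {morph lquot_scale^~ c : a b / a + b}.
Proof.
by move=> a b; rewrite -[c]lquot_pi_repr !lquot_piZ scalerDl lquot_piD.
Qed.
HB.instance Definition _ := GRing.Zmodule_isLmodule.Build R lquot
  lquot_scaleA lquot_scale1 lquot_scaleDr lquot_scaleDl.

Fact lquot_pi_is_linear : linear lquot_pi.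
Proof. by move=> a u v; rewrite lquot_piD -lquot_piZ. Qed.
HB.instance Definition _ :=
  GRing.isLinear.Build R V lquot _ lquot_pi lquot_pi_is_linear.
End LmodQuotient.

(* A module over a field spanned by a finite family is finite dimensional.    *)
Lemma spanned_vector_axiom (F : fieldType) (V : lmodType F) (s : seq V) :
  (forall v, exists c : nat -> F, v = \sum_(i < size s) c i *: s`_i) ->
  {n : nat & Vector.axiom n V}.
Proof.
move=> spans.
pose P n := boolp.asbool (exists b : nat -> V,
  forall v, exists c : 'rV[F]_n, v = \sum_(i < n) c 0 i *: b i).
have exP : exists n, P n.
  exists (size s); apply/boolp.asboolP; exists (nth 0 s) => v.
  have [c ->] := spans v; exists (\row_i c i).
  by apply: eq_bigr => i _; rewrite mxE.
case: (ex_minnP exP) => n /boolp.asboolP/boolp.cid[b bP] minn; exists n.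
have free_b (c : 'rV[F]_n) : \sum_(i < n) c 0 i *: b i = 0 -> c = 0.
  move=> c0; apply/eqP; apply: contraT => /rV0Pn[j cj].
  case: n => [|n] in minn bP c c0 j cj *; first by case: j cj.
  suff /minn : P n by rewrite ltnn.
  apply/boolp.asboolP; exists (fun i => b (bump j i)) => v.
  have [e ->] := bP v.
  exists (\row_i (e 0 (lift j i) - e 0 j / c 0 j * c 0 (lift j i))).
  have -> : \sum_(i < n.+1) e 0 i *: b i = \sum_(i < n.+1)
     (e 0 i - e 0 j / c 0 j * c 0 i) *: b i.
    under [RHS]eq_bigr do rewrite scalerBl -scalerA.
    by rewrite sumrB -scaler_sumr c0 scaler0 subr0.
  rewrite (bigD1_ord j) //= divfK // subrr scale0r add0r.
  by apply: eq_bigr => i _; rewrite !mxE.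
have inj_b (c c' : 'rV[F]_n) :
    \sum_(i < n) c 0 i *: b i = \sum_(i < n) c' 0 i *: b i -> c = c'.
  move=> e; apply/eqP; rewrite -subr_eq0; apply/eqP/free_b.
  rewrite (eq_bigr (fun i : 'I_n => c 0 i *: b i - c' 0 i *: b i)).
    by rewrite sumrB e subrr.
  by move=> i _; rewrite !mxE scalerBl.
pose f v := sval (boolp.cid (bP v)).
have fE v : v = \sum_(i < n) f v 0 i *: b i by rewrite /f; case: boolp.cid.
exists f.
  move=> a u v; apply: inj_b; rewrite -fE {1}[u]fE {1}[v]fE scaler_sumr.
  by rewrite -big_split; apply: eq_bigr => i _; rewrite !mxE scalerDl scalerA.
exists (fun c : 'rV_n => \sum_(i < n) c 0 i *: b i) => [v|c]; first by rewrite -fE.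
by apply: inj_b; rewrite -fE.
Qed.

Section Steenrod.
Variable k : nat.
Local Notation P := {mpoly 'F_2[k]}.

(* The total square \sum_i Sq^i 'X^i : P_k -> P_k['X] is the ring morphism    *)
(* with x_j |-> x_j + x_j^2 'X; multiplicativity is the Cartan formula.       *)
Definition Sqt (f : P) : {poly P} :=
  mmap (polyC \o @mpolyC k 'F_2) (fun j => ('X_j)%:P + ('X_j ^+ 2)%:P * 'X) f.
HB.instance Definition _ := GRing.RMorphism.copy Sqt
  (mmap (polyC \o @mpolyC k 'F_2) (fun j => ('X_j)%:P + ('X_j ^+ 2)%:P * 'X)).

Definition Sq (i : nat) (f : P) : P := (Sqt f)`_i.

Lemma SqtX j : Sqt 'X_j = ('X_j)%:P + ('X_j ^+ 2)%:P * 'X.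
Proof. by rewrite /Sqt mmapX mmap1U. Qed.

Lemma Sq_X j i :
  Sq i 'X_j = if i is i'.+1 then if i' is 0 then 'X_j ^+ 2 else 0 else 'X_j.
Proof.
rewrite /Sq SqtX coefD coefC coefMX.
by case: i => [|[|i]]; rewrite ?addr0 ?add0r //= coefC.
Qed.

Lemma Sq_Cartan n (f g : P) : Sq n (f * g) = \sum_(i < n.+1) Sq i f * Sq (n - i) g.
Proof. by rewrite /Sq rmorphM coefM. Qed.

Fact Sq_is_linear i : linear (Sq i).
Proof.
by move=> a f g; rewrite /Sq rmorphD /= coefD /Sqt mmapZ /= coefCM mul_mpolyC.
Qed.
HB.instance Definition _ i := GRing.isLinear.Build _ P P _ (Sq i)
  (@Sq_is_linear i).

Lemma Sq0 (f : P) : Sq 0 f = f.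
Proof.
have Sq0M (g h : P) : Sq 0 (g * h) = Sq 0 g * Sq 0 h.
  by rewrite Sq_Cartan big_ord1.
rewrite [f in LHS]mpolyE [RHS]mpolyE linear_sum; apply: eq_bigr => m _.
rewrite linearZ /=; congr (_ *: _); rewrite mpolyXE_id.
have Sq01 : Sq 0 1 = 1 by rewrite /Sq rmorph1 coef1.
apply: (big_ind (fun x => Sq 0 x = x)) => // [g h gE hE|j _].
  by rewrite Sq0M gE hE.
by elim: (m j) => [|e IH]; rewrite ?expr0 // exprS Sq0M IH Sq_X.
Qed.

Definition Sqs (I : seq nat) (f : P) : P := foldr Sq f I.

(* A^+ P_k: as a vector space, the augmentation ideal A^+ is spanned by the   *)
(* nonempty products of squares Sq^i with all i > 0.                          *)
Definition hit : {pred P} := fun f => boolp.asbool (exists2 l : seq (seq nat * P),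
  all (fun If => (If.1 != [::]) && (0%N \notin If.1)) l &
  f = \sum_(If <- l) Sqs If.1 If.2).

Lemma hitP f : reflect (exists2 l : seq (seq nat * P),
    all (fun If => (If.1 != [::]) && (0%N \notin If.1)) l &
    f = \sum_(If <- l) Sqs If.1 If.2) (f \in hit).
Proof. exact: boolp.asboolP. Qed.

Fact Sqs_is_linear I : linear (Sqs I).
Proof.
elim: I => [|i I IH] a f g //.
by rewrite -![Sqs (i :: I) _]/(Sq i (Sqs I _)) IH linearP.
Qed.
HB.instance Definition _ I := GRing.isLinear.Build _ P P _ (Sqs I)
  (@Sqs_is_linear I).

Fact hit_submod_closed : submod_closed hit.
Proof.
split=> [|a f g /hitP[l lP ->] /hitP[l' l'P ->]]; apply/hitP.
  by exists [::]; rewrite ?big_nil.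
exists ([seq (If.1, a *: If.2) | If <- l] ++ l').
  by rewrite all_cat l'P andbT all_map.
rewrite big_cat big_map scaler_sumr /=; congr (_ + _).
by apply: eq_bigr => If _; rewrite linearZ.
Qed.
HB.instance Definition _ :=
  GRing.isSubmodClosed.Build _ P hit hit_submod_closed.

Lemma hit_Sq i f : (0 < i)%N -> Sq i f \in hit.
Proof.
move=> i0; apply/hitP; exists [:: ([:: i], f)]; last by rewrite big_seq1.
by rewrite /= inE eq_sym -lt0n i0.
Qed.

(* QP_k = P_k / A^+ P_k                                                       *)
Definition QP : Type := lquot hit_submod_closed.
HB.instance Definition _ := GRing.Lmodule.on QP.

Definition cls (f : P) : QP := lquot_pi hit_submod_closed f.
HB.instance Definition _ := GRing.Linear.copy cls (lquot_pi hit_submod_closed).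

Lemma cls_eq f g : cls f = cls g <-> f - g \in hit.
Proof. exact: lquot_pi_eq. Qed.

Lemma cls_surj c : exists f, c = cls f.
Proof. by exists (repr c); rewrite /cls lquot_pi_repr. Qed.

Definition in_deg (n : nat) : {pred QP} :=
  fun c => boolp.asbool (exists2 f : P, f \is n.-homog & c = cls f).

Lemma in_degP n c :
  reflect (exists2 f : P, f \is n.-homog & c = cls f) (c \in in_deg n).
Proof. exact: boolp.asboolP. Qed.

Fact in_deg_submod_closed n : submod_closed (in_deg n).
Proof.
split=> [|a c c' /in_degP[f fn ->] /in_degP[g gn ->]]; apply/in_degP.
  by exists 0; [exact: dhomog0 | rewrite linear0].
by exists (a *: f + g); [exact: dhomogD (dhomogZ _ fn) gn | rewrite linearP].
Qed.
HB.instance Definition _ n :=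
  GRing.isSubmodClosed.Build _ QP (in_deg n) (in_deg_submod_closed n).

(* (QP_k)_n *)
Record QPdeg (n : nat) : Type :=
  MkQPdeg { QPdeg_val :> QP; QPdeg_valP : QPdeg_val \in in_deg n }.
HB.instance Definition _ n := [isSub for @QPdeg_val n].
HB.instance Definition _ n := [Choice of QPdeg n by <:].
HB.instance Definition _ n := GRing.SubChoice_isSubLmodule.Build _ _ _ (QPdeg n)
  (GRing.submod_closed_semi (in_deg_submod_closed n)).

Fact QPdeg_vector n : {d : nat & Vector.axiom d (QPdeg n)}.
Proof.
have clsP (m : 'X_{1..k < n.+1}) :
    (if mdeg m == n then cls 'X_[m] else 0) \in in_deg n.
  case: eqP => [e|_]; last by have [] := in_deg_submod_closed n.
  by apply/in_degP; exists 'X_[m]; rewrite // dhomogX; apply/eqP.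
pose b (m : 'X_{1..k < n.+1}) := MkQPdeg (clsP m).
apply: (@spanned_vector_axiom _ _ [seq b m | m : 'X_{1..k < n.+1}]) => v.
have [f fn vf] := in_degP _ _ (valP v).
exists (fun i => nth 0 [seq f@_(val m) | m : 'X_{1..k < n.+1}] i).
apply: val_inj; rewrite /= vf.
pose T := {: 'X_{1..k < n.+1}}.
rewrite size_map.
rewrite {1}[f](mpolywE (k := n.+1)); last first.
  rewrite mmeasureE big_seq; apply: (big_ind (fun x => x <= n.+1)%N) => //.
    by move=> x y xn yn; rewrite geq_max xn.
  by move=> m /(dhomog_mf fn) ->.
transitivity (val (\sum_(m : 'X_{1..k < n.+1}) f@_m *: b m)); last first.
  congr val; rewrite -(big_enum _ _ xpredT) /=.
  rewrite -(big_map (fun m => (f@_(val m), b m)) xpredT (fun p => p.1 *: p.2)).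
  rewrite (big_nth 0) size_map big_mkord size_map; apply: eq_bigr => i _.
  have m0 : 'X_{1..k < n.+1} by exists 0%MM; rewrite mdeg0.
  by rewrite !(nth_map m0) ?size_map.
rewrite [in LHS]linear_sum [in RHS]linear_sum /=; apply: eq_bigr => m _.
rewrite !linearZ /=; case: eqP => // mn.
rewrite (dhomog_nemf_coeff fn) ?scale0r //; exact/eqP.
Qed.

End Steenrod.

HB.instance Definition _ k n :=
  Lmodule_hasFinDim.Build _ (QPdeg k n) (projT2 (QPdeg_vector k n)).

Section Kameko.
Variable k : nat.
Local Notation P := {mpoly 'F_2[k]}.

(* x_1 ... x_k y^2 |-> y, and 0 on the other monomials.                       *)
Definition phi_mon (x : 'X_{1..k}) : P :=
  if [forall j, odd (x j)] then 'X_[[multinom (x j)./2 | j < k]] else 0.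

Definition phi (f : P) : P := \sum_(x <- msupp f) f@_x *: phi_mon x.

Lemma mcoeff_phi f y : (phi f)@_y = f@_[multinom (y j).*2.+1 | j < k].
Proof.
set y1 := [multinom _ | _ < _].
have phi_monE x : (phi_mon x)@_y = (x == y1)%:R.
  rewrite /phi_mon; case: ifP => [/forallP xodd|/negP xeven].
    rewrite mcoeffX; congr (_%:R); congr nat_of_bool; apply/eqP/eqP => e.
      by apply/mnmP => j; rewrite mnmE -e mnmE -[LHS]odd_double_half xodd.
    by apply/mnmP => j; rewrite mnmE e mnmE /= uphalf_double.
  rewrite mcoeff0; case: eqP => // xE; case: xeven.
  by apply/forallP => j; rewrite xE mnmE /= odd_double.
rewrite /phi linear_sum /= -/y1.
under eq_bigr do rewrite mcoeffZ phi_monE.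
have [y1f|/memN_msupp_eq0 y1f] := boolP (y1 \in msupp f); last first.
  rewrite y1f big_seq big1 // => x xf; case: eqP => [xE|]; last by rewrite mulr0.
  by move: xf; rewrite xE mcoeff_msupp y1f eqxx.
rewrite (bigD1_seq y1) ?msupp_uniq //= eqxx mulr1 big1 ?addr0 // => x.
by case: eqP => // _ _; rewrite mulr0.
Qed.

Fact phi_is_linear : linear phi.
Proof.
by move=> a f g; apply/mpolyP => y; rewrite !(mcoeffD, mcoeffZ, mcoeff_phi).
Qed.
HB.instance Definition _ := GRing.isLinear.Build _ P P _ phi phi_is_linear.

Lemma phiX x : phi 'X_[x] = phi_mon x.
Proof. by rewrite /phi msuppX big_seq1 mcoeffX eqxx scale1r. Qed.

Lemma phi_homog m f : f \is (2 * m + k)%N.-homog -> phi f \is m.-homog.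
Proof.
move=> /dhomogP fh; apply/dhomogP => y.
rewrite mcoeff_msupp mcoeff_phi -mcoeff_msupp => /fh /eqP.
rewrite /= mdegE (eq_bigr (fun j => 2 * y j + 1)%N); last first.
  by move=> j _; rewrite mnmE -addn1 mul2n.
rewrite big_split /= -big_distrr /= sum_nat_const card_ord muln1 eqn_add2r.
by rewrite eqn_pmul2l // -mdegE => /eqP.
Qed.

Lemma phi_sqX j f : phi ('X_j ^+ 2 * f) = 'X_j * phi f.
Proof.
rewrite [f]mpolyE mulr_sumr !linear_sum mulr_sumr /=; apply: eq_bigr => x _.
rewrite -scalerAr !linearZ /= -scalerAr; congr (_ *: _).
rewrite mpolyXn -mpolyXD !phiX /phi_mon.
have oddE i : odd ((U_(j) *+ 2 + x)%MM i) = odd (x i).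
  by rewrite mnmDE mulmnE oddD oddM andbF.
under eq_forallb do rewrite oddE.
case: ifP => _; last by rewrite mulr0.
rewrite -mpolyXD; congr 'X_[_]; apply/mnmP => i; rewrite !mnmE.
by rewrite addnn halfD odd_double /= doubleK.
Qed.

Lemma Sq_sqX i j (f : P) : Sq i ('X_j ^+ 2 * f) =
  'X_j ^+ 2 * Sq i f + (if i is i'.+2 then 'X_j ^+ 4 * Sq i' f else 0).
Proof.
have char2 (g : {poly P}) : g *+ 2 = 0.
  by rewrite -mulr_natr -(rmorph_nat polyC) -(rmorph_nat (@mpolyC k 'F_2))
     (_ : 2%:R = 0 :> 'F_2) ?mpolyC0 ?mulr0 //; exact/val_inj.
rewrite /Sq rmorphM rmorphXn /= SqtX sqrrD char2 addr0 mulrDl coefD exprMn.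
rewrite -!rmorphXn /= coefCM -exprM. rewrite [_ * 'X^2 * _]mulrAC coefMXn.
by case: i => [|[|i]]; rewrite //= coefCM !subSS subn0.
Qed.

Lemma Sq_mulX i j (f : P) : Sq i ('X_j * f) =
  'X_j * Sq i f + (if i is i'.+1 then 'X_j ^+ 2 * Sq i' f else 0).
Proof.
rewrite /Sq rmorphM /= SqtX mulrDl coefD coefCM [_ * 'X * _]mulrAC coefMX.
by case: i => [|i] //=; rewrite coefCM.
Qed.

Lemma phi_Sq_squarefree i (x : 'X_{1..k}) : (forall j, x j <= 1)%N ->
  phi (Sq i 'X_[x]) = if i is 0 then phi 'X_[x] else 0.
Proof.
move=> x1; pose B j := if x j == 1%N then ('X_j ^+ 2)%:P * 'X : {poly P} else 0.
have SqtE : Sqt 'X_[x] = \prod_j (('X_j ^+ x j)%:P + B j).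
  rewrite mpolyXE_id rmorph_prod; apply: eq_bigr => j _; rewrite rmorphXn /= SqtX.
  rewrite /B; case: (x j) (x1 j) => [|[|//]] _; last by rewrite !expr1.
  by rewrite !expr0 addr0.
rewrite /Sq SqtE bigA_distr coef_sum linear_sum /= (bigD1 setT) //= [X in _ + X]big1 => [|J].
    rewrite addr0 (eq_bigr (fun j => ('X_j ^+ x j)%:P)); last by move=> j; rewrite inE.
  by rewrite -rmorph_prod -mpolyXE_id /= coefC; case: i => //=; rewrite linear0.
rewrite -subTset => /subsetPn[j0 _ j0J].
have [j /andP[jJ xj]|xJ] := pickP (fun j => (j \notin J) && (x j != 1%N)).
  rewrite (bigD1 j) //= (negPf jJ) /B (negPf xj) mul0r coef0.
  by rewrite linear0.
pose e := [multinom if j \in J then x j else 2 | j < k].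
rewrite (eq_bigr (fun j => ('X_j ^+ e j)%:P * 'X^(j \notin J))); last first.
  move=> j _; rewrite mnmE /B; case: ifP => jJ /=; first by rewrite mulr1.
  by have := xJ j; rewrite jJ /= => /negbFE ->.
rewrite big_split -rmorph_prod -mpolyXE_id /= prodrXr coefMXn coefC.
case: ifP => _; first by rewrite linear0.
case: ifP => _; last by rewrite linear0.
rewrite phiX /phi_mon; case: ifP => // /forallP /(_ j0).
by rewrite mnmE (negPf j0J).
Qed.

Lemma Sq_1 i : Sq i (1 : P) = (i == 0%N)%:R.
Proof. by rewrite /Sq rmorph1 coef1. Qed.

Lemma phi_Sq i f : phi (Sq i f) = if odd i then 0 else Sq i./2 (phi f).
Proof.
have lin (g : {linear P -> P}) : g f = \sum_(x <- msupp f) f@_x *: g 'X_[x].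
  by rewrite {1}[f]mpolyE linear_sum; apply: eq_bigr => x _; rewrite linearZ.
suff phi_SqX x : phi (Sq i 'X_[x]) = if odd i then 0 else Sq i./2 (phi 'X_[x]).
  have /= -> := lin (phi \o Sq i); under eq_bigr do rewrite phi_SqX.
  have /= -> := lin (Sq i./2 \o phi); case: ifP => // _.
  by rewrite big1 // => x _; rewrite scaler0.
have [n xn] := ubnP (mdeg x); elim: n => // n IH in x xn i *.
have [j xj|xlt2] := pickP (fun j => 1 < x j)%N.
  have xE : x = (U_(j) *+ 2 + (x - U_(j) *+ 2))%MM.
    rewrite addmC submK //; apply/mnm_lepP => l.
    by rewrite mulmnE mnm1E; case: eqP => // <-.
  rewrite xE; move: (x - _)%MM xE => x' xE.
  have {}IH := IH x' _; rewrite {}xE mdegD mdegMn mdeg1 in xn *.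
  have {}IH l : phi (Sq l 'X_[x']) = if odd l then 0 else Sq l./2 (phi 'X_[x']).
    by apply: IH; rewrite -ltnS (leq_trans _ xn) // ltnS leq_addl.
  rewrite mpolyXD -mpolyXn Sq_sqX phi_sqX linearD /= phi_sqX IH.
  case: i => [|[|i]] /=; rewrite ?linear0 ?mulr0 ?addr0 ?Sq0 // negbK.
  rewrite (exprD _ 2 2) -mulrA !phi_sqX IH.
  case: (odd i); first by rewrite !mulr0 addr0.
  by rewrite (Sq_mulX (i./2).+1 j (phi 'X_[x'])) expr2 -mulrA.
rewrite phi_Sq_squarefree => [|j]; last by rewrite leqNgt xlt2.
case: i => [|i] /=; first by rewrite Sq0.
case: ifP => // io; rewrite phiX /phi_mon.
case: ifP => _; last by rewrite linear0.
rewrite (_ : [multinom _ | _ < _] = 0%MM) ?mpolyX0 ?Sq_1.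
  by case: i io.
by apply/mnmP => j; rewrite !mnmE; case: (x j) (xlt2 j) => [|[]].
Qed.

Lemma phi_hit f : f \in @hit k -> phi f \in @hit k.
Proof.
move=> /hitP[l lP ->]; rewrite linear_sum big_seq /=.
apply: (big_ind (fun f => f \in @hit k)).
- by have [] := @hit_submod_closed k.
- by move=> g h; have [_ /(_ 1 g h)] := @hit_submod_closed k; rewrite scale1r.
move=> [[|i I] g] /(allP lP) //=; rewrite inE negb_or eq_sym => /andP[i0 _].
rewrite phi_Sq; case: ifP => io; first by have [] := @hit_submod_closed k.
by apply: hit_Sq; case: i i0 io => [|[|i]].
Qed.

(* Sq^0_* : QP_k -> QP_k, the map induced by phi.                             *)
Definition kameko (c : QP k) : QP k := cls (phi (repr c)).

Lemma kameko_cls f : kameko (cls f) = cls (phi f).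
Proof.
apply/cls_eq; rewrite -linearB; apply: phi_hit; apply/cls_eq.
exact: lquot_pi_repr.
Qed.

Fact kameko_is_linear : linear kameko.
Proof.
move=> a c c'; have [f ->] := cls_surj c; have [g ->] := cls_surj c'.
by rewrite -linearP !kameko_cls !linearP.
Qed.
HB.instance Definition _ :=
  GRing.isLinear.Build _ (QP k) (QP k) _ kameko kameko_is_linear.

Lemma kameko_in_deg m c : c \in @in_deg k (2 * m + k)%N -> kameko c \in @in_deg k m.
Proof.
move=> /in_degP[f fh ->]; rewrite kameko_cls; apply/in_degP.
by exists (phi f) => //; apply: phi_homog.
Qed.

Definition kameko_res (m : nat) (c : QPdeg k (2 * m + k)%N) : QPdeg k m :=
  MkQPdeg (kameko_in_deg (QPdeg_valP c)).

Fact kameko_res_is_linear m : linear (@kameko_res m).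
Proof. by move=> a c c'; apply: val_inj; rewrite /= !linearP. Qed.
HB.instance Definition _ m := GRing.isLinear.Build _ _ _ _ (@kameko_res m)
  (@kameko_res_is_linear m).

(* (Sq^0_* )_(k,m) : (QP_k)_(2m+k) -> (QP_k)_m                                *)
Definition kameko_deg (m : nat) : 'Hom(QPdeg k (2 * m + k)%N, QPdeg k m) :=
  linfun (@kameko_res m).

Lemma kameko_degE m c : kameko_deg m c = kameko c :> QP k.
Proof. by rewrite lfunE. Qed.

End Kameko.

Section Admissible.
Variable k : nat.
Implicit Types x y : 'X_{1..k}.

Definition alpha (i a : nat) : nat := ((a %/ 2 ^ i) %% 2)%N.

(* omega x i is the entry omega_(i+1)(x) of the weight vector.                *)
Definition omega x (i : nat) : nat := (\sum_(j < k) alpha i (x j))%N.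

Definition omega_lt x y : Prop :=
  exists i, (forall l, (l < i)%N -> omega x l = omega y l) /\ (omega x i < omega y i)%N.

Definition sigma_lt x y : Prop :=
  exists i : 'I_k, (forall l : 'I_k, (l < i)%N -> x l = y l) /\ (x i < y i)%N.

Definition mon_lt x y : Prop :=
  omega_lt x y \/ omega x =1 omega y /\ sigma_lt x y.

(* The empty family is allowed: a hit monomial is inadmissible.               *)
Definition inadmissible x : Prop :=
  exists ys : seq 'X_{1..k},
    {in ys, forall y, mdeg y = mdeg x /\ mon_lt y x} /\
    'X_[x] - \sum_(y <- ys) 'X_[y] \in @hit k.

Definition admissible x : Prop := ~ inadmissible x.

End Admissible.

(* Main.v *)
From HB Require Import structures.
From Stdlib Require Import PArith FMapPositive.
Require Import Defs.
From mathcomp Require Import all_boot all_order all_algebra.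
From mathcomp Require Import mpoly zify ring.
From mathcomp Require boolp.

Set Implicit Arguments.
Unset Strict Implicit.
Unset Printing Implicit Defensive.

Import GRing.Theory.
Local Open Scope ring_scope.

(** Why the kernel has dimension 496.

    Put n = d + 1, so that the source of the Kameko map has degree
    N = 2^n - 1.  A polynomial each of whose monomials has an even exponent
    is killed by phi, and conversely a class of the kernel is represented by such
    a polynomial: if phi f is hit, then the all-odd part
    x_1 ... x_5 (phi f)^2 of f is hit modulo monomials with fewer odd exponents
    ([phi_hit_homog]).  Admissible monomials of a given degree represent a basis
    of QP_5 in that degree, and reduction to admissible monomials never raises
    the weight vector; hence the admissible monomials with an even exponent
    represent a basis of the kernel ([span_kbasis], [free_kbasis], [mem_kbasis]),
    and it remains to count them.

    The count is made by duality.  Consider linear forms on the monomials of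
    degree N which vanish on hit polynomials ([A_functional]), restricted to
    monomials with an even exponent; as N is odd, these have at most 3 odd
    exponents.  Two families of such forms are available.

    - For each of the 31 nonzero points v of F_2^5, restrict a polynomial to the
      line spanned by v, that is, substitute v_j t for x_j, and read the
      coefficient of t^N ([ev]).

    - For each of the 155 planes L of F_2^5 and each of the 3 coordinates k that
      are not pivots of L, differentiate with respect to x_k, restrict to L, and
      read the coefficient of (s t)^(2^(n-1) - 1) ([psi]): 465 forms.

    They vanish on hit polynomials because linear substitutions and partial
    derivatives commute with the Steenrod squares, and because a spike, a
    monomial with all exponents of the form 2^c - 1, does not occur in a hit
    polynomial.  The theorem follows from 31 + 465 = 496 once these forms are
    shown to be a basis: the matrix of their values on the admissible monomials
    in question has independent rows ([pairing_row_free]) and independent columns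
    ([pairing_col_free]).

    That they span ([functional_span]) is the main point.  Write a monomial as the
    word of its letters L_0 L_1 L_2 ..., where L_i is the set of variables whose
    exponent has binary digit 1 in position i; the sizes of the letters form the
    weight vector.  Modulo monomials of lower weight, Sq^1 and Sq^2 applied to a
    letter give relations between words of one weight which involve only two
    neighbouring letters.  For 13 short windows of weights these relations
    alone make all words vanish ([kills_windows]), and every weight vector of
    degree N starting with at most 3 contains such a window or a zero followed by
    a nonzero entry, with two exceptions: (1, ..., 1) and (3, 2, ..., 2, 0)
    ([classify_weights]).  So a form vanishes as soon as it does on the words of
    these two weights.

    On words of weight (1, ..., 1) a form depends only on the set of letters that
    occur; such functions are combinations of the 31 point forms
    ([points_dual]).  Subtracting them, a form becomes a function of a letter A
    with 3 elements and a word w of pairs, which depends on A and on the set of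
    letters of w, satisfies the Pluecker relations in w, and a contraction
    relation that moves an element of A into w.  For fixed A the Pluecker relations
    say that the function is a combination of the products of minors over the
    planes of F_2^5, and the contraction relation leaves 3 free values for each
    plane ([grassmann_dual]).  Uniform statements in the length of w are
    reduced to eliminations over F_2 with supports of bounded size. *)

(** * Polynomials and Steenrod squares modulo 2 *)

Lemma F2_addxx (x : 'F_2) : x + x = 0.
Proof. by apply/val_inj; case: x => [[|[|]]]. Qed.

Lemma F2_01 (c : 'F_2) : c = 0 \/ c = 1.
Proof. by case: c => [[|[|]]] // i; [left|right]; apply/val_inj. Qed.

Lemma coef_sqr_char2 (R : comNzRingType) (p : {poly R}) i : (forall x : R, x + x = 0) ->
  (p ^+ 2)`_i = if odd i then 0 else (p`_i./2) ^+ 2.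
Proof.
move=> R2; elim/poly_ind: p i => [|p c IH] i.
  by rewrite expr2 mulr0 !coef0 expr2 mulr0 if_same.
have -> : (p * 'X + c%:P) ^+ 2 = p ^+ 2 * 'X^2 + (c ^+ 2)%:P.
  rewrite sqrrD exprMn rmorphXn /= [_ *+ 2](_ : _ = 0) ?addr0 //.
  by apply/polyP => j; rewrite coefMn mulr2n R2 coef0.
rewrite coefD coefMXn coefC; case: i => [|[|i]].
- by rewrite /= coefD coefMX coefC /= !add0r.
- by rewrite /= addr0.
rewrite subSS subSS subn0 IH /= negbK addr0; case: (odd i) => //.
by rewrite coefD coefMX coefC /= addr0.
Qed.

Section SteenrodTools.
Variable k : nat.
Local Notation P := {mpoly 'F_2[k]}.
Implicit Types (f g h : P) (m : 'X_{1..k}).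

Lemma mpoly2_addxx f : f + f = 0.
Proof. by apply/mpolyP => m; rewrite mcoeffD F2_addxx mcoeff0. Qed.

Lemma mpoly2_oppr f : - f = f.
Proof. by apply/eqP; rewrite -subr_eq0 -opprD mpoly2_addxx oppr0. Qed.

Lemma mpoly2_sqrD f g : (f + g) ^+ 2 = f ^+ 2 + g ^+ 2.
Proof. by rewrite sqrrD mulr2n mpoly2_addxx addr0. Qed.

Lemma mpoly2_coefZ (c : 'F_2) f : (c *: f) ^+ 2 = c *: f ^+ 2.
Proof.
rewrite exprZn; congr (_ *: _); apply/val_inj.
by case: c => [[|[|]]].
Qed.

Lemma coef_sqr (p : {poly P}) i : (p ^+ 2)`_i = if odd i then 0 else (p`_i./2) ^+ 2.
Proof. exact: coef_sqr_char2 mpoly2_addxx. Qed.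

(** The total square is multiplicative and squaring is additive in
    characteristic 2, so squaring a polynomial squares its total square. *)
Lemma Sq_sqr i f : Sq i (f ^+ 2) = if odd i then 0 else (Sq i./2 f) ^+ 2.
Proof. by rewrite /Sq rmorphXn /= coef_sqr. Qed.

Lemma mnm_ind (Q : 'X_{1..k} -> Prop) :
  Q 0%MM -> (forall j m, Q m -> Q (U_(j) + m)%MM) -> forall m, Q m.
Proof.
move=> Q0 QS m; have [n mn] := ubnP (mdeg m).
elim: n => // n IH in m mn *.
have [/eqP|] := boolP (m == 0%MM); first by move->.
rewrite -mdeg_eq0 mdegE sum_nat_eq0 negb_forall => /existsP[j mj].
have mE : m = (U_(j) + (m - U_(j)))%MM.
  rewrite addmC submK //; apply/mnm_lepP => l; rewrite mnm1E.
  by case: eqP => // <-; rewrite lt0n.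
rewrite mE; apply/QS/IH; move: mn; rewrite {1}mE mdegD mdeg1.
by rewrite add1n ltnS.
Qed.

Lemma Sq_homog i m : Sq i 'X_[m] \is (mdeg m + i)%N.-homog.
Proof.
elim/mnm_ind: m i => [|j m IH] i.
  rewrite mpolyX0 Sq_1 mdeg0 add0n; case: i => [|i] /=; first exact: dhomog1.
  exact: dhomog0.
rewrite mpolyXD Sq_mulX mdegD mdeg1 -addnA; apply: dhomogD.
  by apply: dhomogM => //; rewrite dhomogX /= mdeg1.
case: i => [|i]; first exact: dhomog0.
rewrite (_ : 1 + (mdeg m + i.+1) = 2 + (mdeg m + i))%N; last by lia.
by apply: dhomogM => //; rewrite mpolyXn dhomogX /= mdegMn mdeg1.
Qed.

(** The instability condition: a square of degree above that of the monomial
    vanishes, and in the top degree it is the squaring map. *)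
Lemma Sq_top m : Sq (mdeg m) 'X_[m] = 'X_[m] ^+ 2 /\
  forall i, (mdeg m < i)%N -> Sq i 'X_[m] = 0.
Proof.
elim/mnm_ind: m => [|j m [IHe IHn]].
  rewrite mdeg0 mpolyX0; split=> [|i i0]; rewrite Sq_1 ?expr1n //.
  by case: i i0.
rewrite mdegD mdeg1 mpolyXD add1n; split.
  by rewrite Sq_mulX IHn // IHe mulr0 add0r exprMn.
by move=> [|i] // mi; rewrite Sq_mulX !IHn ?mulr0 ?addr0 // ltnW.
Qed.

Lemma sqr_hit m : m != 0%MM -> 'X_[m] ^+ 2 \in @hit k.
Proof. by rewrite -mdeg_eq0 -lt0n => m0; rewrite -(proj1 (Sq_top m)) hit_Sq. Qed.

(** Hit polynomials are the sums of elements Sq i g with i > 0, since only the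
    first square of a composite matters. *)
Lemma hit_ind (Q : P -> Prop) : Q 0 -> (forall f g, Q f -> Q g -> Q (f + g)) ->
  (forall i g, (0 < i)%N -> Q (Sq i g)) -> forall f, f \in @hit k -> Q f.
Proof.
move=> Q0 QD QS f /hitP[l lP ->]; rewrite big_seq; apply: (big_ind Q) => // -[[|i I] g] /(allP lP) //=.
by rewrite inE negb_or eq_sym -lt0n => /andP[i0 _]; apply: QS.
Qed.

(** * Hit polynomials modulo lower weight *)

Fixpoint lexlt (s t : seq nat) : bool :=
  match s, t with
  | x :: s', y :: t' => (x < y)%N || ((x == y) && lexlt s' t')
  | _, _ => false
  end.

(** The weight vector of m, cut off at the length of om, precedes om; the tail
    of the weight vector is ignored. *)
Definition lowm (om : seq nat) m : bool := lexlt (mkseq (omega m) (size om)) om.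
Definition low (om : seq nat) f : bool := all (lowm om) (msupp f).

Lemma low0 om : low om 0.
Proof. by rewrite /low -mpolyC0 msupp0. Qed.

Lemma lowD om f g : low om f -> low om g -> low om (f + g).
Proof.
move=> /allP lf /allP lg; apply/allP => m /msuppD_le.
by rewrite mem_cat => /orP[/lf|/lg].
Qed.

Lemma lowX om m : lowm om m -> low om 'X_[m].
Proof. by rewrite /low msuppX /= andbT. Qed.

Definition half m : 'X_{1..k} := [multinom (m j)./2 | j < k].

Lemma alpha0 a : alpha 0 a = odd a. Proof. by rewrite /alpha expn0 divn1 modn2. Qed.
Lemma alphaS i a : alpha i.+1 a = alpha i a./2.
Proof. by rewrite /alpha expnS divnMA divn2. Qed.

Lemma omega0 m : omega m 0 = (\sum_j odd (m j))%N.
Proof. by apply: eq_bigr => j _; rewrite alpha0. Qed.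

Lemma omegaS m i : omega m i.+1 = omega (half m) i.
Proof. by apply: eq_bigr => j _; rewrite alphaS mnmE. Qed.

Definition sqfree m := [forall j, m j <= 1]%N.

Lemma omega_add2 m m' i : sqfree m ->
  omega (m + m' *+ 2)%MM i = if i is i'.+1 then omega m' i' else mdeg m.
Proof.
move/forallP=> m1; case: i => [|i].
  rewrite omega0 mdegE; apply: eq_bigr => j _.
  by rewrite mnmDE mulmnE muln2 oddD odd_double addbF; case: (m j) (m1 j) => [|[]].
rewrite omegaS; apply: eq_bigr => j _; congr alpha.
rewrite mnmE mnmDE mulmnE muln2 halfD odd_double andbF add0n doubleK.
by case: (m j) (m1 j) => [|[]].
Qed.

Lemma lowm_cons om m m' : sqfree m ->
  lowm (mdeg m :: om) (m + m' *+ 2)%MM = lowm om m'.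
Proof.
move=> m1; rewrite /lowm /= omega_add2 // ltnn eqxx /=; congr lexlt.
by rewrite /mkseq (iotaDl 1 0) -map_comp; apply: eq_map => i /=; rewrite omega_add2.
Qed.

Lemma lowm_head om a m : (omega m 0 < a)%N -> lowm (a :: om) m.
Proof. by rewrite /lowm /= => ->. Qed.

(** Hit modulo polynomials whose monomials have weight below om: the
    congruence in which the exchange relations between letters hold. *)
Definition hitlow om f : Prop := exists2 g, g \in @hit k & low om (f + g).

Lemma hitlowD om f g : hitlow om f -> hitlow om g -> hitlow om (f + g).
Proof.
move=> [f' f'h fl] [g' g'h gl]; exists (f' + g'); first exact: rpredD.
by rewrite addrACA; apply: lowD.
Qed.

Lemma hitlow_hit om f : f \in @hit k -> hitlow om f.
Proof. by move=> fh; exists f => //; rewrite mpoly2_addxx low0. Qed.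

Lemma hitlow_low om f : low om f -> hitlow om f.
Proof. by move=> fl; exists 0; rewrite ?rpred0 ?addr0. Qed.

Lemma hitlow_sum (I : eqType) (r : seq I) (Q : pred I) (F : I -> P) om :
  (forall i, i \in r -> Q i -> hitlow om (F i)) -> hitlow om (\sum_(i <- r | Q i) F i).
Proof.
move=> rF; rewrite big_seq_cond; apply: big_ind => [|f g|i /andP[]]; last exact: rF.
  by apply: hitlow_low; rewrite low0.
exact: hitlowD.
Qed.

(** The first weight counts the odd exponents, so this bounds the first weight
    of every monomial. *)
Definition oddle a f := all (fun m => omega m 0 <= a)%N (msupp f).

Lemma oddleD a f g : oddle a f -> oddle a g -> oddle a (f + g).
Proof.
move=> /allP lf /allP lg; apply/allP => m /msuppD_le.
by rewrite mem_cat => /orP[/lf|/lg].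
Qed.

Lemma oddle0 a : oddle a 0. Proof. by rewrite /oddle -mpolyC0 msupp0. Qed.

Lemma omega0_add m m' : (omega (m + m')%MM 0 <= omega m 0 + mdeg m')%N.
Proof.
rewrite !omega0 mdegE -big_split; apply: leq_sum => j _; rewrite mnmDE oddD.
by case: (odd (m j)); case: (m' j) => [|n] //=; rewrite ?leq_b1 //; case: odd.
Qed.

Lemma oddle_mulX a f j : oddle a f -> oddle a.+1 ('X_j * f).
Proof.
move=> /allP lf; apply/allP => m; rewrite mulrC (perm_mem (msuppMX _ _)).
case/mapP=> m' /lf m'a ->; rewrite addmC (leq_trans (omega0_add _ _)) //.
by rewrite mdeg1 addn1.
Qed.

Lemma omega0_even m m' : omega (m + m' *+ 2)%MM 0 = omega m 0.
Proof.
by rewrite !omega0; apply: eq_bigr => j _; rewrite mnmDE mulmnE muln2 oddD odd_double addbF.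
Qed.

Lemma oddle_mulX2 a f m : oddle a f -> oddle a ('X_[m] ^+ 2 * f).
Proof.
move=> /allP lf; apply/allP => m1; rewrite mpolyXn mulrC (perm_mem (msuppMX _ _)).
by case/mapP=> m' /lf m'a ->; rewrite addmC omega0_even.
Qed.

Lemma oddle_mul_sqr a f g : oddle a f -> oddle a (f * g ^+ 2).
Proof.
move=> fa; rewrite [g]mpolyE; elim: (msupp g) => [|m s IH].
  by rewrite big_nil expr2 mulr0 mulr0 oddle0.
rewrite big_cons mpoly2_sqrD mulrDr; apply: oddleD => //.
rewrite mpoly2_coefZ -scalerAr mulrC.
have [->|->] := F2_01 g@_m.
- by rewrite scale0r oddle0.
by rewrite scale1r oddle_mulX2.
Qed.

Lemma sqfreeD j m : sqfree (U_(j) + m) -> sqfree m.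
Proof.
by move=> /forallP h; apply/forallP => l; apply: leq_trans (h l); rewrite mnmDE leq_addl.
Qed.

(** Each unit of degree of the square replaces some variable of a squarefree
    monomial by its square, so every monomial of the result has at least i
    variables fewer with odd exponent. *)
Lemma Sq_sqfree_oddle i m : sqfree m ->
  forall a, (mdeg m <= a + i)%N -> oddle a (Sq i 'X_[m]).
Proof.
elim/mnm_ind: m i => [|j m IH] i m1 a.
  rewrite mpolyX0 Sq_1 => _; case: i => [|i] /=; last exact: oddle0.
  rewrite -[1%:R]/(1%:MP : P) /oddle msupp1 /= omega0 big1 // => j _.
  by rewrite mnm0E.
rewrite mdegD mdeg1 add1n mpolyXD Sq_mulX => ma; apply: oddleD.
  case: a ma => [|a] ma; last by apply/oddle_mulX/IH; [exact: sqfreeD m1|].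
  rewrite (proj2 (Sq_top m)) ?mulr0 ?oddle0 //.
case: i ma => [|i] ma; first exact: oddle0.
by apply/oddle_mulX2/IH; [exact: sqfreeD m1|rewrite addnS in ma].
Qed.

Lemma low_mul_sqr om m f : sqfree m -> low om f -> low (mdeg m :: om) ('X_[m] * f ^+ 2).
Proof.
move=> m1 lf; rewrite [f]mpolyE big_seq.
have : {subset msupp f <= lowm om} by move/allP: lf.
elim: (msupp f) => [|m' s IH] sl.
  by rewrite big_nil expr2 mulr0 mulr0 low0.
rewrite -big_seq big_cons mpoly2_sqrD mulrDr; apply: lowD; last first.
  by rewrite big_seq; apply: IH => x xs; apply: sl; rewrite inE xs orbT.
rewrite mpoly2_coefZ -scalerAr mpolyXn -mpolyXD.
have [->|->] := F2_01 f@_m'.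
- by rewrite scale0r low0.
rewrite scale1r lowX // lowm_cons //; apply: sl; exact: mem_head.
Qed.

(** Prepending a squarefree letter preserves the congruence. If f = Sq^i g,
    then Sq^(2i) of X_m g^2 is X_m f^2 plus terms in which a positive square
    acts on X_m, and these have fewer odd exponents. *)
Lemma hitlow_cons om m f : sqfree m -> hitlow om f -> hitlow (mdeg m :: om) ('X_[m] * f ^+ 2).
Proof.
move=> m1 [g gh fgl].
have -> : f = (f + g) + g by rewrite -addrA mpoly2_addxx addr0.
rewrite mpoly2_sqrD mulrDr; apply: hitlowD; first exact/hitlow_low/low_mul_sqr.
elim/hit_ind: g / gh {fgl} => [|g g' gl g'l|i g i0].
- by apply: hitlow_low; rewrite expr2 mulr0 mulr0 low0.
- by rewrite mpoly2_sqrD mulrDr; apply: hitlowD.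
have := Sq_Cartan (2 * i) 'X_[m] (g ^+ 2).
rewrite big_ord_recl /= Sq0 subn0 Sq_sqr mul2n odd_double doubleK => e.
(* the first term of the Cartan formula is X_m (Sq^i g)^2 *)
exists (Sq i.*2 ('X_[m] * g ^+ 2)); first by apply: hit_Sq; rewrite double_gt0.
rewrite e addrA mpoly2_addxx add0r.
apply: (big_ind (low (mdeg m :: om))) => [|f1 f2|j _]; [exact: low0|exact: lowD|].
have [m0|m0] := posnP (mdeg m).
  by rewrite (proj2 (Sq_top m)) ?m0 // mul0r low0.
have lowle h : oddle (mdeg m).-1 h -> low (mdeg m :: om) h.
  move=> /allP hm; apply/allP => m' /hm m'm; apply: lowm_head.
  by rewrite -ltnS prednK in m'm.
rewrite Sq_sqr; case: ifP => _; first by rewrite mulr0 low0.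
apply/lowle/oddle_mul_sqr/Sq_sqfree_oddle => //.
by rewrite /bump /= add1n addnS -addSn prednK // leq_addr.
Qed.
End SteenrodTools.

(** * Derivatives, spikes and linear substitutions *)

Section Derivative.
Variable k : nat.
Local Notation Pk := {mpoly 'F_2[k]}.
Implicit Types f g : Pk.

Lemma linear_mpolyE (V : lmodType 'F_2) (F G : {linear Pk -> V}) :
  (forall m, F 'X_[m] = G 'X_[m]) -> F =1 G.
Proof.
move=> FG f; rewrite [f]mpolyE !linear_sum; apply: eq_bigr => m _.
by rewrite !linearZ /= FG.
Qed.

Lemma mderiv_mulX2 i j g : mderiv i ('X_j ^+ 2 * g) = 'X_j ^+ 2 * mderiv i g.
Proof.
rewrite mderivM expr2 mderivM [mderiv i 'X_j * 'X_j]mulrC mpoly2_addxx mul0r.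
by rewrite add0r.
Qed.

Lemma mderiv_U i j : mderiv i ('X_j : Pk) = (i == j)%:R.
Proof.
rewrite mderivX mnm1E eq_sym; case: eqP => [->|_]; last by rewrite scale0r.
rewrite scale1r (_ : (U_(j) - U_(j) = 0)%MM) ?mpolyX0 //.
by apply/mnmP => l; rewrite mnmBE subnn mnm0E.
Qed.

(** Partial derivatives commute with the squares because the derivative of x_j
    + x_j^2 X is again 1. *)
Lemma Sq_mderiv i j f : mderiv j (Sq i f) = Sq i (mderiv j f).
Proof.
apply: (linear_mpolyE (F := mderiv j \o Sq i) (G := Sq i \o mderiv j)) => m /=.
elim/mnm_ind: m i => [|l m IH] i.
  rewrite mpolyX0 Sq_1 -[1](mpolyC1) mderivC linear0.
  by case: i => [|i]; rewrite ?mderivC // linear0.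
have SqC (b : bool) g : Sq i (b%:R * g) = b%:R * Sq i g.
  by case: b; rewrite ?mul1r // !mul0r linear0.
rewrite mpolyXD Sq_mulX mderivD !mderivM mderiv_U linearD /= SqC Sq_mulX IH addrA.
congr (_ + _); case: i {SqC} => [|i]; first by rewrite linear0.
by rewrite mderiv_mulX2 IH.
Qed.

Lemma phi_mul_sqr f g : phi (f * g ^+ 2) = phi f * g.
Proof.
rewrite [g]mpolyE; elim: (msupp g) => [|m s IH].
  by rewrite big_nil expr2 !mulr0 linear0.
rewrite big_cons mpoly2_sqrD !mulrDr linearD /= IH; congr (_ + _).
rewrite mpoly2_coefZ -!scalerAr linearZ /=; congr (_ *: _).
elim/mnm_ind: m f {IH} => [|j m IH] f; first by rewrite mpolyX0 expr1n !mulr1.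
by rewrite mpolyXD exprMn mulrA IH [f * _]mulrC phi_sqX -mulrA mulrCA.
Qed.

Definition spike c : 'X_{1..k} := [multinom (2 ^ c - 1)%N | j < k].

Lemma spike0 : spike 0 = 0%MM.
Proof. by apply/mnmP => j; rewrite !mnmE. Qed.

Lemma mcoeff_spikeS c f : f@_(spike c.+1) = (phi f)@_(spike c).
Proof.
rewrite mcoeff_phi; congr (_@_ _); apply/mnmP => j; rewrite !mnmE expnS.
by have := expn_gt0 2 c; lia.
Qed.

(** The Kameko map lowers a spike to the next smaller one and preserves hit
    polynomials, which reduces the claim to the constant coefficient; a
    positive square has none. *)
Lemma spike_hit c f : f \in @hit k -> f@_(spike c) = 0.
Proof.
move=> fh; elim/hit_ind: f / fh => [|f g f0 g0|i g]; first exact: mcoeff0.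
  by rewrite mcoeffD f0 g0 addr0.
elim: c i g => [|c IH] i g i0; last first.
  rewrite mcoeff_spikeS phi_Sq; case: ifP => io; first exact: mcoeff0.
  by apply: IH; case: i i0 io => [|[|i]].
rewrite [g]mpolyE linear_sum raddf_sum big1 // => m _.
rewrite linearZ /= mcoeffZ (dhomog_nemf_coeff (Sq_homog i m)) ?mulr0 //.
by rewrite spike0 /= mdeg0 eq_sym addn_eq0 negb_and -!lt0n i0 orbT.
Qed.
End Derivative.

Lemma rmorph_mpoly2_ext k (R : nzRingType) (F G : {rmorphism {mpoly 'F_2[k]} -> R}) :
  (forall j, F 'X_j = G 'X_j) -> F =1 G.
Proof.
move=> FG; have FX m : F 'X_[m] = G 'X_[m].
  elim/mnm_ind: m => [|j m IH]; first by rewrite mpolyX0 !rmorph1.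
  by rewrite mpolyXD (rmorphM F) (rmorphM G) FG IH.
move=> f; rewrite [f]mpolyE !raddf_sum; apply: eq_bigr => m _.
have [->|->] := F2_01 f@_m.
- by rewrite !scale0r !raddf0.
by rewrite !scale1r; apply: FX.
Qed.

Section Substitution.
Variables (k l : nat) (h : 'I_k -> {mpoly 'F_2[l]}).
Local Notation Pk := {mpoly 'F_2[k]}.
Local Notation Pl := {mpoly 'F_2[l]}.

Definition subst (f : Pk) : Pl := mmap (@mpolyC l 'F_2) h f.
HB.instance Definition _ := GRing.RMorphism.copy subst (mmap (@mpolyC l 'F_2) h).

Lemma substX j : subst 'X_j = h j.
Proof. by rewrite /subst mmapX mmap1U. Qed.

Lemma substZ c f : subst (c *: f) = c *: subst f.
Proof. by rewrite /subst mmapZ mul_mpolyC. Qed.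

Lemma subst0 : subst 0 = 0. Proof. exact: rmorph0. Qed.
Lemma subst1 : subst 1 = 1. Proof. exact: rmorph1. Qed.
Lemma substD f g : subst (f + g) = subst f + subst g. Proof. exact: rmorphD. Qed.
Lemma substM f g : subst (f * g) = subst f * subst g. Proof. exact: rmorphM. Qed.
Lemma subst_sqr f : subst (f ^+ 2) = subst f ^+ 2. Proof. exact: rmorphXn. Qed.

Hypothesis h_lin : forall j, Sqt (h j) = (h j)%:P + ((h j) ^+ 2)%:P * 'X.
Hypothesis h_homog : forall j, h j \is 1.-homog.

(** A substitution by linear forms commutes with the total square: both sides
    are ring morphisms, so only the variables have to be compared. *)
Lemma Sqt_subst f : Sqt (subst f) = map_poly subst (Sqt f).
Proof.
pose F : {rmorphism Pk -> {poly Pl}} := @Sqt l \o subst.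
pose G : {rmorphism Pk -> {poly Pl}} := map_poly subst \o @Sqt k.
apply: (rmorph_mpoly2_ext (F := F) (G := G)) => j.
change (Sqt (subst 'X_j) = map_poly subst (Sqt 'X_j)).
have eD (p q : {poly Pk}) : map_poly subst (p + q) = map_poly subst p + map_poly subst q.
  exact: rmorphD.
have eM (p q : {poly Pk}) : map_poly subst (p * q) = map_poly subst p * map_poly subst q.
  exact: rmorphM.
by rewrite substX h_lin SqtX eD eM map_polyX !map_polyC /= subst_sqr substX.
Qed.

Lemma Sq_subst i f : Sq i (subst f) = subst (Sq i f).
Proof. by rewrite /Sq Sqt_subst coef_map. Qed.

Lemma subst_hit f : f \in @hit k -> subst f \in @hit l.
Proof.
move=> fh; elim/hit_ind: f / fh => [|g g' gh g'h|i g i0]; first by rewrite subst0 rpred0.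
  by rewrite substD; exact: rpredD gh g'h.
by rewrite -Sq_subst hit_Sq.
Qed.

Lemma subst_homog m : subst 'X_[m] \is (mdeg m).-homog.
Proof.
elim/mnm_ind: m => [|j m IH]; first by rewrite mpolyX0 subst1 mdeg0 dhomog1.
by rewrite mpolyXD substM substX mdegD mdeg1; apply: dhomogM.
Qed.
End Substitution.

(** On linear forms squaring is additive, so their total square is as for a
    variable. *)
Lemma Sqt_linear_form l (h : {mpoly 'F_2[l]}) (r : seq 'I_l) (Q : pred 'I_l) :
  h = \sum_(i <- r | Q i) 'X_i ->
  Sqt h = h%:P + (h ^+ 2)%:P * 'X /\ h \is 1.-homog.
Proof.
move=> ->; elim: r => [|i r [IH1 IH2]].
  by rewrite big_nil raddf0 expr2 mulr0 polyC0 mul0r addr0 dhomog0.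
rewrite big_cons; case: (Q i); last by split; [exact: IH1|exact: IH2].
split; last by apply: dhomogD IH2; rewrite dhomogX /= mdeg1.
have SqtD (f g : {mpoly 'F_2[l]}) : Sqt (f + g) = Sqt f + Sqt g by exact: rmorphD.
rewrite SqtD IH1 SqtX mpoly2_sqrD !polyCD mulrDl.
exact: addrACA.
Qed.

(** * The monomial order and admissible monomials *)

Lemma lexlt_trans s t u : lexlt s t -> lexlt t u -> lexlt s u.
Proof.
elim: s t u => [|x s IH] [|y t] [|z u] //=.
case/orP=> [xy|/andP[/eqP-> st]] /orP[yz|/andP[/eqP<- tu]].
- by rewrite (ltn_trans xy yz).
- by rewrite xy.
- by rewrite yz.
by rewrite eqxx (IH _ _ st tu) orbT.
Qed.

(** A number whose base b + 1 digits are the entries; on sequences bounded by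
    b it is monotone for the lexicographic order, which makes well-founded
    induction available. *)
Definition lexkey (b : nat) (s : seq nat) : nat := foldl (fun k a => k * b.+1 + a)%N 0%N s.

Lemma lexlt_key b s t : size s = size t -> all (leq^~ b) s -> lexlt s t ->
  (lexkey b s < lexkey b t)%N.
Proof.
rewrite /lexkey.
suff h k l : size s = size t -> all (leq^~ b) s ->
   ((k < l)%N \/ k = l /\ lexlt s t) ->
   (foldl (fun k a => k * b.+1 + a) k s < foldl (fun k a => k * b.+1 + a) l t)%N.
  by move=> st sb lt; apply: h => //; right.
elim: s t k l => [|x s IH] [|y t] k l //=; first by move=> _ _ [|[]].
move=> [st] /andP[xb sb] h; apply: IH => //.
case: h => [kl|[-> /orP[xy|/andP[/eqP-> h]]]]; [left|left; lia|by right].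
have : (k.+1 * b.+1 <= l * b.+1)%N by rewrite leq_mul2r kl orbT.
lia.
Qed.

Lemma lexltP s t : size s = size t ->
  lexlt s t <-> exists i, [/\ (i < size s)%N, forall l, (l < i)%N -> nth 0%N s l = nth 0%N t l
                            & (nth 0%N s i < nth 0%N t i)%N].
Proof.
elim: s t => [|x s IH] [|y t] //=; first by split=> // -[i []].
move=> [st]; split.
  case/orP=> [xy|/andP[/eqP-> /(IH t st)[i [si e lt]]]]; first by exists 0%N.
  by exists i.+1; split=> // -[|l] //; apply: e.
move=> [[|i] [si e lt]]; first by rewrite lt.
have -> : x = y := e 0%N isT.
rewrite eqxx ltnn /=; apply/(IH t st); exists i; split=> // l li; exact: (e l.+1).
Qed.

Lemma lexlt_total s t : size s = size t -> [|| s == t, lexlt s t | lexlt t s].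
Proof.
elim: s t => [|x s IH] [|y t] //= [/IH st]; rewrite eqseq_cons.
by case: (ltngtP x y) st => //= _; rewrite orbF.
Qed.

Section MonomialOrder.
Variables k D : nat.
Implicit Types x y z : 'X_{1..k}.

(** Weight vector followed by exponent vector: the monomial order is the
    lexicographic order of these sequences. D entries of the weight vector
    suffice in degree D because D < 2^D. *)
Definition mon_seq x : seq nat := mkseq (omega x) D ++ [seq x j | j <- enum 'I_k].

Lemma size_mon_seq x : size (mon_seq x) = (D + k)%N.
Proof. by rewrite size_cat size_mkseq size_map size_enum_ord. Qed.

Lemma nth_mon_seq_omega x i : (i < D)%N -> nth 0%N (mon_seq x) i = omega x i.
Proof. by move=> iD; rewrite nth_cat size_mkseq iD nth_mkseq. Qed.

Lemma nth_mon_seq_sigma x (j : 'I_k) : nth 0%N (mon_seq x) (D + j) = x j.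
Proof.
rewrite nth_cat size_mkseq ltnNge leq_addr /= addKn (nth_map j) ?size_enum_ord //.
by rewrite nth_ord_enum.
Qed.

Lemma mnm_le_deg x j : (x j <= mdeg x)%N.
Proof. by rewrite mdegE (bigD1 j) //= leq_addr. Qed.

Lemma omega_large x i : mdeg x = D -> (D <= i)%N -> omega x i = 0%N.
Proof.
move=> xD Di; rewrite /omega big1 // => j _; rewrite /alpha divn_small //.
by apply: (@leq_trans (2 ^ D)); rewrite ?leq_pexp2l // (leq_ltn_trans (mnm_le_deg x j)) // xD ltn_expl.
Qed.

Lemma mon_seq_inj x y : mon_seq x = mon_seq y -> x = y.
Proof. by move=> e; apply/mnmP => j; rewrite -!nth_mon_seq_sigma e. Qed.

Lemma mon_ltE x y : mdeg x = D -> mdeg y = D -> mon_lt x y <-> lexlt (mon_seq x) (mon_seq y).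
Proof.
move=> xD yD; have st : size (mon_seq x) = size (mon_seq y) by rewrite !size_mon_seq.
split.
  move=> h; apply/(lexltP st); case: h => [[i [e lt]]|[e [i [e' lt]]]].
    have iD : (i < D)%N.
      by rewrite ltnNge; apply/negP => Di; rewrite (omega_large yD Di) in lt.
    exists i; split=> [|l li|]; rewrite ?size_mon_seq.
    - exact: ltn_addr.
    - by rewrite !nth_mon_seq_omega ?(ltn_trans li iD) ?e.
    - by rewrite !nth_mon_seq_omega.
  exists (D + i)%N; split=> [|l li|]; rewrite ?size_mon_seq ?ltn_add2l ?nth_mon_seq_sigma //.
  have [lD|Dl] := ltnP l D; first by rewrite !nth_mon_seq_omega ?e.
  have li' : (l - D < i)%N by rewrite ltn_subLR.
  have := e' (Ordinal (ltn_trans li' (ltn_ord i))) li'.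
  by rewrite -!nth_mon_seq_sigma /= subnKC.
case/(lexltP st)=> i [+ e lt]; rewrite size_mon_seq => iDk.
have [iD|Di] := ltnP i D.
  left; exists i; rewrite -!nth_mon_seq_omega //; split=> // l li.
  by rewrite -!nth_mon_seq_omega ?e // (ltn_trans li).
have ik : (i - D < k)%N by rewrite ltn_subLR.
right; split=> [l|].
  have [lD|Dl] := ltnP l D; last by rewrite !omega_large.
  by rewrite -!nth_mon_seq_omega // e // (leq_trans lD).
exists (Ordinal ik); split=> [l /= li|].
  by rewrite -!nth_mon_seq_sigma e // -ltn_subRL.
by rewrite -!nth_mon_seq_sigma /= subnKC.
Qed.

Definition mon_key x := lexkey (D + k) (mon_seq x).

Lemma mon_lt_key x y : mdeg x = D -> mdeg y = D -> mon_lt x y -> (mon_key x < mon_key y)%N.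
Proof.
move=> xD yD /(mon_ltE xD yD); apply: lexlt_key; first by rewrite !size_mon_seq.
rewrite all_cat; apply/andP; split; apply/allP => a /mapP[i _ ->] /=.
  apply: (@leq_trans k); last exact: leq_addl.
  apply: (@leq_trans (\sum_(j < k) 1)%N); last by rewrite sum_nat_const card_ord muln1.
  by apply: leq_sum => j _; rewrite /alpha -ltnS ltn_mod.
by apply: leq_trans (mnm_le_deg x i) _; rewrite xD leq_addr.
Qed.

Lemma mon_lt_trans x y z : mdeg x = D -> mdeg y = D -> mdeg z = D ->
  mon_lt x y -> mon_lt y z -> mon_lt x z.
Proof.
move=> xD yD zD /(mon_ltE xD yD) xy /(mon_ltE yD zD) yz.
by apply/(mon_ltE xD zD); apply: lexlt_trans xy yz.
Qed.

Lemma mon_lt_total x y : mdeg x = D -> mdeg y = D -> x != y -> mon_lt x y \/ mon_lt y x.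
Proof.
move=> xD yD xy; have st : size (mon_seq x) = size (mon_seq y) by rewrite !size_mon_seq.
case/or3P: (lexlt_total st) => [/eqP/mon_seq_inj e|h|h].
- by rewrite e eqxx in xy.
- by left; apply/(mon_ltE xD yD).
- by right; apply/(mon_ltE yD xD).
Qed.

Definition below x y := y = x \/ mon_lt y x.

(** Rewriting an inadmissible monomial by smaller ones ends by induction on
    the key, and never leaves the monomials below x. *)
Lemma admissible_span x : mdeg x = D -> exists2 r : seq 'X_{1..k},
  {in r, forall y, [/\ mdeg y = D, admissible y & below x y]} &
  'X_[x] - \sum_(y <- r) 'X_[y] \in @hit k.
Proof.
have [c] := ubnP (mon_key x); elim: c => // c IH in x *; rewrite ltnS => xc xD.
have [xa|] := boolp.EM (admissible x).
  exists [:: x]; last by rewrite big_seq1 subrr rpred0.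
  by move=> y; rewrite inE => /eqP->; split=> //; left.
move=> /boolp.contrapT[ys [ysx xh]]; rewrite xD in ysx.
suff [r rP rh] : exists2 r : seq 'X_{1..k},
    {in r, forall y, [/\ mdeg y = D, admissible y & mon_lt y x]} &
    \sum_(y <- ys) 'X_[y] - \sum_(y <- r) 'X_[y] \in @hit k.
  exists r; first by move=> y /rP[yD ya yx]; split=> //; right.
  rewrite -[X in X - _](subrK (\sum_(y <- ys) 'X_[y])) -addrA; exact: rpredD xh rh.
elim: ys ysx {xh} => [|y ys IHy] ysx.
  by exists [::] => //; rewrite !big_nil subrr rpred0.
have [yD yx] := ysx y (mem_head _ _).
have [r1 r1P r1h] := IH y (leq_trans (mon_lt_key yD xD yx) xc) yD.
have [r2 r2P r2h] := IHy (fun z zy => ysx z (mem_behead (s := y :: ys) zy)).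
exists (r1 ++ r2).
  move=> z; rewrite mem_cat => /orP[/r1P[zD za zy]|/r2P//].
  split=> //; case: zy => [->//|zy]; exact: mon_lt_trans zD yD xD zy yx.
by rewrite big_cons big_cat opprD addrACA; exact: rpredD r1h r2h.
Qed.

Lemma max_key (r : seq 'X_{1..k}) : r != [::] ->
  exists2 x, x \in r & {in r, forall y, (mon_key y <= mon_key x)%N}.
Proof.
elim: r => // x [|y r] IH _.
  by exists x; [exact: mem_head | move=> z; rewrite inE => /eqP->].
have [//|z zr zP] := IH.
have [xz|zx] := leqP (mon_key x) (mon_key z).
  exists z; first by rewrite in_cons zr orbT.
  by move=> t; rewrite in_cons => /orP[/eqP->|/zP].
exists x; first exact: mem_head.
by move=> t; rewrite in_cons => /orP[/eqP->//|/zP tz]; apply: leq_trans tz (ltnW zx).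
Qed.

(** Otherwise the largest monomial of the sum would be congruent to the sum of
    the others, hence inadmissible. *)
Lemma admissible_free (r : seq 'X_{1..k}) : uniq r -> r != [::] ->
  {in r, forall x, mdeg x = D /\ admissible x} -> \sum_(x <- r) 'X_[x] \notin @hit k.
Proof.
move=> ru r0 rP; have [x xr xmax] := max_key r0; have [xD xa] := rP x xr.
apply/negP => h; apply: xa; exists (rem x r); split; last first.
  by rewrite mpoly2_oppr; move: h; rewrite (perm_big _ (perm_to_rem xr)) big_cons.
move=> y; rewrite mem_rem_uniq // inE => /andP[yx yr]; have [yD _] := rP y yr.
rewrite yD xD; split=> //; have [//|lt] := mon_lt_total yD xD yx.
by have := mon_lt_key xD yD lt; rewrite ltnNge xmax.
Qed.
End MonomialOrder.

(** * Homogeneous parts and the kernel of the Kameko map *)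

Section HomogeneousParts.
Variable k : nat.
Local Notation P := {mpoly 'F_2[k]}.
Implicit Types (f g h : P) (m x y : 'X_{1..k}).

Lemma Sq_pihomog e i f : pihomog mdeg (e + i)%N (Sq i f) = Sq i (pihomog mdeg e f).
Proof.
apply: (linear_mpolyE (F := pihomog mdeg (e + i)%N \o Sq i) (G := Sq i \o pihomog mdeg e)) => m /=.
rewrite pihomogX; case: eqP => [<-|/eqP me]; first by rewrite pihomog_dE ?Sq_homog.
by rewrite linear0 (@pihomog_ne0 _ _ _ (mdeg m + i)%N) ?Sq_homog // eqn_add2r.
Qed.

Lemma pihomog_Sq_small e i f : (e < i)%N -> pihomog mdeg e (Sq i f) = 0.
Proof.
move=> ei; apply: (linear_mpolyE (F := pihomog mdeg e \o Sq i) (G := GRing.null_fun _)) => m /=.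
rewrite (@pihomog_ne0 _ _ _ (mdeg m + i)%N) ?Sq_homog //.
by apply: contraTneq ei => <-; rewrite -leqNgt leq_addl.
Qed.

(** The squares are homogeneous, so the homogeneous parts of a hit polynomial
    are hit. *)
Lemma hit_pihomog e f : f \in @hit k -> pihomog mdeg e f \in @hit k.
Proof.
move=> fh; elim/hit_ind: f / fh e => [|f g fh gh|i g i0] e.
- by rewrite linear0 rpred0.
- by rewrite linearD; exact: rpredD (fh e) (gh e).
have [ei|ie] := ltnP e i; first by rewrite pihomog_Sq_small // rpred0.
by rewrite -(subnK ie) Sq_pihomog hit_Sq.
Qed.

Lemma lowZ om (c : 'F_2) f : low om f -> low om (c *: f).
Proof. by have [->|->] := F2_01 c; rewrite ?scale1r // scale0r low0. Qed.

Lemma low_sum (I : eqType) (r : seq I) (Q : pred I) (F : I -> P) om :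
  {in r, forall i, Q i -> low om (F i)} -> low om (\sum_(i <- r | Q i) F i).
Proof.
move=> rF; rewrite big_seq_cond.
apply: (big_ind (fun f => low om f)) => [|f g|i /andP[ir Qi]]; last exact: rF ir Qi.
  exact: low0.
exact: lowD.
Qed.

Lemma low_pihomog om e f : low om f -> low om (pihomog mdeg e f).
Proof.
move=> /allP lf; rewrite pihomogE; apply: low_sum => m /lf ml _.
exact/lowZ/lowX.
Qed.

Lemma mpoly2E f : f = \sum_(m <- msupp f) 'X_[m].
Proof.
rewrite {1}[f]mpolyE; apply: eq_big_seq => m; rewrite mcoeff_msupp => m0.
by have [e|->] := F2_01 f@_m; [rewrite e eqxx in m0 | rewrite scale1r].
Qed.
End HomogeneousParts.

Section KamekoReduction.
Variable k : nat.
Local Notation P := {mpoly 'F_2[k]}.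
Implicit Types (f g h : P) (m x y : 'X_{1..k}).

Definition ones : 'X_{1..k} := [multinom 1%N | j < k].

Lemma sqfree_ones : sqfree ones.
Proof. by apply/forallP => j; rewrite mnmE. Qed.

Lemma mdeg_ones : mdeg ones = k.
Proof.
rewrite mdegE (eq_bigr (fun=> 1%N)) => [|j _]; last by rewrite mnmE.
by rewrite sum_nat_const card_ord muln1.
Qed.

Lemma omega0_all_odd m : (omega m 0 < k)%N = ~~ [forall j, odd (m j)].
Proof.
rewrite ltnNge; congr negb; apply/idP/forallP => [h j|h].
  apply: contraTT h => /negPf mj; rewrite -ltnNge omega0.
  apply: (@leq_trans (\sum_(i < k) 1)%N); last by rewrite sum_nat_const card_ord muln1.
  rewrite (bigD1 j) //= [X in (_ < X)%N](bigD1 j) //= mj add0n add1n ltnS.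
  by apply: leq_sum => i _; apply: leq_b1.
rewrite omega0 (eq_bigr (fun=> 1%N)) => [|j _]; last by rewrite h.
by rewrite sum_nat_const card_ord muln1.
Qed.

(** The monomials seen by phi are those of the form x_1 ... x_k y^2; these are
    recovered from their image. *)
Lemma ones_sqr_phi m : 'X_[ones] * phi 'X_[m] ^+ 2 = if [forall j, odd (m j)] then 'X_[m] else 0.
Proof.
rewrite phiX /phi_mon; case: ifP => [/forallP mo|_]; last by rewrite expr2 !mulr0.
rewrite mpolyXn -mpolyXD; congr 'X_[_]; apply/mnmP => j.
by rewrite mnmDE mulmnE !mnmE -[RHS]odd_double_half (mo j) muln2.
Qed.

Lemma low_phi_zero f : low [:: k] (f + 'X_[ones] * phi f ^+ 2).
Proof.
have phiD g h : phi (g + h) = phi g + phi h by exact: linearD.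
rewrite [f]mpoly2E; elim: (msupp f) => [|m s IH].
  by rewrite big_nil linear0 expr2 !mulr0 addr0 low0.
rewrite big_cons phiD mpoly2_sqrD mulrDr addrACA; apply: lowD => //.
rewrite ones_sqr_phi; case: ifP => [_|mo]; first by rewrite mpoly2_addxx low0.
by rewrite addr0; apply/lowX/lowm_head; rewrite omega0_all_odd mo.
Qed.

(** The all-odd part of f is x_1 ... x_k (phi f)^2; when phi f is hit, it is
    hit modulo monomials with an even exponent by [hitlow_cons]. *)
Lemma phi_hit_low f : phi f \in @hit k -> hitlow [:: k] f.
Proof.
move=> ph; rewrite -[f]addr0 -(mpoly2_addxx ('X_[ones] * phi f ^+ 2)) addrA.
apply: hitlowD; first exact/hitlow_low/low_phi_zero.
by rewrite -[X in [:: X]]mdeg_ones; apply: hitlow_cons sqfree_ones _; apply: hitlow_hit.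
Qed.

Lemma lowm1 m : lowm [:: k] m = (omega m 0 < k)%N.
Proof. by rewrite /lowm /= andbF orbF. Qed.

Lemma phi_hit_homog e f : f \is e.-homog -> phi f \in @hit k ->
  exists g, [/\ g \is e.-homog, low [:: k] g & f - g \in @hit k].
Proof.
move=> fe /phi_hit_low[g gh gl]; exists (pihomog mdeg e (f + g)); split.
- exact: pihomogP.
- exact: low_pihomog.
by rewrite linearD /= pihomog_dE // opprD addrA subrr add0r rpredN hit_pihomog.
Qed.

(** An all-odd monomial in the kernel would be congruent to monomials with
    fewer odd exponents, which are smaller in the order. *)
Lemma admissible_kernel x : admissible x -> phi 'X_[x] \in @hit k -> (omega x 0 < k)%N.
Proof.
move=> xa xh; rewrite ltnNge; apply/negP => kx; apply: xa.
have xX : ('X_[x] : P) \is (mdeg x).-homog by rewrite dhomogX; apply/eqP.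
have [g [gx /allP gl fg]] := phi_hit_homog xX xh.
exists (msupp g); split; last by rewrite -mpoly2E.
move=> y yg; split; first exact: dhomog_mf gx _ yg.
left; exists 0%N; split=> //; apply: leq_trans kx.
by have := gl y yg; rewrite lowm1.
Qed.

End KamekoReduction.

Section QuotientClasses.
Variables k D : nat.
Local Notation P := {mpoly 'F_2[k]}.
Implicit Types (f g h : P) (m x y : 'X_{1..k}).

Fact qcls_proof f : cls (pihomog mdeg D f) \in @in_deg k D.
Proof. by apply/in_degP; exists (pihomog mdeg D f) => //; apply: pihomogP. Qed.

(** The class of the component of degree D, which makes the map to (QP_k)_D
    total and linear. *)
Definition qcls f : QPdeg k D := MkQPdeg (qcls_proof f).

Fact qcls_is_linear : linear qcls.
Proof. by move=> a f g; apply: val_inj; rewrite /= !linearP. Qed.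
HB.instance Definition _ := GRing.isLinear.Build _ _ _ _ qcls qcls_is_linear.

Lemma qcls_eq0 f : f \is D.-homog -> qcls f = 0 <-> f \in @hit k.
Proof.
move=> fD; split=> [/(congr1 val)/=|fh].
  by rewrite pihomog_dE // => e; rewrite -[f]subr0; apply/cls_eq; rewrite e linear0.
apply: val_inj; rewrite /= pihomog_dE // -[RHS](linear0 (@cls k)).
by apply/cls_eq; rewrite subr0.
Qed.

Lemma qcls_hit f : f \in @hit k -> qcls f = 0.
Proof.
move=> fh; apply: val_inj; rewrite /= -[RHS](linear0 (@cls k)).
by apply/cls_eq; rewrite subr0 hit_pihomog.
Qed.

Lemma qcls_surj c : exists2 f, f \is D.-homog & c = qcls f.
Proof.
have [f fD cf] := in_degP _ _ (QPdeg_valP c).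
by exists f => //; apply: val_inj; rewrite /= pihomog_dE.
Qed.

Lemma qclsXE x : mdeg x = D -> qcls 'X_[x] = cls 'X_[x] :> QP k.
Proof. by move=> xD; rewrite /= pihomog_dE // dhomogX; apply/eqP. Qed.
End QuotientClasses.

(** * A basis of the kernel by admissible monomials *)

Section KernelBasis.
Variables k m0 : nat.
Let D := (2 * m0 + k)%N.
Local Notation P := {mpoly 'F_2[k]}.
Implicit Types (f g : P) (x y : 'X_{1..k}).

(** omega x 0 < k says that some exponent of x is even; for an admissible
    monomial this is the condition to lie in the kernel. *)
Definition adm : seq 'X_{1..k} :=
  [seq x <- [seq bmnm y | y : 'X_{1..k < D.+1}] |
   [&& mdeg x == D, (omega x 0 < k)%N & boolp.asbool (admissible x)]].

Lemma uniq_adm : uniq adm.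
Proof.
apply: filter_uniq; rewrite map_inj_uniq ?enum_uniq //.
exact: val_inj.
Qed.

Lemma mem_adm x : x \in adm <-> [/\ mdeg x = D, (omega x 0 < k)%N & admissible x].
Proof.
rewrite mem_filter; split=> [/andP[/and3P[/eqP xD xk /boolp.asboolP xa] _]//|[xD xk xa]].
rewrite xD eqxx xk (boolp.asboolT xa) /=; apply/mapP.
have xD' : (mdeg x < D.+1)%N by rewrite xD.
by exists (BMultinom xD'); rewrite ?mem_enum.
Qed.

Lemma XD x : mdeg x = D -> ('X_[x] : P) \is D.-homog.
Proof. by move=> xD; rewrite dhomogX; apply/eqP. Qed.

(** Over F_2 a linear combination is the sum of the monomials with coefficient
    1, so [admissible_free] applies. *)
Lemma adm_comb_hit (c : 'I_(size adm) -> 'F_2) :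
  \sum_i c i *: 'X_[nth 0%MM adm i] \in @hit k -> forall i, c i = 0.
Proof.
move=> h i; apply/eqP/negPn/negP => ci.
pose r := [seq nth 0%MM adm (val i) | i <- enum 'I_(size adm) & c i != 0].
have mem_r x : x \in r -> x \in adm by case/mapP=> j _ ->; exact: mem_nth (ltn_ord j).
have ru : uniq r.
  rewrite map_inj_in_uniq; first exact: filter_uniq (enum_uniq _).
  move=> j l _ _ /eqP.
  by rewrite (nth_uniq _ (ltn_ord j) (ltn_ord l) uniq_adm) => /eqP; apply: val_inj.
have r0 : r != [::].
  have : nth 0%MM adm i \in r.
    by apply/mapP; exists i; rewrite // mem_filter ci mem_enum.
  by case: (r).
have rP : {in r, forall x, mdeg x = D /\ admissible x}.
  by move=> x /mem_r/mem_adm[xD _ xa].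
case/negP: (admissible_free ru r0 rP).
rewrite (_ : \sum_(x <- r) _ = \sum_i c i *: ('X_[nth 0%MM adm i] : P)) //.
rewrite big_map big_filter big_enum_cond [LHS]big_mkcond /=.
by apply: eq_bigr => j _; case: (F2_01 (c j)) => ->; rewrite ?scale0r ?scale1r.
Qed.

Definition kbasis : seq (QPdeg k D) := [seq qcls D 'X_[x] | x <- adm].

Lemma free_kbasis : free kbasis.
Proof.
rewrite -[kbasis]/(val (in_tuple kbasis)).
apply/freeP => c c0 i; have sE : size kbasis = size adm by rewrite size_map.
suff /(_ (cast_ord sE i)) : forall j : 'I_(size adm), c (cast_ord (esym sE) j) = 0.
  by rewrite cast_ordK.
apply: adm_comb_hit; apply/(@qcls_eq0 k D).
  apply: (big_ind (fun f => f \is D.-homog)) => [|f g|j _]; [exact: dhomog0|exact: dhomogD|].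
  by apply/dhomogZ/XD; have /mem_adm[] := mem_nth 0%MM (ltn_ord j).
rewrite linear_sum -[RHS]c0 (reindex (cast_ord (esym sE))) /=; last first.
  by exists (cast_ord sE) => j _; rewrite ?cast_ordK ?cast_ordKV.
apply: eq_bigr => j _; rewrite linearZ; congr (_ *: _).
by rewrite (nth_map 0%MM).
Qed.

Lemma mem_lker c : (c \in lker (kameko_deg k m0)) = (kameko (QPdeg_val c) == 0).
Proof.
rewrite memv_ker; apply/eqP/eqP => [e|e]; first by rewrite -kameko_degE e.
by apply: val_inj; rewrite /= kameko_degE.
Qed.

Lemma qcls_lker f : f \is D.-homog -> (qcls D f \in lker (kameko_deg k m0)) <-> phi f \in @hit k.
Proof.
move=> fD; rewrite mem_lker /= pihomog_dE // kameko_cls.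
rewrite -(linear0 (@cls k)); split=> [/eqP/cls_eq|h]; first by rewrite subr0.
by apply/eqP/cls_eq; rewrite subr0.
Qed.

(** Reduction to admissible monomials does not raise the first weight, so it
    stays among the monomials with an even exponent. *)
Lemma qcls_span x : mdeg x = D -> (omega x 0 < k)%N -> qcls D 'X_[x] \in <<kbasis>>%VS.
Proof.
move=> xD xk; have [r rP rh] := admissible_span xD.
have -> : qcls D 'X_[x] = \sum_(y <- r) qcls D 'X_[y].
  by apply/eqP; rewrite -linear_sum -subr_eq0 -linearB; apply/eqP/qcls_hit.
rewrite big_seq; apply: memv_suml => y /rP[yD ya yx]; apply/memv_span/map_f/mem_adm.
split=> //; case: yx => [->//|]; case=> [[[|i] [e lt]]|[e _]].
- exact: ltn_trans lt xk.
- by rewrite e.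
- by rewrite e.
Qed.

Lemma span_kbasis : <<kbasis>>%VS = lker (kameko_deg k m0).
Proof.
apply/eqP; rewrite eqEsubv; apply/andP; split.
  apply/span_subvP => _ /mapP[x /mem_adm[xD xk _] ->].
  apply/qcls_lker; first exact: XD.
  rewrite phiX /phi_mon ifF ?rpred0 //.
  by apply/negbTE; rewrite -omega0_all_odd.
apply/subvP => c; have [f fD ->] := qcls_surj c.
move/(qcls_lker fD)/(phi_hit_homog fD)=> [g [gD /allP gl fg]].
have -> : qcls D f = qcls D g.
  by apply/eqP; rewrite -subr_eq0 -linearB; apply/eqP/qcls_hit.
rewrite [g]mpoly2E linear_sum big_seq; apply: memv_suml => y yg.
apply: qcls_span; first exact: dhomog_mf gD _ yg.
by have := gl y yg; rewrite lowm1.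
Qed.

(** An admissible monomial whose class is in the kernel has an even exponent,
    so it already belongs to the basis. *)
Lemma mem_kbasis c : c \in kbasis <->
  c \in lker (kameko_deg k m0) /\
  exists x, [/\ mdeg x = D, admissible x & c = cls 'X_[x] :> QP k].
Proof.
split=> [ck|[ck [x [xD xa cx]]]].
  split; first by rewrite -span_kbasis memv_span.
  by have /mapP[x /mem_adm[xD _ xa] ->] := ck; exists x; split=> //; apply: qclsXE.
have cE : c = qcls D 'X_[x] by apply: val_inj; rewrite [RHS]qclsXE.
rewrite cE; apply/map_f/mem_adm; split=> //.
by apply: admissible_kernel xa _; apply/(qcls_lker (XD xD)); rewrite -cE.
Qed.

Lemma dim_kbasis : \dim (lker (kameko_deg k m0)) = size adm.
Proof. by rewrite -span_kbasis; have /eqP -> := free_kbasis; rewrite size_map. Qed.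
End KernelBasis.

(** * Certified elimination over the field with two elements *)

Section Elimination.
Variables (T : eqType) (key : T -> positive).

(** A vector over F_2 as the list of its nonzero coordinates, by decreasing
    key; the key of an element is stored next to it, and addition is a merge.
    *)
Definition row := seq (positive * T).

Fixpoint row_add (r1 : row) : row -> row :=
  match r1 with
  | [::] => id
  | x1 :: r1' => fix add1 (r2 : row) : row :=
      match r2 with
      | [::] => r1
      | x2 :: r2' =>
        match Pos.compare x1.1 x2.1 with
        | Lt => x2 :: add1 r2'
        | Gt => x1 :: row_add r1' r2
        | Eq => if x1.2 == x2.2 then row_add r1' r2' else x1 :: row_add r1' r2
        end
      end
  end.

Definition row_of (s : seq T) : row :=
  foldr (fun t => row_add [:: (key t, t)]) [::] s.

(** Reduction of a vector by the pivots; the fuel bounds the number of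
    reduction steps, and running out of it only weakens the result, since
    every step preserves the value of any function that kills the pivots. *)
Fixpoint row_nf (fuel : nat) (piv : PositiveMap.t row) (r : row) : row :=
  if fuel isn't fuel'.+1 then r else
  if r isn't x :: r' then [::] else
  if PositiveMap.find x.1 piv is Some p then row_nf fuel' piv (row_add r p)
  else x :: row_nf fuel' piv r'.

Definition fuel : nat := 2000.

Definition nf (piv : PositiveMap.t row) (s : seq T) : seq T :=
  [seq x.2 | x <- row_nf fuel piv (row_of s)].

Definition row_insert (piv : PositiveMap.t row) (s : seq T) :=
  if row_nf fuel piv (row_of s) is x :: r then PositiveMap.add x.1 (x :: r) piv
  else piv.

Definition elim (rels : seq (seq T)) := foldl row_insert (PositiveMap.empty row) rels.

Variable F : T -> 'F_2.
Local Notation ev r := (\sum_(x <- r) F x.2).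
Local Notation ev' s := (\sum_(t <- s) F t).

Lemma ev_row_add r1 r2 : ev (row_add r1 r2) = ev r1 + ev r2.
Proof.
elim: r1 r2 => [|x1 r1 IH1] r2; first by rewrite big_nil add0r.
elim: r2 => [|x2 r2 IH2]; first by rewrite [in RHS]big_nil addr0.
rewrite /=; case: Pos.compare.
- case: eqP => [e|_]; last by rewrite !big_cons IH1 big_cons addrA.
  by rewrite IH1 !big_cons e addrACA F2_addxx add0r.
- rewrite [in LHS]big_cons IH2 [in X in _ = _ + X]big_cons !addrA.
  by congr (_ + _); rewrite addrC.
- by rewrite !big_cons IH1 big_cons !addrA.
Qed.

Arguments row_add : simpl never.

Lemma ev_row_of s : ev (row_of s) = ev' s.
Proof.
elim: s => [|t s IH]; first by rewrite !big_nil.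
by rewrite -[row_of _]/(row_add [:: (key t, t)] (row_of s)) ev_row_add big_seq1 IH big_cons.
Qed.

Definition null (piv : PositiveMap.t row) :=
  forall k r, PositiveMap.find k piv = Some r -> ev r = 0.

Lemma ev_row_nf n piv r : null piv -> ev (row_nf n piv r) = ev r.
Proof.
move=> piv0; elim: n r => //= n IH [|x r] //=.
case E: PositiveMap.find => [p|]; last by rewrite !big_cons IH.
by rewrite IH ev_row_add (piv0 _ _ E) addr0.
Qed.

Lemma ev_nf piv s : null piv -> ev' (nf piv s) = ev' s.
Proof. by move=> piv0; rewrite big_map ev_row_nf // ev_row_of. Qed.

Lemma null_empty : null (PositiveMap.empty row).
Proof. by move=> k r; rewrite PositiveMap.gempty. Qed.

Lemma null_elim rels : (forall s, s \in rels -> ev' s = 0) -> null (elim rels).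
Proof.
rewrite /elim; move: null_empty; elim: rels (PositiveMap.empty _) => [|s rels IH] //= piv piv0 rels0.
apply: IH => [|s' s'rels]; last by apply: rels0; rewrite inE s'rels orbT.
rewrite /row_insert; case E: row_nf => [//|x r] k r'.
case: (Pos.eq_dec k x.1) => [->|kx]; last by rewrite PositiveMap.gso //; apply: piv0.
rewrite PositiveMap.gss => -[<-]; rewrite -E ev_row_nf // ev_row_of.
by apply: rels0; rewrite mem_head.
Qed.

Lemma elim_zero rels s :
  nilp (nf (elim rels) s) -> (forall r, r \in rels -> ev' r = 0) -> ev' s = 0.
Proof. by move=> /nilP nf0 /null_elim/(ev_nf s) <-; rewrite nf0 big_nil. Qed.

Lemma elim_kill rels cols :
  all (fun t => nilp (nf (elim rels) [:: t])) cols ->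
  (forall r, r \in rels -> ev' r = 0) -> forall t, t \in cols -> F t = 0.
Proof. by move=> /allP kills rels0 t /kills/elim_zero/(_ rels0); rewrite big_seq1. Qed.

End Elimination.

(** * Words and their exchange relations *)

(** A set of variables as an increasing sequence of indices below 5; a word
    L_0 L_1 ... stands for the monomial whose exponents have their i-th binary
    digit 1 on L_i. *)
Definition letter := seq nat.
Definition word := seq letter.

Definition srt (I : letter) : letter := [seq c <- iota 0 5 | c \in I].

Fixpoint subseqs (T : Type) (s : seq T) : seq (seq T) :=
  if s is c :: s' then [seq c :: t | t <- subseqs s'] ++ subseqs s' else [:: [::]].

Definition letters (r : nat) : seq letter :=
  [seq L <- subseqs (iota 0 5) | size L == r].

Definition key_letter (k : positive) (I : letter) : positive :=
  foldl (fun k c => if c \in I then xI k else xO k) k (iota 0 5).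
Definition key_word (w : word) : positive := foldl key_letter xH w.

(** Up to lower weight, Sq^1 applied to x_J followed by g moves one element c
    of J to the next letter; the terms with c in g have lower weight and are
    left out. *)
Definition sq1_rel (J g : letter) : seq (letter * letter) :=
  [seq (rem c J, srt (c :: g)) | c <- J & c \notin g].

(** Sq^2 of x_J multiplied by a fourth power: two elements of J are squared
    and become the next letter. *)
Fixpoint sq2_rel (J : letter) : seq (letter * letter) :=
  if J is c :: J' then
    [seq (c :: p.1, p.2) | p <- sq2_rel J'] ++ [seq (rem d J', [:: c; d]) | d <- J']
  else [::].

Definition rels2 (a b : nat) : seq (seq (letter * letter)) :=
  (if b is b'.+1 then [seq sq1_rel J g | J <- letters a.+1, g <- letters b'] else [::])
  ++ (if b == 2 then [seq sq2_rel J | J <- letters a.+2] else [::]).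

Lemma mem_subseqs (T : eqType) (s t : seq T) : (t \in subseqs s) = subseq t s.
Proof.
elim: s t => [|c s IH] [|d t] //=; rewrite mem_cat; first by rewrite IH sub0seq orbT.
case: eqP => [->|cd].
  rewrite (mem_map (f := cons c)) => [|? ? [] //]; rewrite !IH.
  by apply/orP/idP => [[//|/(subseq_trans (subseq_cons _ _))]|]; [|left].
by rewrite -IH; case: mapP => // -[? _ [/cd]].
Qed.

Lemma mem_letters r L : (L \in letters r) = subseq L (iota 0 5) && (size L == r).
Proof. by rewrite mem_filter mem_subseqs andbC. Qed.

Lemma mem_rels2 a b R p : R \in rels2 a b -> p \in R ->
  p.1 \in letters a /\ p.2 \in letters b.
Proof.
pose ok a b := all (all (fun p => (p.1 \in letters a) && (p.2 \in letters b))) (rels2 a b).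
have okP : all (fun a => all (ok a) (iota 0 7)) (iota 0 6) by vm_compute.
have small r L : L \in letters r -> (r <= 5)%N.
  by rewrite mem_letters => /andP[/size_subseq + /eqP <-].
move=> Rab pR.
have [a6 b7] : (a < 6)%N /\ (b < 7)%N.
  move: Rab; rewrite mem_cat => /orP[].
    case: b => [|b]; first by rewrite in_nil.
    move=> /allpairsP[p' [/small a5 /small b5 _]]; split; last by rewrite !ltnS.
    exact: leq_trans a5 _.
  case: eqP => [->|_]; last by rewrite in_nil.
  move=> /mapP[J Ja _]; move: (small _ _ Ja) => {Ja}a5; split; last exact: isT.
  exact: leq_trans (leqnSn _) (leqW a5).
have /allP/(_ a) := okP; rewrite mem_iota a6 => /(_ isT)/allP/(_ b).
by rewrite mem_iota b7 => /(_ isT)/allP/(_ R Rab)/allP/(_ p pR)/andP.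
Qed.

Definition wd (om : seq nat) (w : word) := all2 (fun a I => I \in letters a) om w.

Definition exch (om : seq nat) (G : word -> 'F_2) : Prop :=
  forall o1 a b o2 pre post R, om = o1 ++ a :: b :: o2 -> wd o1 pre -> wd o2 post ->
    R \in rels2 a b -> \sum_(p <- R) G (pre ++ p.1 :: p.2 :: post) = 0.

(** Words of a given weight are handled letter by letter: modulo the relations
    every word of the current weight is a sum of words of st_reps. The
    previous representatives are kept because a new relation involves the last
    two letters, and st_piv holds the pivots found at the last letter. *)
Record stage := Stage {
  st_prev : seq word; st_reps : seq word; st_piv : PositiveMap.t (row word) }.

Definition stage0 a := Stage [:: [::]] [seq [:: L] | L <- letters a] (PositiveMap.empty _).

(** The relations of the two last letters, with the words before reduced to
    sums of representatives. *)
Definition stage_rels o a b st : seq (seq word) :=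
  [seq flatten [seq [seq rcons s p.2 | s <- nf key_word (st_piv st) [:: rcons r p.1]] | p <- R]
  | r <- [seq r <- st_prev st | wd o r], R <- rels2 a b].

Definition stage_next o a b st :=
  let piv := elim key_word (stage_rels o a b st) in
  Stage (st_reps st)
    (undup (flatten [seq nf key_word piv [:: rcons r L] | r <- st_reps st, L <- letters b])) piv.

Fixpoint stage_iter o a om st :=
  if om is b :: om' then stage_iter (rcons o a) b om' (stage_next o a b st) else st.

(** No representatives are left: the relations imply that every word of weight
    om vanishes. *)
Definition kills (om : seq nat) : bool :=
  if om is a :: om' then nilp (st_reps (stage_iter [::] a om' (stage0 a))) else false.

Lemma wd_cat o1 o2 w1 w2 : wd o1 w1 -> wd o2 w2 -> wd (o1 ++ o2) (w1 ++ w2).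
Proof. by elim: o1 w1 => [|a o1 IH] [|L w1] //= /andP[-> /IH h] /h. Qed.

Lemma wd_rcons om b w : wd (rcons om b) w ->
  exists w' L, [/\ w = rcons w' L, wd om w' & L \in letters b].
Proof.
elim: om w => [|a om IH] [|L w] //=.
  by case: w => [|? ?]; rewrite ?andbT ?andbF // => Lb; exists [::], L.
case/andP=> La /IH[w' [L' [-> w'om L'b]]].
by exists (L :: w'), L'; rewrite /= La.
Qed.

Lemma exch_rcons om b L (G : word -> 'F_2) : exch (rcons om b) G -> L \in letters b ->
  exch om (fun w => G (rcons w L)).
Proof.
move=> GE Lb o1 a b' o2 pre post R omE wpre wpost Rab.
rewrite -[RHS](GE o1 a b' (rcons o2 b) pre (rcons post L) R) //.
- by apply: eq_bigr => p _; rewrite rcons_cat !rcons_cons.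
- by rewrite omE rcons_cat !rcons_cons.
- by rewrite -!cats1; apply: wd_cat => //=; rewrite Lb.
Qed.

Definition stage_ok o a st := forall G : word -> 'F_2, exch (rcons o a) G ->
  null G (st_piv st) /\
  ((forall r, r \in st_reps st -> G r = 0) -> forall w, wd (rcons o a) w -> G w = 0).

Lemma stage0_ok a : stage_ok [::] a (stage0 a).
Proof.
move=> G _; split=> [|G0 w /wd_rcons[[|? ?] [L [-> // _ La]]]]; first exact: null_empty.
by apply: G0; apply: map_f.
Qed.

(** Fixing the last letter of a word leaves a function that satisfies the
    exchange relations of the shorter weight, so the previous stage applies to
    it. *)
Lemma stage_next_ok o a b st : stage_ok o a st -> stage_ok (rcons o a) b (stage_next o a b st).
Proof.
move=> ok G GE.
have okL L : L \in letters b -> _ := fun Lb => ok _ (exch_rcons GE Lb).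
have piv0 : null G (st_piv (stage_next o a b st)).
  apply: null_elim => s /allpairsP[[r R] /= [+ Rab ->]].
  rewrite mem_filter => /andP[wr _].
  rewrite big_flatten big_map /=.
  rewrite -[RHS](GE o a b [::] r [::] R) //; last by rewrite -!cats1 -catA.
  rewrite [LHS]big_seq [RHS]big_seq; apply: eq_bigr => p pR.
  have [_ p2b] := mem_rels2 Rab pR.
  rewrite big_map (ev_nf (F := fun w => G (rcons w p.2)) _ _ (proj1 (okL _ p2b))) big_seq1.
  by rewrite -!cats1 -catA.
split=> // G0 w /wd_rcons[w' [L [-> w'om Lb]]].
apply: (proj2 (okL _ Lb)) => // r rst.
have := ev_nf key_word [:: rcons r L] piv0; rewrite big_seq1 => <-.
rewrite big_seq big1 // => s snf; apply: G0; rewrite mem_undup; apply/flattenP.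
exists (nf key_word (st_piv (stage_next o a b st)) [:: rcons r L]) => //.
by apply/allpairsP; exists (r, L).
Qed.

Lemma kills_sound om G w : kills om -> exch om G -> wd om w -> G w = 0.
Proof.
case: om => // a om /= /nilP reps0.
suff: forall o st, stage_ok o a st -> st_reps (stage_iter o a om st) = [::] ->
    exch (o ++ a :: om) G -> wd (o ++ a :: om) w -> G w = 0.
  by move/(_ [::] (stage0 a) (@stage0_ok a) reps0).
elim: om a {reps0} => [|b om IH] a o st ok /= reps0 GE wom.
  move: GE wom; rewrite cats1 => GE wom.
  by apply: (proj2 (ok _ GE)) => // r; rewrite reps0.
apply: (IH b (rcons o a) _ (stage_next_ok ok)) => //; rewrite cat_rcons //.
Qed.

(** Enough killed weights to meet every weight in degree 2^n - 1 that is not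
    covered otherwise; see [classify_weights]. *)
Definition windows : seq (seq nat) :=
  [:: [:: 1; 2]; [:: 1; 5]; [:: 3; 5]; [:: 4; 5]; [:: 1; 3; 2]; [:: 1; 3; 4];
      [:: 1; 1; 1; 3]; [:: 2; 2; 4]; [:: 3; 2; 4]; [:: 3; 1; 4]; [:: 4; 1; 4];
      [:: 3; 4; 3; 3; 1]; [:: 3; 4; 3; 3; 3]]%N.

Lemma kills_windows : all kills windows.
Proof. vm_cast_no_check (erefl true). Qed.

(** * Planes of F_2^5 and the Pluecker relations *)

Definition pairs : seq letter := letters 2.
(** The support of a word of pairs, as a subsequence of pairs; it depends only
    on the set of letters. *)
Definition norm (S : word) : word := [seq P <- pairs | P \in S].
Definition syms (lo hi : nat) : seq word :=
  [seq V <- subseqs pairs | (lo <= size V <= hi)%N].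
(** Larger supports get larger keys, so that elimination expresses them by
    smaller ones. *)
Definition key_sym (S : word) : positive :=
  foldl (fun k P => if P \in S then xI k else xO k) (iter (size S) xI xH) pairs.

Definition plucker (Q : letter) : seq (letter * letter) :=
  if Q is [:: a; b; c; d] then
    [:: ([:: a; b], [:: c; d]); ([:: a; c], [:: b; d]); ([:: a; d], [:: b; c])]
  else [::].
Definition plucker_rel Q S : seq word := [seq norm [:: x.1, x.2 & S] | x <- plucker Q].

(** A plane of F_2^5 by the supports of two spanning vectors. *)
Definition plane := (letter * letter)%type.
(** The pairs of rows in reduced echelon form, one for each of the 155 planes:
    the pivots increase, and the first row vanishes at the second pivot. *)
Definition planes : seq plane :=
  [seq L <- [seq (s, t) | s <- subseqs (iota 0 5), t <- subseqs (iota 0 5)] |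
   [&& L.1 != [::], L.2 != [::], (head 0 L.1 < head 0 L.2)%N & head 0 L.2 \notin L.1]].
(** The 2 x 2 minor of the matrix of L in the columns a, b: a Pluecker
    coordinate of L. *)
Definition minor (L : plane) (P : letter) : bool :=
  if P is [:: a; b] then ((a \in L.1) && (b \in L.2)) (+) ((a \in L.2) && (b \in L.1)) else false.
Definition minors (L : plane) (S : word) : bool := all (minor L) S.
Definition key_plane (L : plane) : positive :=
  foldl (fun k P => if minor L P then xI k else xO k) (iter (count (predC (minor L)) pairs) xI xH) pairs.

Definition off_pivots (L : plane) (k : nat) := (k \in iota 0 5) && (k \notin [:: head 0 L.1; head 0 L.2]).
(** The coordinates that are not pivots of L span a complement of L, so that
    there are 3 of them for each plane. *)
Definition flags : seq (plane * nat) := [seq (L, k) | L <- planes, k <- [seq k <- iota 0 5 | off_pivots L k]].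
(** The value on L of the derivative of the letter A along the k-th
    coordinate. *)
Definition contract (Lk : plane * nat) (A : letter) : bool := (Lk.2 \in A) && minor Lk.1 (rem Lk.2 A).

Definition plucker_rels : seq (seq word) := [seq plucker_rel Q V | Q <- letters 4, V <- syms 1 3].
(** Supports that are not leading terms of Pluecker relations; there are as
    many as planes. *)
Definition basis : seq word :=
  let piv := elim key_sym plucker_rels in
  [seq V <- syms 1 5 | if PositiveMap.find (key_sym V) piv is Some _ then false else true].

Definition basis_spans : bool :=
  let piv := elim key_sym ([seq [:: V] | V <- basis] ++ plucker_rels) in
  all (fun S => nilp (nf key_sym piv [:: S])) (syms 1 5).

Definition plane_rel (S : word) : seq plane := [seq L <- planes | minors L S].
Definition basis_separates : bool :=
  let piv := elim key_plane [seq plane_rel V | V <- basis] in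
  all (fun L => nilp (nf key_plane piv [:: L])) planes.
(** The contraction relation has room for supports of size at most 4 next to
    the new pair, so one value, at the plane L0, has to be supplied from
    elsewhere. *)
Definition basis4_separates (L0 : plane) : bool :=
  let piv := elim key_plane ([:: L0] :: [seq plane_rel V | V <- basis & (size V <= 4)%N]) in
  all (fun L => nilp (nf key_plane piv [:: L])) planes.
(** A coordinate plane all of whose minors involving d vanish. *)
Definition far_plane (d : nat) : plane := if (d <= 1)%N then ([:: 2], [:: 3]) else ([:: 0], [:: 1])%N.

Definition top_rels : seq (seq word) :=
  [seq [seq T <- plucker_rel Q V | size T == 6%N] | Q <- letters 4, V <- syms 4 4].
Definition top_spans : bool :=
  let piv := elim key_sym top_rels in
  all (fun S => nilp (nf key_sym piv [:: S])) (syms 6 6).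

(** The linear relations in A that the contraction relation imposes for one
    plane L. *)
Definition contract_rels (L : plane) : seq (seq letter) :=
  [seq [seq rem c J | c <- J & (c != d) && minor L (srt [:: c; d])] | J <- letters 4, d <- iota 0 5].
(** Modulo the contraction relations of L, each letter with 3 elements is a
    combination of the letters made of the two pivots and one further
    coordinate. *)
Definition flags_span (L : plane) : bool :=
  let piv := elim (key_letter xH) (contract_rels L) in
  all (fun A => nilp (nf (key_letter xH) piv
     (A :: [seq srt [:: head 0%N L.1; head 0%N L.2; k]
           | k <- iota 0 5 & off_pivots L k && contract (L, k) A]))) (letters 3).

Lemma basis_spansP : basis_spans. Proof. vm_cast_no_check (erefl true). Qed.
Lemma basis_separatesP : basis_separates. Proof. vm_cast_no_check (erefl true). Qed.
Lemma basis4_separatesP : all basis4_separates [:: far_plane 0; far_plane 2].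
Proof. vm_cast_no_check (erefl true). Qed.
Lemma top_spansP : top_spans. Proof. vm_cast_no_check (erefl true). Qed.
Lemma flags_spanP : all flags_span planes. Proof. vm_cast_no_check (erefl true). Qed.
Lemma size_basis : size basis = size planes. Proof. vm_cast_no_check (erefl 155%N). Qed.
Lemma size_flags : size flags = 465%N. Proof. vm_cast_no_check (erefl 465%N). Qed.
Lemma uniq_planes : uniq planes. Proof. vm_cast_no_check (erefl true). Qed.

Lemma uniq_basis : uniq basis. Proof. vm_cast_no_check (erefl true). Qed.

Lemma F2_oppr (x : 'F_2) : - x = x.
Proof. by apply/eqP; rewrite -subr_eq0 -opprD F2_addxx oppr0. Qed.

(** A square system over F_2 with injective matrix is solvable; the shape is
    that of the systems below, with sums over the entries where M holds. *)
Lemma square_solve (T1 T2 : eqType) (cs : seq T1) (rs : seq T2) (M : T2 -> T1 -> bool) :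
    size rs = size cs -> uniq cs -> uniq rs ->
    (forall c : T1 -> 'F_2, (forall r, r \in rs -> \sum_(t <- cs | M r t) c t = 0) ->
      forall t, t \in cs -> c t = 0) ->
  forall g : T2 -> 'F_2, {c : T1 -> 'F_2 |
    forall r, r \in rs -> \sum_(t <- cs | M r t) c t = g r}.
Proof.
case: cs => [|t0 cs']; first by case: rs => // _ _ _ _ g; exists (fun=> 0).
case: rs => // r0 rs'; set cs := t0 :: cs'; set rs := r0 :: rs'.
move=> szE csu rsu inj g; set n := size cs' in szE *.
pose A := \matrix_(i < n.+1, j < n.+1) ((M (nth r0 rs j) (nth t0 cs i))%:R : 'F_2).
pose fn (v : 'rV['F_2]_n.+1) t := v 0 (inord (index t cs)).
have fnE v j : (v *m A) 0 j = \sum_(t <- cs | M (nth r0 rs j) t) fn v t.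
  rewrite mxE (big_nth t0) big_mkord [RHS]big_mkcond /=; apply: eq_bigr => i _.
  rewrite /fn index_uniq // inord_val mxE.
  by case: (M _ _); rewrite ?mulr1 ?mulr0.
have Afree : row_free A.
  apply: inj_row_free => v vA; apply/rowP => i; rewrite [RHS]mxE.
  have := inj (fn v) _ (nth t0 cs i) (mem_nth _ _).
  rewrite /fn index_uniq // inord_val; apply=> // r /(nthP r0)[j jlt <-].
  have jn : (j < n.+1)%N by rewrite -[n.+1]szE.
  by have := fnE v (Ordinal jn); rewrite vA mxE /= => <-.
exists (fn ((\row_j g (nth r0 rs j)) *m invmx A)) => r /(nthP r0)[j jlt <-].
have jn : (j < n.+1)%N by rewrite -[n.+1]szE.
have := fnE ((\row_j g (nth r0 rs j)) *m invmx A) (Ordinal jn).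
by rewrite mulmxKV -?row_free_unit // mxE => <-.
Qed.

Lemma uniq_pairs : uniq pairs. Proof. by vm_compute. Qed.

Lemma eq_norm V W : V =i W -> norm V = norm W.
Proof. by move=> VW; apply: eq_filter => P; rewrite VW. Qed.

Lemma mem_norm V : {subset V <= pairs} -> norm V =i V.
Proof. by move=> sV P; rewrite mem_filter andb_idr // => /sV. Qed.

Lemma norm_subseqs V : norm V \in subseqs pairs.
Proof. by rewrite mem_subseqs filter_subseq. Qed.

Lemma size_norm V : (size (norm V) <= size V)%N.
Proof.
apply: uniq_leq_size; first by rewrite filter_uniq // uniq_pairs.
by move=> P; rewrite mem_filter => /andP[].
Qed.

Lemma size_norm_gt0 P V : P \in pairs -> (0 < size (norm (P :: V)))%N.
Proof.
move=> Pp; rewrite lt0n size_eq0 -has_filter; apply/hasP.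
by exists P; rewrite //= mem_head.
Qed.

Lemma norm_id V : V \in subseqs pairs -> norm V = V.
Proof.
by rewrite mem_subseqs => /(subseq_uniqP uniq_pairs) {2}->.
Qed.

Lemma mem_syms lo hi V : (V \in syms lo hi) = (V \in subseqs pairs) && (lo <= size V <= hi)%N.
Proof. by rewrite mem_filter andbC. Qed.

Lemma sub_subseqs V : V \in subseqs pairs -> {subset V <= pairs}.
Proof. by rewrite mem_subseqs => /mem_subseq. Qed.

Lemma basis_syms V : V \in basis -> V \in subseqs pairs /\ (0 < size V <= 5)%N.
Proof. by rewrite mem_filter mem_syms => /andP[_ /andP]. Qed.

Lemma mem_flags L k : (L, k) \in flags -> [/\ L \in planes, k \in iota 0 5 & off_pivots L k].
Proof.
by case/allpairsPdep=> L' [k' [Lp + [-> ->]]]; rewrite mem_filter => /andP[].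
Qed.

Lemma flag_letter L k : (L, k) \in flags -> let A := srt [:: head 0%N L.1; head 0%N L.2; k] in
  A \in letters 3 /\ [:: k] = [seq k <- iota 0 5 | off_pivots L k && contract (L, k) A].
Proof.
have /allP h : all (fun Lk => let A := srt [:: head 0%N Lk.1.1; head 0%N Lk.1.2; Lk.2] in
  (A \in letters 3) && ([:: Lk.2] == [seq k <- iota 0 5 | off_pivots Lk.1 k && contract (Lk.1, k) A]))
  flags by vm_cast_no_check (erefl true).
by move=> /h /= /andP[-> /eqP].
Qed.

Lemma minor_far_plane c d : c \in iota 0 5 -> d \in iota 0 5 ->
  minor (far_plane d) (srt [:: c; d]) = false.
Proof.
have /allP h : all (fun c => all (fun d => ~~ minor (far_plane d) (srt [:: c; d])) (iota 0 5)) (iota 0 5).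
  by vm_compute.
by move=> /h/allP/[apply]/negPf.
Qed.

Lemma mem_pairs_srt c d : c \in iota 0 5 -> d \in iota 0 5 -> c != d -> srt [:: c; d] \in pairs.
Proof.
have /allP h : all (fun c => all (fun d => (c != d) ==> (srt [:: c; d] \in pairs)) (iota 0 5)) (iota 0 5).
  by vm_compute.
by move=> /h/allP/[apply]/implyP.
Qed.

Lemma big_flags (b : plane * nat -> 'F_2) A w :
  \sum_(Lk <- flags | contract Lk A && minors Lk.1 w) b Lk =
  \sum_(L <- planes | minors L w)
     \sum_(k <- iota 0 5 | off_pivots L k && contract (L, k) A) b (L, k).
Proof.
rewrite big_mkcond big_allpairs_dep [RHS]big_mkcond; apply: eq_bigr => L _.
rewrite big_filter -big_mkcondr.
case: (minors L w); first by apply: eq_bigl => k; rewrite andbT.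
by rewrite big_pred0 // => k; rewrite !andbF.
Qed.

(** The incidence matrix between basis supports and planes is invertible. *)
Lemma separated (c : plane -> 'F_2) :
  (forall V, V \in basis -> \sum_(L <- planes | minors L V) c L = 0) ->
  forall L, L \in planes -> c L = 0.
Proof.
move=> cV; apply: (elim_kill basis_separatesP) => R /mapP[V Vb ->].
by rewrite big_filter cV.
Qed.

Opaque letters pairs syms basis planes flags subseqs.

Lemma plucker_pairs Q x : Q \in letters 4 -> x \in plucker Q ->
  x.1 \in pairs /\ x.2 \in pairs.
Proof.
have /allP h : all (fun Q => all (fun x => (x.1 \in pairs) && (x.2 \in pairs)) (plucker Q)) (letters 4).
  by vm_compute.
by move=> /h/allP/[apply]/andP.
Qed.

(** h, as a function of supports, satisfies the Pluecker relations multiplied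
    by a monomial V; m bounds the number of letters available. *)
Definition plucker_closed m (h : word -> 'F_2) : Prop :=
  forall Q (V : word), Q \in letters 4 -> V \in subseqs pairs -> (0 < size V)%N -> (size V + 2 <= m)%N ->
    \sum_(T <- plucker_rel Q V) h T = 0.

(** For supports of size at most 5 this is elimination. A larger support is
    split after its first 6 pairs: modulo smaller supports, the Pluecker
    relations kill every support with 6 pairs, so induction on the size
    applies. *)
Lemma plucker_closed_zero m h : (5 <= m)%N -> plucker_closed m h ->
    (forall V, V \in basis -> h V = 0) ->
  forall V : word, V \in subseqs pairs -> (0 < size V <= m)%N -> h V = 0.
Proof.
move=> m5 hP h0 V; have [s sV] := ubnP (size V).
elim: s => [|s IH] in V sV *; [by rewrite ltn0 in sV|]; move=> Vp /andP[V0 Vm].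
have [V5|V6] := leqP (size V) 5.
  apply: (elim_kill basis_spansP) => [R|]; last by rewrite mem_syms Vp V0 V5.
  rewrite mem_cat => /orP[/mapP[W Wb ->]|/allpairsP[[Q W] /= [Q4 + ->]]].
    by rewrite big_seq1 h0.
  rewrite mem_syms => /andP[Wp /andP[W0 W3]].
  by apply: hP; rewrite // (leq_trans _ m5) // -[5%N]/(3 + 2)%N leq_add2r.
(* R is carried along as a multiplier, and only the first 6 pairs are rewritten *)
pose R := drop 6 V; pose h' (T : word) := h (norm (T ++ R)).
have sR : size R = (size V - 6)%N by rewrite size_drop.
have Rp : {subset R <= pairs} by move=> P /mem_drop; apply: sub_subseqs.
have h'0 (T : word) : T \in subseqs pairs -> (0 < size T < 6)%N -> h' T = 0.
  move=> Tp /andP[T0 T6]; have TRs : (size (norm (T ++ R)) < size V)%N.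
    rewrite (leq_ltn_trans (size_norm _)) // size_cat sR; lia.
  apply: IH; first exact: leq_trans TRs _.
    exact: norm_subseqs.
  rewrite (leq_trans (ltnW TRs) Vm) andbT.
  case: T T0 Tp {T6 TRs} => [//|P T] _ /sub_subseqs Tp.
  exact: (size_norm_gt0 _ (Tp _ (mem_head _ _))).
have <- : h' (take 6 V) = h V by rewrite /h' cat_take_drop norm_id.
apply: (elim_kill top_spansP); last first.
  rewrite mem_syms size_takel ?leqnn ?andbT; last exact: V6.
  by move: Vp; rewrite !mem_subseqs => /(subseq_trans (take_subseq _ _)).
move=> _ /allpairsP[[Q W] /= [Q4 + ->]]; rewrite mem_syms -eqn_leq => /andP[Wp /eqP W4].
have WRp : {subset W ++ R <= pairs}.
  by move=> P; rewrite mem_cat => /orP[/(sub_subseqs Wp)|/Rp].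
rewrite big_filter big_mkcond /=.
have -> : \sum_(T <- plucker_rel Q W) (if size T == 6 then h' T else 0) =
    \sum_(T <- plucker_rel Q (norm (W ++ R))) h T.
  rewrite !big_map; apply: eq_big_seq => x xQ.
  have [x1 x2] := plucker_pairs Q4 xQ.
  have sub : {subset [:: x.1, x.2 & W] <= pairs}.
    by move=> P; rewrite !in_cons => /or3P[/eqP->|/eqP->|]; last exact: sub_subseqs.
  transitivity (h' (norm [:: x.1, x.2 & W])); last first.
    congr h; apply: eq_norm => P; rewrite mem_cat mem_norm // !in_cons mem_norm //.
    by rewrite mem_cat !orbA.
  case: eqP => // /eqP n6; rewrite h'0 ?norm_subseqs //.
  rewrite (size_norm_gt0 _ x1) ltn_neqAle n6 /=.
  by rewrite (leq_trans (size_norm _)) //= -W4.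
have sW : (size (norm (W ++ R)) <= size V - 2)%N.
  by rewrite (leq_trans (size_norm _)) // size_cat sR -W4; lia.
apply: hP; rewrite ?norm_subseqs //.
  case: W W4 {sW WRp} Wp => [//|P W] _ /sub_subseqs Wp.
  exact: (size_norm_gt0 _ (Wp _ (mem_head _ _))).
lia.
Qed.

Lemma plucker_minors L Q V : Q \in letters 4 -> {subset V <= pairs} ->
  \sum_(T <- plucker_rel Q V) (minors L T)%:R = 0 :> 'F_2.
Proof.
move=> Q4 sV; rewrite big_map.
have mE x : x \in plucker Q ->
    minors L (norm [:: x.1, x.2 & V]) = [&& minor L x.1, minor L x.2 & minors L V].
  move=> /(plucker_pairs Q4)[x1 x2].
  have sub : {subset [:: x.1, x.2 & V] <= pairs}.
    by move=> P; rewrite !in_cons => /or3P[/eqP->|/eqP->|]; last exact: sV.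
  by rewrite /minors (eq_all_r (mem_norm sub)).
under eq_big_seq => x xQ do rewrite mE //.
case: (minors L V); last by rewrite big1 // => x _; rewrite !andbF.
move: Q4; rewrite mem_letters => /andP[_ /eqP].
case: Q {mE} => [|a [|b [|c [|d []]]]] // _.
rewrite !big_cons big_nil /=.
by case: (a \in L.1) (a \in L.2) (b \in L.1) (b \in L.2) (c \in L.1) (c \in L.2)
  (d \in L.1) (d \in L.2) => [] [] [] [] [] [] [] [] //=; apply/val_inj.
Qed.

Lemma mem_cat_nseq_head (V : word) n : (0 < size V)%N -> V ++ nseq n (head [::] V) =i V.
Proof.
case: V => [//|P V] _ Q; rewrite mem_cat mem_nseq /= in_cons.
by case: eqP; rewrite ?andbF ?orbF //= ?orbT.
Qed.

Section GrassmannDual.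
Variables (m : nat) (m5 : (5 <= m)%N).

(** Repeating a letter does not change the support, so a support is realised
    by words of any larger length. *)
Definition pad (V : word) : word := V ++ nseq (m - size V) (head [::] V).

Lemma size_pad V : (size V <= m)%N -> size (pad V) = m.
Proof. by move=> Vm; rewrite size_cat size_nseq subnKC. Qed.

Lemma mem_pad V : (0 < size V)%N -> pad V =i V.
Proof. exact: mem_cat_nseq_head. Qed.

Variable f : letter -> word -> 'F_2.
Hypothesis f_supp : forall A u v, A \in letters 3 ->
  {subset u <= pairs} -> size u = m -> size v = m -> u =i v -> f A u = f A v.
Hypothesis f_plucker : forall A Q (w : word), A \in letters 3 -> Q \in letters 4 ->
  {subset w <= pairs} -> (size w).+2 = m ->
  \sum_(x <- plucker Q) f A [:: x.1, x.2 & w] = 0.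
Hypothesis f_contract : forall J d (w : word), J \in letters 4 -> d \in iota 0 5 ->
  {subset w <= pairs} -> (size w).+1 = m ->
  \sum_(c <- J | c != d) f (rem c J) (srt [:: c; d] :: w) = 0.

Let h A V := f A (pad V).

Let h_closed A : A \in letters 3 -> plucker_closed m (h A).
Proof.
move=> A3 Q V Q4 /sub_subseqs Vp V0 Vm; rewrite big_map.
rewrite -[RHS](f_plucker (w := V ++ nseq (m - 2 - size V) (head [::] V)) A3 Q4).
- apply: eq_big_seq => x /(plucker_pairs Q4)[x1 x2].
  have sub : {subset [:: x.1, x.2 & V] <= pairs}.
    by move=> P; rewrite !in_cons => /or3P[/eqP->|/eqP->|]; last exact: Vp.
  have n0 : (0 < size (norm [:: x.1, x.2 & V]))%N by exact: (size_norm_gt0 _ x1).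
  apply: (f_supp A3).
  + move=> P; rewrite mem_pad; last exact: n0.
    rewrite mem_norm; last exact: sub.
    exact: sub.
  + rewrite size_pad; first by [].
    apply: leq_trans (size_norm _) _; rewrite /=; lia.
  + by rewrite /= size_cat size_nseq; move: Vm; move: (size V) => sV; lia.
  move=> P; rewrite mem_pad; last exact: n0.
  rewrite mem_norm; last exact: sub.
  by rewrite !in_cons mem_cat_nseq_head.
- by move=> P; rewrite mem_cat_nseq_head; [exact: Vp|exact: V0].
by rewrite size_cat size_nseq; move: Vm; move: (size V) => sV; lia.
Qed.

Let minors_closed L : plucker_closed m (fun V => (minors L V)%:R).
Proof. by move=> Q V Q4 /sub_subseqs Vp _ _; apply: plucker_minors. Qed.

Let coef A : {c : plane -> 'F_2 |
  forall V, V \in basis -> \sum_(L <- planes | minors L V) c L = h A V}.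
Proof.
exact: square_solve size_basis uniq_planes uniq_basis separated (h A).
Qed.

Let coefP A (V : word) : A \in letters 3 -> V \in subseqs pairs -> (0 < size V <= m)%N ->
  \sum_(L <- planes | minors L V) sval (coef A) L = h A V.
Proof.
move=> A3 Vp Vm; apply/eqP; rewrite -subr_eq0; apply/eqP.
pose h' (V : word) := \sum_(L <- planes | minors L V) sval (coef A) L - h A V.
apply: (@plucker_closed_zero m h' m5 _ _ V Vp Vm) => [Q W Q4 Wp W0 Wm|W Wb].
  rewrite sumrB (h_closed A3 Q4 Wp W0 Wm) subr0.
  under eq_bigr do rewrite big_mkcond.
  rewrite exchange_big big1 // => L _.
  transitivity (sval (coef A) L * \sum_(T <- plucker_rel Q W) (minors L T)%:R).
    rewrite mulr_sumr; apply: eq_bigr => T _.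
    by case: (minors L T); rewrite ?mulr1 ?mulr0.
  by rewrite (minors_closed L Q4 Wp W0 Wm) mulr0.
by rewrite /h' (svalP (coef A) W Wb) subrr.
Qed.

(** Summing over planes with the supports V of size at most 4 gives the
    contraction relation; the remaining equation holds because all minors
    involving d vanish on the plane far from d. *)
Let coef_contract J d L : J \in letters 4 -> d \in iota 0 5 -> L \in planes ->
  \sum_(c <- J | (c != d) && minor L (srt [:: c; d])) sval (coef (rem c J)) L = 0.
Proof.
move=> J4 d5 Lp.
have remJ c : c \in J -> rem c J \in letters 3.
  move: J4; rewrite !mem_letters => /andP[Js /eqP J4] cJ.
  by rewrite (subseq_trans (rem_subseq _ _) Js) size_rem // J4.
have J5 c : c \in J -> c \in iota 0 5.
  by move: J4; rewrite mem_letters => /andP[/mem_subseq Js _]; apply: Js.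
pose D L := \sum_(c <- J | (c != d) && minor L (srt [:: c; d])) sval (coef (rem c J)) L.
have Dfar : D (far_plane d) = 0.
  rewrite /D big_seq_cond big1 // => c /andP[cJ /andP[cd]].
  by rewrite minor_far_plane // J5.
have far : basis4_separates (far_plane d).
  have /and3P[far0 far2 _] := basis4_separatesP.
  by rewrite /far_plane; case: (d <= 1)%N; [exact: far0 | exact: far2].
apply: (elim_kill far (F := D)) Lp => R; rewrite in_cons => /orP[/eqP->|/mapP[V]].
  by rewrite big_seq1.
rewrite mem_filter => /andP[V4 Vb] ->; rewrite big_filter /D.
have [Vp /andP[V0 _]] := basis_syms Vb; have Vs := sub_subseqs Vp.
pose w := V ++ nseq (m - 1 - size V) (head [::] V).
have wV : w =i V := mem_cat_nseq_head _ V0.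
have sw : (size w).+1 = m.
  by rewrite size_cat size_nseq; move: V4 m5; move: (size V) => sV; lia.
have ws : {subset w <= pairs} by move=> P; rewrite wV; exact: Vs.
rewrite -[RHS](f_contract J4 d5 ws sw).
under eq_bigr do rewrite big_mkcond.
rewrite exchange_big [RHS]big_mkcond [LHS]big_seq [RHS]big_seq; apply: eq_bigr => c cJ.
case: (boolP (c != d)) => cd; last by rewrite big1.
have cdp := mem_pairs_srt (J5 _ cJ) d5 cd.
have sub : {subset srt [:: c; d] :: V <= pairs}.
  by move=> P; rewrite in_cons => /orP[/eqP->|]; [exact: cdp|exact: Vs].
have n0 := size_norm_gt0 V cdp.
have nm : (size (norm (srt [:: c; d] :: V)) <= m)%N.
  apply: leq_trans (size_norm _) _; apply: leq_trans m5; exact: V4.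
have nn : (0 < size (norm (srt [:: c; d] :: V)) <= m)%N.
  by apply/andP; split; [exact: n0|exact: nm].
transitivity (h (rem c J) (norm (srt [:: c; d] :: V))).
  rewrite -(coefP (remJ _ cJ) (norm_subseqs _) nn) -big_mkcondr; apply: eq_bigl => L'.
  by rewrite /minors (eq_all_r (mem_norm sub)) /= andbC.
apply: f_supp (remJ _ cJ) _ _ _ _.
- move=> P; rewrite mem_pad; last exact: n0.
  rewrite mem_norm; last exact: sub.
  exact: sub.
- by rewrite size_pad.
- exact: sw.
move=> P; rewrite mem_pad; last exact: n0.
by rewrite (mem_norm sub) !in_cons wV.
Qed.

(** For fixed A, the Pluecker relations show that f A is determined by its
    values on the basis supports, and products of minors over the 155 planes
    realise these values. By the contraction relation the coefficient of a
    plane L, as a function of A, satisfies the relations of [contract_rels],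
    because it does so after summing over planes against enough supports
    ([basis4_separates]); hence it is determined by its values on the pivots
    of L and one further coordinate. *)
Theorem grassmann_dual : exists b : plane * nat -> 'F_2,
  forall A w, A \in letters 3 -> {subset w <= pairs} -> size w = m ->
    f A w = \sum_(Lk <- flags | contract Lk A && minors Lk.1 w) b Lk.
Proof.
(* the coefficient of (L, k) is that of L for the letter of its pivots and k *)
exists (fun Lk => sval (coef (srt [:: head 0%N Lk.1.1; head 0%N Lk.1.2; Lk.2])) Lk.1).
move=> A w A3 ws sw.
have w0 : (0 < size w)%N by rewrite sw (leq_trans _ m5).
have n0 : (0 < size (norm w))%N.
  by case: w ws w0 {sw} => [//|P w] ws _; apply: size_norm_gt0 (ws _ (mem_head _ _)).
have nm : (0 < size (norm w) <= m)%N by rewrite n0 -sw size_norm.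
transitivity (h A (norm w)).
  apply: (f_supp A3); [exact: ws|exact: sw|by rewrite size_pad; case/andP: nm|].
  by move=> P; rewrite (mem_pad n0) (mem_norm ws).
rewrite -(coefP A3 (norm_subseqs w) nm) big_flags.
rewrite [LHS]big_seq_cond [RHS]big_seq_cond; apply: eq_big => L; last case/andP=> Lp _.
  by rewrite /minors (eq_all_r (mem_norm ws)).
have /allP/(_ _ Lp)/allP/(_ _ A3)/elim_zero e := flags_spanP.
have := e (fun B => sval (coef B) L); rewrite big_cons big_map big_filter => {}e.
apply/eqP; rewrite -[X in _ == X]F2_oppr -addr_eq0; apply/eqP/e.
move=> _ /allpairsP[[J d] /= [J4 d5 ->]].
by rewrite big_map big_filter; exact: (coef_contract J4 d5 Lp).
Qed.
End GrassmannDual.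

(** For the letter made of the pivots of L and k, the inner sum over the
    coordinates of L has the single term k; the sums over planes vanish by
    [separated]. *)
Theorem flags_independent m (b : plane * nat -> 'F_2) : (5 <= m)%N ->
  (forall A w, A \in letters 3 -> {subset w <= pairs} -> size w = m ->
    \sum_(Lk <- flags | contract Lk A && minors Lk.1 w) b Lk = 0) ->
  forall Lk, Lk \in flags -> b Lk = 0.
Proof.
move=> m5 b0 [L k] Lk.
have [Lp k5 koff] := mem_flags Lk.
pose A := srt [:: head 0%N L.1; head 0%N L.2; k].
have [A3 kA] := flag_letter Lk.
have D0 : forall L', L' \in planes ->
    \sum_(k <- iota 0 5 | off_pivots L' k && contract (L', k) A) b (L', k) = 0.
  apply: separated => V Vb.
  have [Vp /andP[V0 V5]] := basis_syms Vb; have Vs := sub_subseqs Vp.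
  rewrite -[RHS](b0 A (pad m V) A3).
  - rewrite big_flags; apply: eq_bigl => L'.
    by rewrite /minors (eq_all_r (mem_pad _ V0)).
  - by move=> P; rewrite mem_pad; [exact: Vs|exact: V0].
  by apply: size_pad; apply: leq_trans V5 m5.
have := D0 L Lp; rewrite -big_filter -kA big_seq1; exact.
Qed.

(** * Points of F_2^5 *)

Definition points : seq letter := [seq v <- subseqs (iota 0 5) | v != [::]].

Lemma size_points : size points = 31%N. Proof. by vm_compute. Qed.
Lemma uniq_points : uniq points. Proof. by vm_compute. Qed.
Lemma points_separate :
  all (fun v => nilp (nf (key_letter xH)
    (elim (key_letter xH) [seq [seq v <- points | all (mem v) u] | u <- points]) [:: v])) points.
Proof. by vm_compute. Qed.

Lemma points_separated (a : letter -> 'F_2) :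
  (forall u, u \in points -> \sum_(v <- points | all (mem v) u) a v = 0) ->
  forall v, v \in points -> a v = 0.
Proof.
move=> a0; apply: (elim_kill points_separate) => R /mapP[u up ->].
by rewrite big_filter; exact: a0.
Qed.

Lemma mem_points u : (u \in points) = (u \in subseqs (iota 0 5)) && (u != [::]).
Proof. by rewrite mem_filter andbC. Qed.

Opaque points.

Lemma srt_points u : u != [::] -> {subset u <= iota 0 5} -> srt u \in points.
Proof.
move=> u0 u5; rewrite mem_points mem_subseqs filter_subseq /=.
case: u u0 u5 => [//|c u] _ u5; rewrite -has_filter; apply/hasP.
by exists c; [exact: u5 (mem_head _ _) | exact: mem_head].
Qed.

Lemma mem_srt u : {subset u <= iota 0 5} -> srt u =i u.
Proof. by move=> u5 c; rewrite mem_filter andb_idr //; exact: u5. Qed.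

Definition cpad n (u : letter) := u ++ nseq (n - size u) (head 0%N u).

Lemma size_cpad n u : (size u <= n)%N -> size (cpad n u) = n.
Proof. by move=> un; rewrite size_cat size_nseq subnKC. Qed.

Lemma mem_cpad n u : u != [::] -> cpad n u =i u.
Proof.
case: u => [//|c u] _ d; rewrite mem_cat mem_nseq /= in_cons.
by case: eqP; rewrite ?andbF ?orbF //= ?orbT.
Qed.

Lemma point_facts u : u \in points -> [/\ u != [::], {subset u <= iota 0 5} & (size u <= 5)%N].
Proof.
rewrite mem_points mem_subseqs => /andP[us u0]; split=> //; first exact: mem_subseq.
exact: (size_subseq us).
Qed.

(** A function of the supports in F_2^5 is a combination of the 31 functions
    saying that the support is contained in that of v, since the inclusion
    matrix of nonempty sets is unitriangular. *)
Theorem points_dual n (f : letter -> 'F_2) : (5 <= n)%N ->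
  (forall u v, {subset u <= iota 0 5} -> size u = n -> size v = n -> u =i v -> f u = f v) ->
  exists a : letter -> 'F_2, forall u, {subset u <= iota 0 5} -> size u = n ->
    f u = \sum_(v <- points | all (mem v) u) a v.
Proof.
move=> n5 f_supp.
have [a aP] := square_solve (erefl _) uniq_points uniq_points points_separated (fun u => f (cpad n u)).
exists a => u u5 un.
have u0 : u != [::] by rewrite -size_eq0 un; lia.
have sp := srt_points u0 u5; have [s0 s5 ss] := point_facts sp.
have sn : (size (srt u) <= n)%N by apply: leq_trans ss n5.
transitivity (f (cpad n (srt u))).
  apply: (f_supp _ _ u5 un); first exact: size_cpad.
  by move=> c; rewrite mem_cpad // mem_srt.
by rewrite -aP //; apply: eq_bigl => v; apply: eq_all_r; exact: mem_srt.
Qed.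

Theorem points_independent n (a : letter -> 'F_2) : (5 <= n)%N ->
  (forall u, {subset u <= iota 0 5} -> size u = n ->
    \sum_(v <- points | all (mem v) u) a v = 0) ->
  forall v, v \in points -> a v = 0.
Proof.
move=> n5 a0; apply: points_separated => u /point_facts[u0 u5 us].
rewrite -[RHS](a0 (cpad n u)).
- by apply: eq_bigl => v; apply: eq_all_r => c; rewrite mem_cpad.
- by move=> c; rewrite mem_cpad //; exact: u5.
by rewrite size_cpad // (leq_trans us).
Qed.

(** * Words as monomials *)

Local Notation P := {mpoly 'F_2[5]}.
Local Notation xv c := ('X_(inord c : 'I_5) : P).

(** The squarefree monomial with variables in L; wm and pm turn a word into
    its monomial, least significant letter first. *)
Definition lm (L : letter) : 'X_{1..5} := [multinom nat_of_bool (val j \in L) | j < 5].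
Definition wm (w : word) : 'X_{1..5} := foldr (fun L m => lm L + m *+ 2)%MM 0%MM w.
Definition pm (w : word) : P := 'X_[wm w].

Definition is_letter (L : letter) := subseq L (iota 0 5).

Lemma is_letter_uniq L : is_letter L -> uniq L.
Proof. by move=> h; rewrite (subseq_uniq h) ?iota_uniq. Qed.

Lemma is_letter_lt L c : is_letter L -> c \in L -> (c < 5)%N.
Proof. by move=> /mem_subseq h /h; rewrite mem_iota. Qed.

Lemma is_letter_rem c L : is_letter L -> is_letter (rem c L).
Proof. exact: subseq_trans (rem_subseq _ _). Qed.

Lemma letters_is r L : L \in letters r -> is_letter L /\ size L = r.
Proof. by rewrite mem_letters => /andP[? /eqP]. Qed.

Lemma lm_sqfree L : sqfree (lm L).
Proof. by apply/forallP => j; rewrite mnmE leq_b1. Qed.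

Lemma lm_nil : lm [::] = 0%MM.
Proof. by apply/mnmP => j; rewrite !mnmE. Qed.

Lemma eq_lm L M : L =i M -> lm L = lm M.
Proof. by move=> LM; apply/mnmP => j; rewrite !mnmE LM. Qed.

Lemma mdeg_lm L : is_letter L -> mdeg (lm L) = size L.
Proof.
move=> Ll; rewrite mdegE.
transitivity (\sum_(c <- iota 0 5) nat_of_bool (c \in L))%N.
  by rewrite -[iota 0 5]/(index_iota 0 5) big_mkord; apply: eq_bigr => j _; rewrite mnmE.
rewrite [in RHS](subseq_uniqP (iota_uniq 0 5) Ll) -sum1_size big_filter [RHS]big_mkcond.
by apply: eq_bigr => c _; case: (c \in L).
Qed.

Lemma lm_cons c L : (c < 5)%N -> c \notin L -> lm (c :: L) = (U_(inord c) + lm L)%MM.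
Proof.
move=> c5 cL; apply/mnmP => j; rewrite mnmDE !mnmE in_cons -val_eqE /= inordK // eq_sym.
by case: eqP => [<-|_] //=; rewrite (negPf cL).
Qed.

Lemma pm_cons L w : pm (L :: w) = 'X_[lm L] * pm w ^+ 2.
Proof. by rewrite /pm mpolyXn -mpolyXD. Qed.

Lemma XlmE c L : (c < 5)%N -> c \notin L -> 'X_[lm (c :: L)] = xv c * 'X_[lm L] :> P.
Proof. by move=> c5 cL; rewrite lm_cons // mpolyXD. Qed.

Lemma sqr_mulCA (R : comNzRingType) (x y z t : R) :
  x ^+ 2 * (y * z ^+ 2 * t) = y * (x * z) ^+ 2 * t.
Proof. by ring. Qed.

Lemma mul_sqrA (R : comNzRingType) (x y z : R) :
  x * y ^+ 2 * z ^+ 2 = x * (y * z) ^+ 2.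
Proof. by ring. Qed.

Lemma mul_sqrA2 (R : comNzRingType) (x y z : R) :
  x * (y * z ^+ 2) ^+ 2 = x * y ^+ 2 * (z ^+ 2) ^+ 2.
Proof. by ring. Qed.

Lemma mul_sqrCA (R : comNzRingType) (j x y t : R) : j = y * x ->
  x * y ^+ 2 * (j * t ^+ 2) ^+ 2 = x * (x * (y * t) ^+ 2) ^+ 2.
Proof. by move=> ->; ring. Qed.

(** Sq^1 is a derivation that squares one variable at a time, and G is a
    constant for it. *)
Lemma Sq1_letter J (G : P) : uniq J -> all (fun c => c < 5)%N J -> Sq 1 G = 0 ->
  Sq 1 ('X_[lm J] * G) = \sum_(c <- J) 'X_[lm (rem c J)] * xv c ^+ 2 * G.
Proof.
move=> + + G1; elim: J => [|c J IH] /=.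
  by rewrite lm_nil mpolyX0 mul1r big_nil.
move=> /andP[cJ Ju] /andP[c5 J5]; rewrite XlmE // -mulrA Sq_mulX Sq0 IH //.
rewrite big_cons eqxx mulr_sumr addrC; congr (_ + _); first by rewrite mulrA [_ * 'X_[_]]mulrC.
rewrite big_seq [RHS]big_seq; apply: eq_bigr => d dJ.
have -> : (c == d) = false by apply: contraNF cJ => /eqP->.
rewrite XlmE ?mulrA //.
by apply: contra cJ; apply: mem_rem.
Qed.

Lemma mem_sq2_rel J p : uniq J -> p \in sq2_rel J -> {subset p.1 <= J} /\ {subset p.2 <= J}.
Proof.
elim: J p => [|c J IH] p //= /andP[cJ Ju]; rewrite mem_cat => /orP[/mapP[q qJ ->]|/mapP[d dJ ->]] /=.
  have [q1 q2] := IH q Ju qJ; split=> x; rewrite !in_cons; last by move/q2->; rewrite orbT.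
  by case/orP=> [->//|/q1->]; rewrite orbT.
split=> x; first by move/mem_rem; rewrite in_cons => ->; rewrite orbT.
by rewrite !in_cons orbF => /orP[->//|/eqP->]; rewrite dJ orbT.
Qed.

(** By the Cartan formula Sq^2 squares two variables of the letter, G being a
    constant for Sq^1 and Sq^2. *)
Lemma Sq2_letter J (G : P) : uniq J -> all (fun c => c < 5)%N J -> Sq 1 G = 0 -> Sq 2 G = 0 ->
  Sq 2 ('X_[lm J] * G) = \sum_(p <- sq2_rel J) 'X_[lm p.1] * 'X_[lm p.2] ^+ 2 * G.
Proof.
move=> + + G1 G2; elim: J => [|c J IH] /=.
  by rewrite lm_nil mpolyX0 mul1r big_nil.
move=> /andP[cJ Ju] /andP[c5 J5]; rewrite XlmE // -mulrA Sq_mulX IH // Sq1_letter //.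
rewrite big_cat !big_map !mulr_sumr /=; congr (_ + _).
  rewrite big_seq [RHS]big_seq; apply: eq_bigr => p pJ; rewrite XlmE ?mulrA //.
  by have [p1 _] := mem_sq2_rel Ju pJ; apply: contra cJ => /p1.
rewrite big_seq [RHS]big_seq; apply: eq_bigr => d dJ.
have dc : c \notin [:: d] by rewrite inE; apply: contra cJ => /eqP->.
have d5 : (d < 5)%N := allP J5 d dJ.
rewrite XlmE // XlmE // lm_nil.
by rewrite mpolyX0 mulr1 sqr_mulCA.
Qed.

(** The word pre put in front of f, which need not be a monomial. *)
Definition app (pre : word) (f : P) : P := foldr (fun L g => 'X_[lm L] * g ^+ 2) f pre.

Lemma app_pm pre w : app pre (pm w) = pm (pre ++ w).
Proof. by elim: pre => //= L pre ->; rewrite pm_cons. Qed.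

Lemma appD pre f g : app pre (f + g) = app pre f + app pre g.
Proof. by elim: pre => //= L pre ->; rewrite mpoly2_sqrD mulrDr. Qed.

Lemma app0 pre : app pre 0 = 0.
Proof. by elim: pre => //= L pre ->; rewrite expr2 mulr0 mulr0. Qed.

Lemma app_sum pre (I : Type) (r : seq I) (F : I -> P) :
  app pre (\sum_(i <- r) F i) = \sum_(i <- r) app pre (F i).
Proof. by elim: r => [|i r IH]; rewrite ?big_nil ?app0 // !big_cons appD IH. Qed.

(** Two-letter relations may be used at any position of a word. *)
Lemma hitlow_app om o pre f : wd o pre -> hitlow om f -> hitlow (o ++ om) (app pre f).
Proof.
elim: o pre => [|a o IH] [|L pre] //= /andP[/letters_is[Ll <-] wp] fh.
by rewrite -(mdeg_lm Ll); apply: hitlow_cons (lm_sqfree L) (IH _ wp fh).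
Qed.

(** When c already occurs in g, the new factor x_c^2 cancels one odd exponent
    of the next letter, so its weight drops below b + 1. *)
Lemma lm_sq_low (a b : nat) c J g m : is_letter J -> size J = a.+1 -> is_letter g -> size g = b ->
  c \in J -> c \in g -> hitlow [:: a; b.+1] ('X_[lm (rem c J)] * (xv c * ('X_[lm g] * 'X_[m] ^+ 2)) ^+ 2).
Proof.
move=> Jl Ja gl gb cJ cg; apply: hitlow_low.
have -> : a = mdeg (lm (rem c J)) by rewrite mdeg_lm ?is_letter_rem // size_rem // Ja.
apply: low_mul_sqr (lm_sqfree _) _.
rewrite mpolyXn -!mpolyXD; apply/lowX/lowm_head.
rewrite addmA omega0_even ltnS -gb -(mdeg_lm gl) omega0 mdegE; apply: leq_sum => j _.
rewrite mnmDE mnm1E !mnmE -val_eqE /= inordK; last exact: is_letter_lt cg.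
by case: eqP => [<-|_] /=; [rewrite cg | rewrite add0n; case: (_ \in g)].
Qed.

Lemma lm_srt c g : is_letter g -> (c < 5)%N -> c \notin g -> 'X_[lm (srt (c :: g))] = xv c * 'X_[lm g] :> P.
Proof.
move=> gl c5 cg; rewrite -XlmE //; congr 'X_[_]; apply: eq_lm.
apply: mem_srt => d; rewrite in_cons mem_iota => /orP[/eqP->//|dg].
exact: is_letter_lt dg.
Qed.

Lemma char2_bigID (I : Type) (r : seq I) (Q : pred I) (F : I -> P) :
  \sum_(i <- r | ~~ Q i) F i = \sum_(i <- r) F i + \sum_(i <- r | Q i) F i.
Proof. by rewrite (bigID Q predT) /= addrAC mpoly2_addxx add0r. Qed.

(** The sum over c in J is Sq^1 of x_J times a square; the terms with c in g
    have lower weight. *)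
Lemma sq1_hitlow a b J g post : J \in letters a.+1 -> g \in letters b ->
  hitlow [:: a; b.+1] (\sum_(p <- sq1_rel J g) pm (p.1 :: p.2 :: post)).
Proof.
move=> /letters_is[Jl Ja] /letters_is[gl gb].
have Ju := is_letter_uniq Jl; have J5 : all (fun c => c < 5)%N J.
  by apply/allP => c; apply: is_letter_lt.
pose h := 'X_[lm g] * pm post ^+ 2.
pose F c := 'X_[lm (rem c J)] * (xv c * h) ^+ 2.
have eF : Sq 1 ('X_[lm J] * h ^+ 2) = \sum_(c <- J) F c.
  rewrite (Sq1_letter Ju J5); last by rewrite Sq_sqr.
  by apply: eq_bigr => c _; exact: mul_sqrA.
rewrite big_map big_filter.
rewrite (_ : \sum_(c <- J | _) _ = \sum_(c <- J | c \notin g) F c); last first.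
  rewrite big_seq_cond [RHS]big_seq_cond; apply: eq_bigr => c /andP[cJ cg].
  by rewrite /= !pm_cons (lm_srt gl (allP J5 _ cJ) cg) -(mulrA (xv c)).
rewrite (char2_bigID _ (fun c => c \in g)) -eF.
apply: hitlowD; first by apply/hitlow_hit/hit_Sq.
by apply: hitlow_sum => c cJ cg; apply: lm_sq_low.
Qed.

(** Sq^1 of x_J (x_J h^2)^2: as x_J = x_c x_(J-c), moving c leaves two letters
    J - c and sends c two places further. This relation changes multiplicities
    of letters, which exchanges of neighbours cannot do. *)
Lemma sq1_cube_hitlow a b J g post : J \in letters a.+1 -> g \in letters b ->
  hitlow [:: a; a; b.+1] (\sum_(p <- sq1_rel J g) pm [:: p.1, p.1, p.2 & post]).
Proof.
move=> /letters_is[Jl Ja] /letters_is[gl gb].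
have Ju := is_letter_uniq Jl; have J5 : all (fun c => c < 5)%N J.
  by apply/allP => c; apply: is_letter_lt.
pose h := 'X_[lm g] * pm post ^+ 2.
pose F c := 'X_[lm (rem c J)] * ('X_[lm (rem c J)] * (xv c * h) ^+ 2) ^+ 2.
have JE c : c \in J -> 'X_[lm J] = xv c * 'X_[lm (rem c J)] :> P.
  move=> cJ; rewrite -XlmE ?(allP J5) ?mem_rem_uniqF //; congr 'X_[_]; apply: eq_lm => d.
  exact: perm_mem (perm_to_rem cJ) d.
have eF : Sq 1 ('X_[lm J] * ('X_[lm J] * h ^+ 2) ^+ 2) = \sum_(c <- J) F c.
  rewrite (Sq1_letter Ju J5); last by rewrite Sq_sqr.
  apply: eq_big_seq => c cJ.
  exact: mul_sqrCA (JE c cJ).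
rewrite big_map big_filter.
rewrite (_ : \sum_(c <- J | _) _ = \sum_(c <- J | c \notin g) F c); last first.
  rewrite big_seq_cond [RHS]big_seq_cond; apply: eq_bigr => c /andP[cJ cg].
  by rewrite /= !pm_cons (lm_srt gl (allP J5 _ cJ) cg) -(mulrA (xv c)).
rewrite (char2_bigID _ (fun c => c \in g)) -eF.
apply: hitlowD; first by apply/hitlow_hit/hit_Sq.
apply: hitlow_sum => c cJ cg.
have aE : a = mdeg (lm (rem c J)) by rewrite mdeg_lm ?is_letter_rem // size_rem // Ja.
have := lm_sq_low (wm post) Jl Ja gl gb cJ cg; rewrite -/(pm post) -/h => l.
by have := hitlow_cons (lm_sqfree (rem c J)) l; rewrite -aE.
Qed.

(** The rest of the word enters as a fourth power, on which Sq^1 and Sq^2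
    vanish. *)
Lemma sq2_hitlow a J post : J \in letters a.+2 ->
  hitlow [:: a; 2]%N (\sum_(p <- sq2_rel J) pm (p.1 :: p.2 :: post)).
Proof.
move=> /letters_is[Jl Ja]; have Ju := is_letter_uniq Jl.
have J5 : all (fun c => c < 5)%N J by apply/allP => c; apply: is_letter_lt.
apply/hitlow_hit; rewrite (_ : \sum_(p <- _) _ = Sq 2 ('X_[lm J] * (pm post ^+ 2) ^+ 2)) ?hit_Sq //.
rewrite Sq2_letter //; first last.
- by rewrite Sq_sqr /= Sq_sqr /= expr2 mulr0.
- by rewrite Sq_sqr.
by apply: eq_bigr => p _; rewrite !pm_cons; exact: mul_sqrA2.
Qed.

(** * Classification of the weights in degree 2^n - 1 *)

Definition deg (om : seq nat) : nat := foldr (fun a d => a + 2 * d)%N 0%N om.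

(** The words of weight om vanish for every functional that kills lower
    weights: om contains one of the windows, or a zero followed by something
    nonzero, which makes the tail of the word a square. *)
Definition killed (om : seq nat) : Prop := exists o1 win o2,
  om = o1 ++ win ++ o2 /\ (win \in windows \/ win = [:: 0%N] /\ (0 < deg o2)%N).

Lemma killed_cat o om : killed om -> killed (o ++ om).
Proof.
by move=> [o1 [win [o2 [-> h]]]]; exists (o ++ o1), win, o2; rewrite catA.
Qed.

Lemma killed_window o1 win o2 : win \in windows -> killed (o1 ++ win ++ o2).
Proof. by move=> h; exists o1, win, o2; split=> //; left. Qed.

Lemma killed_zero o1 o2 : (0 < deg o2)%N -> killed (o1 ++ 0%N :: o2).
Proof. by move=> h; exists o1, [:: 0%N], o2; split=> //; right. Qed.

(** After a prefix that ends in x, 2 the rest has degree 2^m - 2, so its next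
    entry is even: 0 ends the weight or is followed by something nonzero, 4
    closes a window, and 2 continues. *)
Lemma state2_run x om m : x \in [:: 2; 3]%N -> size om = m -> (deg om + 2 = 2 ^ m)%N ->
  all (leq^~ 5) om -> om = nseq m.-1 2 ++ [:: 0%N] \/ killed (x :: 2 :: om)%N.
Proof.
elim: om x m => [|b om IH] x [|m] //= xE [sm] dm /andP[b5 om5].
rewrite expnS in dm.
have [b0|[b2|b4]] : b = 0%N \/ b = 2%N \/ b = 4%N by lia.
- subst b; case: m sm dm => [|m] sm dm.
    by case: om sm {IH dm om5} => // _; left.
  by right; apply: (@killed_zero [:: x; 2]%N); rewrite expnS in dm; have := expn_gt0 2 m; lia.
- subst b; case: (IH 2%N m) => //; try lia.
    case: m sm dm => [|m] sm dm e; last by left; rewrite e.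
    by move: dm; rewrite expn0; lia.
  by move=> k; right; apply: (@killed_cat [:: x]).
right; subst b; apply: (@killed_window [::] [:: x; 2; 4]%N).
by move: xE; rewrite !inE => /orP[] /eqP->.
Qed.

(** After a run of ones the rest has degree 2^m - 1, so its next entry is odd:
    5 closes a window, 1 continues, and 3 is killed together with what
    follows. *)
Lemma state1_run om m a : size om = m -> (deg om + 1 = 2 ^ m)%N -> all (leq^~ 5) om ->
  (1 <= a)%N -> (7 <= a + m)%N -> om = nseq m 1%N \/ killed (nseq a 1%N ++ om).
Proof.
elim: om m a => [|b om IH] [|m] a //=; first by left.
move=> [sm] dm /andP[b5 om5] a1 am; rewrite expnS in dm.
have nseqS n (s : seq nat) : nseq n 1%N ++ 1%N :: s = nseq n.+1 1%N ++ s.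
  by elim: n => //= n ->.
have [b1|[b3|b5']] : b = 1%N \/ b = 3%N \/ b = 5%N by lia.
- subst b; rewrite nseqS; case: (IH m a.+1) => //; try lia.
    by move->; left.
  by right.
- subst b; right; case: om sm dm om5 {IH} => [|b om] /= sm dm; first by move: dm; rewrite -sm expn0; lia.
  move=> /andP[b5' om5]; case: m sm dm am => // m [sm] dm am; rewrite expnS in dm.
  have [b0|[b2|b4]] : b = 0%N \/ b = 2%N \/ b = 4%N by lia.
  + subst b; case: m sm dm am => [|m] sm dm am.
      have -> : a = (3 + (a - 3))%N by lia.
      rewrite addnC nseqD -catA; apply: killed_cat.
      exact: (@killed_window [::] [:: 1; 1; 1; 3]%N).
    rewrite -cat_rcons; apply: killed_zero.
    by rewrite expnS in dm; have := expn_gt0 2 m; lia.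
  + subst b; case: a a1 {am} => // a _; rewrite -nseqS; apply: killed_cat.
    exact: (@killed_window [::] [:: 1; 3; 2]%N).
  subst b; case: a a1 {am} => // a _; rewrite -nseqS; apply: killed_cat.
  exact: (@killed_window [::] [:: 1; 3; 4]%N).
subst b; right; case: a a1 {am} => // a _; rewrite -nseqS; apply: killed_cat.
exact: (@killed_window [::] [:: 1; 5]%N).
Qed.

Definition generic3 n : seq nat := (3 :: nseq (n - 2) 2 ++ [:: 0])%N.

(** The parity of each entry is forced by the degree that remains. Starting
    with 1 leads to [state1_run]; starting with 3, the next entry is 0, 2 or
    4, where 2 leads to [state2_run] and 4 is killed within three further
    entries. *)
Lemma classify_weights om n : (7 <= n)%N -> size om = n -> (deg om + 1 = 2 ^ n)%N ->
  all (leq^~ 5) om -> (head 0 om <= 3)%N ->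
  [\/ om = nseq n 1%N, om = generic3 n | killed om].
Proof.
case: om => [|b om]; first by move=> n7 s0; rewrite -s0 in n7.
case: n => // n n7 [sn]; rewrite /= expnS => dn /andP[_ om5] b3.
have [b1|b3'] : b = 1%N \/ b = 3%N by lia.
  subst b; case: (@state1_run om n 1) => //; try lia.
    by move->; apply: Or31.
  by move=> k; apply: Or33.
subst b; clear b3; rewrite /generic3 subSS.
case: om sn om5 dn => [|b om]; first by move=> s0; rewrite -s0 in n7.
case: n n7 => // n n7 [sn] /= /andP[b5 om5]; rewrite expnS => dn.
have [b0|[b2|b4]] : b = 0%N \/ b = 2%N \/ b = 4%N by lia.
- subst b; apply: Or33; apply: (@killed_zero [:: 3]%N).
  by have := @leq_pexp2l 2 1 n isT; lia.
- subst b; have d2 : (deg om + 2 = 2 ^ n)%N by lia.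
  have [omE|k] := @state2_run 3 om n isT sn d2 om5; last by apply: Or33.
  by case: n n7 sn dn omE {d2} => // n _ _ _ ->; apply: Or32; rewrite subSS subn0.
subst b; apply: Or33.
case: om sn om5 dn => [|b om]; first by move=> s0; rewrite -s0 in n7.
case: n n7 => // n n7 [sn] /= /andP[b5' om5]; rewrite expnS => dn.
case: om sn om5 dn => [|c om]; first by move=> s0; rewrite -s0 in n7.
case: n n7 => // n n7 [sn] /= /andP[c5 om5]; rewrite expnS => dn.
have n3 := @leq_pexp2l 2 1 n isT.
have [b1|[b3|b5'']] : b = 1%N \/ b = 3%N \/ b = 5%N by lia.
- subst b; have [c0|[c2|c4]] : c = 0%N \/ c = 2%N \/ c = 4%N by lia.
  + by subst c; apply: (@killed_zero [:: 3; 4; 1]%N); lia.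
  + by subst c; apply: (@killed_window [:: 3; 4]%N [:: 1; 2]%N).
  by subst c; apply: (@killed_window [:: 3]%N [:: 4; 1; 4]%N).
- subst b; case: om sn om5 dn => [|d om]; first by move=> s0; rewrite -s0 in n7.
  case: n n7 {n3} => // n n7 [sn] /= /andP[d5 om5]; rewrite expnS => dn.
  have n2 := @leq_pexp2l 2 1 n isT.
  have [c1|[c3|c5']] : c = 1%N \/ c = 3%N \/ c = 5%N by lia.
  + subst c; have [c0|[c2|c4]] : d = 0%N \/ d = 2%N \/ d = 4%N by lia.
    * by subst d; apply: (@killed_zero [:: 3; 4; 3; 1]%N); lia.
    * by subst d; apply: (@killed_window [:: 3; 4; 3]%N [:: 1; 2]%N).
    by subst d; apply: (@killed_window [:: 3; 4]%N [:: 3; 1; 4]%N).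
  + subst c; have [c0|[c2|c4]] : d = 1%N \/ d = 3%N \/ d = 5%N by lia.
    * by subst d; apply: (@killed_window [::] [:: 3; 4; 3; 3; 1]%N).
    * by subst d; apply: (@killed_window [::] [:: 3; 4; 3; 3; 3]%N).
    by subst d; apply: (@killed_window [:: 3; 4; 3]%N [:: 3; 5]%N).
  by subst c; apply: (@killed_window [:: 3; 4]%N [:: 3; 5]%N).
by subst b; apply: (@killed_window [:: 3]%N [:: 4; 5]%N).
Qed.

(** * Functionals on words *)

Definition first_letter (m : 'X_{1..5}) : letter := [seq c <- iota 0 5 | odd (m (inord c))].
Fixpoint word_of n (m : 'X_{1..5}) : word :=
  if n is n'.+1 then first_letter m :: word_of n' (half m) else [::].

Lemma lm_first_letter m : (lm (first_letter m) + half m *+ 2)%MM = m.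
Proof.
apply/mnmP => j; rewrite mnmDE mulmnE !mnmE mem_filter mem_iota /= add0n ltn_ord andbT.
by rewrite inord_val muln2 odd_double_half.
Qed.

Lemma first_letterP m : first_letter m \in letters (omega m 0).
Proof.
have l : is_letter (first_letter m) by apply: filter_subseq.
have e : omega m 0 = mdeg (lm (first_letter m)).
  by rewrite -{1}(lm_first_letter m) omega_add2 ?lm_sqfree.
by rewrite mem_letters -/(is_letter _) l e mdeg_lm /=.
Qed.

Definition weight n (m : 'X_{1..5}) : seq nat := mkseq (omega m) n.

Lemma weightS n m : weight n.+1 m = omega m 0 :: weight n (half m).
Proof.
rewrite /weight /mkseq /= (iotaDl 1 0) -map_comp; congr cons.
by apply: eq_map => i /=; rewrite omegaS.
Qed.

Lemma wd_word_of n m : wd (weight n m) (word_of n m).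
Proof. by elim: n m => // n IH m; rewrite weightS /= first_letterP IH. Qed.

(** The letters of a monomial are its binary digits; n of them suffice for
    exponents below 2^n. *)
Lemma wm_word_of n (m : 'X_{1..5}) : (forall j, m j < 2 ^ n)%N -> wm (word_of n m) = m.
Proof.
elim: n m => [|n IH] m mn /=.
  by apply/mnmP => j; rewrite mnmE; have := mn j; case: (m j).
rewrite IH ?lm_first_letter // => j; rewrite mnmE.
by have := mn j; rewrite expnS; have := odd_double_half (m j); lia.
Qed.

Lemma mdeg_wm om w : wd om w -> mdeg (wm w) = deg om.
Proof.
elim: om w => [|a om IH] [|L w] //=; first by rewrite mdeg0.
move=> /andP[/letters_is[Ll <-] /IH e].
by rewrite mdegD mdegMn mdeg_lm // e mulnC.
Qed.

Lemma lexlt_cat s t u v : lexlt s t -> size s = size t -> lexlt (s ++ u) (t ++ v).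
Proof. by elim: s t => [|x s IH] [|y t] //= /orP[-> //|/andP[-> h] [/(IH _ h)->]]; rewrite orbT. Qed.

Lemma lowm_prefix o1 o2 (m : 'X_{1..5}) : lowm o1 m -> lowm (o1 ++ o2) m.
Proof.
rewrite /lowm size_cat /mkseq iotaD map_cat => /lexlt_cat; apply.
by rewrite size_map size_iota.
Qed.

Section Functional.
Variables (N : nat) (lam : P -> 'F_2).
Hypothesis lamD : forall f g, lam (f + g) = lam f + lam g.
Hypothesis lam_hit : forall f, f \in @hit 5 -> lam f = 0.
Hypothesis lam_deg : forall m, mdeg m != N -> lam 'X_[m] = 0.

Lemma lam0 : lam 0 = 0. Proof. by rewrite lam_hit ?rpred0. Qed.

Lemma lam_sum (I : Type) (r : seq I) (F : I -> P) :
  lam (\sum_(i <- r) F i) = \sum_(i <- r) lam (F i).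
Proof. by elim: r => [|i r IH]; rewrite ?big_nil ?lam0 // !big_cons lamD IH. Qed.

Lemma lam_supp f : {in msupp f, forall m, lam 'X_[m] = 0} -> lam f = 0.
Proof.
move=> f0; rewrite [f]mpolyE lam_sum big_seq big1 // => m mf.
have [->|->] := F2_01 f@_m.
- by rewrite scale0r lam0.
by rewrite scale1r f0.
Qed.

(** Only monomials of degree N matter, since lam vanishes on the others. *)
Definition vanish_below (om : seq nat) : Prop :=
  forall m, mdeg m = N -> lowm om m -> lam 'X_[m] = 0.

Lemma vanish_hitlow om f : vanish_below om -> hitlow om f -> lam f = 0.
Proof.
move=> v [g gh /allP fgl].
have -> : f = (f + g) + g by rewrite -addrA mpoly2_addxx addr0.
rewrite lamD (lam_hit gh) addr0; apply: lam_supp => m /fgl ml.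
by have [/eqP mN|/lam_deg] := boolP (mdeg m == N); first by apply: v.
Qed.

Lemma vanish_prefix o1 o2 : vanish_below (o1 ++ o2) -> vanish_below o1.
Proof. by move=> v m mN /lowm_prefix ml; apply: v. Qed.

Lemma wd_split o1 o2 w : wd (o1 ++ o2) w ->
  exists w1 w2, [/\ w = w1 ++ w2, wd o1 w1 & wd o2 w2].
Proof.
elim: o1 w => [|a o1 IH] w; first by exists [::], w.
case: w => [|L w] //= /andP[La /IH[w1 [w2 [-> wd1 wd2]]]].
by exists (L :: w1), w2; rewrite /= La.
Qed.

(** The exchange relations are hit modulo lower weight, at any position of a
    word, so lam respects them. *)
Lemma lam_exch om : vanish_below om -> exch om (fun w => lam (pm w)).
Proof.
move=> v o1 a b o2 pre post R omE wpre wpost Rab.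
rewrite -lam_sum; under eq_bigr do rewrite -app_pm.
rewrite -app_sum; apply: (vanish_hitlow (om := o1 ++ [:: a; b])).
  by apply: (@vanish_prefix _ o2); rewrite -catA -omE.
apply: hitlow_app => //; move: Rab; rewrite mem_cat => /orP[].
  case: b {omE} => [|b]; first by rewrite in_nil.
  by case/allpairsP=> p [Ja gb ->]; exact: sq1_hitlow Ja gb.
case: eqP => [->|_]; last by rewrite in_nil.
by case/mapP=> J Ja ->; exact: sq2_hitlow Ja.
Qed.

Lemma exch_context o1 om o2 (G : word -> 'F_2) pre post : wd o1 pre -> wd o2 post ->
  exch (o1 ++ om ++ o2) G -> exch om (fun w => G (pre ++ w ++ post)).
Proof.
move=> wpre wpost GE o1' a b o2' pre' post' R omE wpre' wpost' Rab.
rewrite -[RHS](GE (o1 ++ o1') a b (o2' ++ o2) (pre ++ pre') (post' ++ post) R) //.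
- by apply: eq_bigr => p _; rewrite -!catA.
- by rewrite omE -!catA.
- exact: wd_cat.
exact: wd_cat.
Qed.

(** A window is killed by the exchange relations alone. When a letter is
    empty, the rest of the word is the square of a nonconstant monomial, which
    is hit. *)
Lemma lam_killed om w : killed om -> vanish_below om -> wd om w -> lam (pm w) = 0.
Proof.
move=> [o1 [win [o2 [-> h]]]] v /wd_split[w1 [_ [-> wd1 /wd_split[w2 [w3 [-> wd2 wd3]]]]]].
case: h => [inw|[we d0]].
  apply: (kills_sound (om := win) (G := fun w => lam (pm (w1 ++ w ++ w3)))) => //.
    exact: (allP kills_windows).
  by apply: exch_context (lam_exch v).
move: wd2; rewrite we => /(@wd_rcons [::])[[|? ?] [L [-> // _ /letters_is[_ /size0nil->]]]].
rewrite -app_pm; apply: (vanish_hitlow (om := o1 ++ [::])).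
  by rewrite cats0; apply: vanish_prefix v.
apply: hitlow_app => //; apply: hitlow_hit.
rewrite pm_cons lm_nil mpolyX0 mul1r; apply: sqr_hit.
by rewrite -mdeg_eq0 (mdeg_wm wd3) -lt0n.
Qed.

End Functional.

(** * Functions of a word which depend on its set of letters only *)

Lemma perm_middle (T : eqType) (x : T) s t : perm_eql (s ++ x :: t) (x :: s ++ t).
Proof. exact: (perm_catCA s [:: x] t). Qed.

Section Support.
Variables (T : eqType) (V : Type) (A : {pred T}) (n : nat) (f : seq T -> V).
Hypothesis f_swap : forall u v p q, {subset u ++ p :: q :: v <= A} ->
  size (u ++ p :: q :: v) = n -> f (u ++ p :: q :: v) = f (u ++ q :: p :: v).
Hypothesis f_dup : forall p q v, {subset p :: q :: v <= A} ->
  size (p :: p :: q :: v) = n -> f (p :: p :: q :: v) = f (p :: q :: q :: v).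

Lemma front_invariance u s x t : {subset u ++ s ++ x :: t <= A} ->
  size (u ++ s ++ x :: t) = n -> f (u ++ s ++ x :: t) = f (u ++ x :: s ++ t).
Proof.
elim: s u => [|y s IH] u //= sA sn.
have e : u ++ y :: s ++ x :: t = rcons u y ++ s ++ x :: t by rewrite cat_rcons.
rewrite e IH -?e // cat_rcons; apply: f_swap.
  move=> z zin; apply: sA; rewrite !mem_cat !inE !mem_cat !inE in zin *.
  by case/or4P: zin => [|||/orP[]] -> //=; rewrite ?orbT.
by move: sn; rewrite !size_cat /= !size_cat /=; lia.
Qed.

Lemma perm_invariance u s t : {subset u ++ s <= A} -> size (u ++ s) = n ->
  perm_eq s t -> f (u ++ s) = f (u ++ t).
Proof.
elim: s u t => [|x s IH] u t sA sn st; first by move: st; rewrite perm_sym => /perm_nilP->.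
have xt : x \in t by rewrite -(perm_mem st) mem_head.
case/splitPr: t / xt st => t1 t2 st.
rewrite [RHS]front_invariance; first last.
- by move: sn; rewrite !size_cat (perm_size st) size_cat.
- move=> z; rewrite mem_cat -(perm_mem st) -mem_cat; exact: sA.
rewrite -!cat_rcons; apply: IH; rewrite ?cat_rcons //.
by rewrite -(perm_cons x) (perm_trans st) // perm_middle.
Qed.

Lemma undup_perm (s : seq T) : exists2 R, perm_eq s (undup s ++ R) & {subset R <= s}.
Proof.
elim: s => [|x s [R sR Rs]]; first by exists [::].
have Rxs : {subset R <= x :: s} by move=> y /Rs; rewrite inE orbC => ->.
rewrite /=; case: ifP => xs; last by exists R; rewrite // perm_cons.
exists (x :: R); first by rewrite perm_sym perm_middle perm_cons perm_sym.
by move=> y; rewrite inE => /orP[/eqP->|/Rxs//]; rewrite mem_head.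
Qed.

(** If D contains r and x, then r and x both occur in the word, and f_dup
    turns one superfluous r into an x. *)
Lemma dup_invariance (D : seq T) r x (R : seq T) : {subset D <= A} -> {subset R <= D} -> r \in D -> x \in D ->
  size (D ++ r :: R) = n -> f (D ++ r :: R) = f (D ++ x :: R).
Proof.
move=> DA RD rD xD sn; have [->//|rx] := eqVneq r x.
have pD := perm_to_rem rD; have xD' : x \in rem r D.
  by move: xD; rewrite (perm_mem pD) inE eq_sym (negPf rx).
have {}pD : perm_eq D [:: r, x & rem x (rem r D)].
  by rewrite (perm_trans pD) // perm_cons perm_to_rem.
set D' := rem x (rem r D) in pD.
have D'D : {subset D' <= D} by move=> z zD'; rewrite (perm_mem pD) !inE zD' !orbT.
have subA : {subset D ++ r :: R <= A}.
  by move=> z; rewrite mem_cat inE => /or3P[zD|/eqP->|/RD zD]; exact: DA.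
have subA' : {subset D ++ x :: R <= A}.
  by move=> z; rewrite mem_cat inE => /or3P[zD|/eqP->|/RD zD]; exact: DA.
rewrite (@perm_invariance [::] _ [:: r, r, x & D' ++ R]) //; last first.
  by rewrite perm_middle perm_cons -!cat_cons perm_cat2r.
rewrite [RHS](@perm_invariance [::] _ [:: r, x, x & D' ++ R]) //; first last.
- rewrite perm_middle -[X in perm_eq _ X]/([:: r] ++ x :: (x :: D' ++ R)) perm_sym perm_middle.
  by rewrite perm_cons perm_sym -[X in perm_eq _ X]/([:: r, x & D'] ++ R) perm_cat2r.
- by move: sn; rewrite !size_cat.
apply: f_dup => [z|]; last by move: sn; rewrite /= !size_cat (perm_size pD) /=; lia.
by rewrite !inE mem_cat => /or4P[/eqP->|/eqP->|/D'D zD|/RD zD]; exact: DA.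
Qed.

Lemma support_normal (u : seq T) x : {subset u <= A} -> size u = n -> x \in u ->
  f u = f (undup u ++ nseq (n - size (undup u)) x).
Proof.
move=> uA un xu; have [R uR Ru] := undup_perm u.
have DA : {subset undup u <= A} by move=> z; rewrite mem_undup => /uA.
have RD : {subset R <= undup u} by move=> z /Ru; rewrite mem_undup.
have xD : x \in undup u by rewrite mem_undup.
have gen R' l : {subset R' <= undup u} -> size (undup u ++ R' ++ nseq l x) = n ->
    f (undup u ++ R' ++ nseq l x) = f (undup u ++ nseq (size R' + l) x).
  elim: R' l => [|r R' IH] l R'D sn; first by [].
  have R'D' : {subset R' <= undup u} by move=> z zR; apply: R'D; rewrite inE zR orbT.
  have RxD : {subset R' ++ nseq l x <= undup u}.
    by move=> z; rewrite mem_cat mem_nseq => /orP[/R'D'//|/andP[_ /eqP->]].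
  rewrite cat_cons (dup_invariance DA RxD _ xD sn); last by apply: R'D; rewrite mem_head.
  have p : perm_eq (x :: R' ++ nseq l x) (R' ++ nseq l.+1 x).
    by rewrite -[nseq l.+1 x]/(x :: nseq l x) perm_sym perm_middle.
  have sn' : size (undup u ++ R' ++ nseq l.+1 x) = n.
    by move: sn; rewrite !size_cat !size_nseq /=; lia.
  rewrite addSnnS -IH //; apply: perm_invariance p.
    move=> z; rewrite mem_cat inE => /or3P[/DA//|/eqP->|/RxD/DA//]; exact: DA.
  by rewrite -sn !size_cat /= size_cat; lia.
have e : size R = (n - size (undup u))%N by rewrite -un (perm_size uR) size_cat addKn.
have s0 : size (undup u ++ R ++ nseq 0 x) = n by rewrite cats0 -(perm_size uR).
by rewrite (@perm_invariance [::] _ _ uA un uR) -e -[size R]addn0 -gen //= cats0.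
Qed.

(** Exchanging neighbours gives invariance under permutations; the relation
    ppq = pqq moves multiplicities between letters, so every word can be
    brought to the form in which all repetitions are of one chosen letter. *)
Lemma support_invariance (u v : seq T) : {subset u <= A} -> size u = n -> size v = n ->
  u =i v -> f u = f v.
Proof.
have [->|[x xu]] : u = [::] \/ exists x, x \in u.
  by case: u => [|x u]; [left | right; exists x; rewrite mem_head].
  by move=> _ <- /size0nil->.
move=> uA un vn uv; have xv : x \in v by rewrite -uv.
have vA : {subset v <= A} by move=> z; rewrite -uv => /uA.
rewrite (support_normal uA un xu) (support_normal vA vn xv).
have p : perm_eq (undup u) (undup v).
  by apply: uniq_perm; rewrite ?undup_uniq // => z; rewrite !mem_undup.
rewrite (perm_size p); apply: (@perm_invariance [::]); last by rewrite perm_cat2r.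
  by move=> z; rewrite /= mem_cat mem_undup mem_nseq => /orP[/uA//|/andP[_ /eqP->]]; apply: vA.
rewrite /= size_cat size_nseq (perm_size p) subnKC // -vn; exact: size_undup.
Qed.
End Support.

(** * The two surviving weights *)

Lemma nil_subset (T : eqType) (s : seq T) : {subset [::] <= s}.
Proof. by []. Qed.

Lemma cons_subset (T : eqType) (x : T) (r s : seq T) : x \in s -> {subset r <= s} -> {subset x :: r <= s}.
Proof. by move=> xs rs z; rewrite in_cons => /orP[/eqP->|/rs]. Qed.

Definition pair_rels : seq (seq word) := [seq [seq [:: x.1; x.2] | x <- R] | R <- rels2 2 2].

Lemma pair_swap_check :
  let piv := elim key_word pair_rels in
  all (fun p => all (fun q => nilp (nf key_word piv [:: [:: p; q]; [:: q; p]])) pairs) pairs.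
Proof. vm_cast_no_check (erefl true). Qed.

(** The exchange relations between two neighbouring pairs contain the
    commutation of pairs and the Pluecker relations. *)
Lemma pair_plucker_check :
  let piv := elim key_word pair_rels in
  all (fun Q => nilp (nf key_word piv [seq [:: x.1; x.2] | x <- plucker Q])) (letters 4).
Proof. vm_cast_no_check (erefl true). Qed.

Definition sort_pairs (w : word) : word :=
  flatten [seq nseq (count_mem p w) p | p <- pairs].

(** Relations between words of four pairs up to order: those of two neighbours
    next to two further pairs, and the multiplicity changing ones. *)
Definition quad_rels : seq (seq word) :=
  [seq [seq sort_pairs [:: x.1; x.2; v.1; v.2] | x <- R] | R <- rels2 2 2,
     v <- [seq (p, q) | p <- pairs, q <- pairs]] ++
  [seq [seq sort_pairs [:: x.1; x.1; x.2; v.2] | x <- sq1_rel v.1.1 v.1.2]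
     | v <- [seq (u, p) | u <- [seq (J, g) | J <- letters 3, g <- letters 1], p <- pairs]].

(** The change of multiplicity needs a third pair r in the context; this is
    where words of at least four pairs are needed. *)
Lemma pair_dup_check :
  let piv := elim key_word quad_rels in
  all (fun p => all (fun q => all (fun r =>
    nilp (nf key_word piv [:: sort_pairs [:: p; p; q; r]; sort_pairs [:: p; q; q; r]])) pairs) pairs) pairs.
Proof. vm_cast_no_check (erefl true). Qed.

Lemma sort_pairs_perm w : {subset w <= pairs} -> perm_eq (sort_pairs w) w.
Proof.
move=> wp; apply/allP => y _ /=; apply/eqP.
rewrite count_flatten sumnE !big_map.
under eq_bigr do rewrite count_nseq /=.
have [yp|yp] := boolP (y \in pairs).
  rewrite (bigD1_seq y) ?uniq_pairs //= eqxx mul1n big1 ?addn0 // => p.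
  by rewrite eq_sym eq_sym; case: eqP.
have /count_memPn-> : y \notin w by apply: contra yp => /wp.
rewrite big_seq big1 // => p pp; case: eqP => [e|_]; last by rewrite mul0n.
by rewrite -e pp in yp.
Qed.

Definition singles (u : letter) : word := [seq [:: c] | c <- u].

(** Sq^1 of x_p x_q gives the exchange of the one-element letters p and q. *)
Lemma single_swap_rel p q : p \in iota 0 5 -> q \in iota 0 5 -> p != q ->
  exists2 J, J \in letters 2 & perm_eq (sq1_rel J [::]) [:: ([:: p], [:: q]); ([:: q], [:: p])].
Proof.
have /allP h : all (fun p => all (fun q => (p != q) ==> has (fun J =>
   perm_eq (sq1_rel J [::]) [:: ([:: p], [:: q]); ([:: q], [:: p])]) (letters 2)) (iota 0 5)) (iota 0 5).
  by vm_compute.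
by move=> /h/allP/[apply]/implyP/[apply]/hasP.
Qed.

Lemma sq1_rel_in a b J g : J \in letters a.+1 -> g \in letters b -> sq1_rel J g \in rels2 a b.+1.
Proof.
move=> Ja gb; rewrite mem_cat; apply/orP; left.
by apply/allpairsP; exists (J, g); split; [exact: Ja|exact: gb|].
Qed.

Lemma letters0 : [::] \in letters 0. Proof. by []. Qed.
Lemma letters1 c : c \in iota 0 5 -> [:: c] \in letters 1.
Proof. by move=> c5; rewrite mem_letters sub1seq c5. Qed.

Lemma letters1P L : L \in letters 1 -> exists2 c, c \in iota 0 5 & L = [:: c].
Proof.
rewrite mem_letters => /andP[s]; case: L s => [|c []] //.
by rewrite sub1seq => c5 _; exists c.
Qed.

Lemma wd_nseq r n w : wd (nseq n r) w <-> {subset w <= letters r} /\ size w = n.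
Proof.
elim: n w => [|n IH] [|L w] //=; try by split=> // -[].
split=> [/andP[Lr /IH[wr <-]]|[wr [sw]]].
  by split=> // z; rewrite in_cons => /orP[/eqP->|/wr].
rewrite (wr L (mem_head _ _)); apply/IH; split=> // z zw.
by apply: wr; rewrite in_cons zw orbT.
Qed.

Lemma wd_singles u : {subset u <= iota 0 5} -> wd (nseq (size u) 1%N) (singles u).
Proof.
move=> u5; apply/wd_nseq; rewrite size_map; split=> // L /mapP[c /u5 c5 ->].
exact: letters1.
Qed.

Lemma wd_singlesP n w : wd (nseq n 1%N) w ->
  exists u, [/\ w = singles u, {subset u <= iota 0 5} & size u = n].
Proof.
elim: n w => [|n IH] [|L w] //=; first by exists [::].
case/andP=> /letters1P[c c5 ->] /IH[u [-> u5 <-]]; exists (c :: u); split=> // z.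
by rewrite in_cons => /orP[/eqP->|/u5].
Qed.

(** A linear form on (QP_5)_N, seen as an additive function on all polynomials
    that ignores the other degrees. Over F_2 additive functions are linear. *)
Definition A_functional N (lam : P -> 'F_2) : Prop :=
  [/\ forall f g, lam (f + g) = lam f + lam g,
      forall f, f \in @hit 5 -> lam f = 0
    & forall m, mdeg m != N -> lam 'X_[m] = 0].

Section Words.
Variables (N : nat) (lam : P -> 'F_2).
Hypothesis lamA : A_functional N lam.
Let lamD : forall f g, lam (f + g) = lam f + lam g. Proof. by case: lamA. Qed.
Let lamH : forall f, f \in @hit 5 -> lam f = 0. Proof. by case: lamA. Qed.
Let lamN : forall m, mdeg m != N -> lam 'X_[m] = 0. Proof. by case: lamA. Qed.

Lemma F2_addr_eq (x y : 'F_2) : x + y = 0 -> x = y.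
Proof. by move/eqP; rewrite addr_eq0 F2_oppr => /eqP. Qed.

Section Singles.
Variable n : nat.
Hypothesis v1 : vanish_below N lam (nseq n 1%N).

Lemma singles_swap u v p q : {subset u ++ p :: q :: v <= iota 0 5} ->
  size (u ++ p :: q :: v) = n ->
  lam (pm (singles (u ++ p :: q :: v))) = lam (pm (singles (u ++ q :: p :: v))).
Proof.
move=> s5 sn; have [->//|pq] := eqVneq p q.
have p5 : p \in iota 0 5 by apply: s5; rewrite mem_cat mem_head orbT.
have q5 : q \in iota 0 5 by apply: s5; rewrite mem_cat !in_cons eqxx !orbT.
have [J J2 Jpq] := single_swap_rel p5 q5 pq.
have GE := lam_exch lamD lamH lamN v1.
have := GE (nseq (size u) 1%N) 1%N 1%N (nseq (size v) 1%N) (singles u) (singles v) (sq1_rel J [::]).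
rewrite (perm_big _ Jpq) !big_cons big_nil /= addr0 /singles !map_cat /= => e.
apply/F2_addr_eq/e.
- by rewrite -sn size_cat /= -[X in _ = _ ++ X]/(nseq (size v).+2 1%N) -nseqD.
- by apply: wd_singles => c cu; apply: s5; rewrite mem_cat cu.
- by apply: wd_singles => c cv; apply: s5; rewrite mem_cat !in_cons cv !orbT.
exact: sq1_rel_in J2 letters0.
Qed.

Lemma singles_dup p q v : {subset p :: q :: v <= iota 0 5} -> size (p :: p :: q :: v) = n ->
  lam (pm (singles (p :: p :: q :: v))) = lam (pm (singles (p :: q :: q :: v))).
Proof.
move=> s5 sn; have [->//|pq] := eqVneq p q.
have p5 : p \in iota 0 5 by apply: s5; rewrite mem_head.
have q5 : q \in iota 0 5 by apply: s5; rewrite !in_cons eqxx !orbT.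
have [J J2 Jpq] := single_swap_rel p5 q5 pq.
have s5' : {subset [:: q, q, p & v] <= iota 0 5}.
  by move=> z; rewrite !in_cons => /or4P[/eqP->|/eqP->|/eqP->|zv] //; apply: s5; rewrite !in_cons zv !orbT.
have s5'' : {subset [:: q, p, q & v] <= iota 0 5}.
  by move=> z; rewrite !in_cons => /or4P[/eqP->|/eqP->|/eqP->|zv] //; apply: s5; rewrite !in_cons zv !orbT.
have <- := @singles_swap [::] (q :: v) q p s5'' sn.
have <- := @singles_swap [:: q] v q p s5' sn.
apply: F2_addr_eq; rewrite -lamD.
have : hitlow [:: 1; 1; 1]%N (\sum_(x <- sq1_rel J [::]) pm [:: x.1, x.1, x.2 & singles v]).
  exact: sq1_cube_hitlow J2 letters0.
rewrite (perm_big _ Jpq) !big_cons big_nil /= addr0.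
apply: (vanish_hitlow lamD lamH lamN); apply: (@vanish_prefix _ _ _ (nseq (size v) 1%N)).
by move: sn v1 => /= <-.
Qed.

Lemma singles_support u v : {subset u <= iota 0 5} -> size u = n -> size v = n -> u =i v ->
  lam (pm (singles u)) = lam (pm (singles v)).
Proof.
exact: (@support_invariance _ _ (mem (iota 0 5)) n (fun u => lam (pm (singles u)))
  singles_swap singles_dup).
Qed.
End Singles.

Section Pairs.
Variable m : nat.
Hypothesis m4 : (4 <= m)%N.
Hypothesis v3 : vanish_below N lam (3 :: nseq m 2)%N.
Variable A : letter.
Hypothesis A3 : A \in letters 3.

Lemma pairs_exch o1 o2 o3 u v : nseq m 2%N = o1 ++ o2 ++ o3 -> wd o1 u -> wd o3 v ->
  exch o2 (fun w => lam (pm (A :: u ++ w ++ v))).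
Proof.
move=> mE wu wv; apply: (@exch_context (3%N :: o1) o2 o3 (fun w => lam (pm w)) (A :: u) v) => //.
  by rewrite /= A3.
rewrite cat_cons -mE.
by have GE := lam_exch lamD lamH lamN v3.
Qed.

Lemma pairs_exch22 u v : {subset u <= pairs} -> {subset v <= pairs} ->
  (size u + 2 + size v)%N = m ->
  forall s, s \in pair_rels -> \sum_(w <- s) lam (pm (A :: u ++ w ++ v)) = 0.
Proof.
move=> up vp sm s /mapP[R Rab ->]; rewrite big_map.
have GE : exch [:: 2; 2]%N (fun w => lam (pm (A :: u ++ w ++ v))).
  apply: (@pairs_exch (nseq (size u) 2%N) _ (nseq (size v) 2%N)).
  - by rewrite -sm -addnA !nseqD.
  - by apply/wd_nseq.
  by apply/wd_nseq.
exact: (GE [::] 2%N 2%N [::] [::] [::] R).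
Qed.

Lemma pairs_swap u v p q : {subset u ++ p :: q :: v <= pairs} -> size (u ++ p :: q :: v) = m ->
  lam (pm (A :: u ++ p :: q :: v)) = lam (pm (A :: u ++ q :: p :: v)).
Proof.
move=> sp sm; have up : {subset u <= pairs} by move=> z zu; apply: sp; rewrite mem_cat zu.
have vp : {subset v <= pairs} by move=> z zv; apply: sp; rewrite mem_cat !in_cons zv !orbT.
have pp : p \in pairs by apply: sp; rewrite mem_cat mem_head orbT.
have qp : q \in pairs by apply: sp; rewrite mem_cat !in_cons eqxx !orbT.
have sm' : (size u + 2 + size v)%N = m by rewrite -sm size_cat /=; lia.
have /allP/(_ p pp)/allP/(_ q qp)/elim_zero/(_ (pairs_exch22 up vp sm')) := pair_swap_check.
by rewrite !big_cons big_nil addr0 => /F2_addr_eq.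
Qed.

Lemma pairs_plucker Q w : Q \in letters 4 -> {subset w <= pairs} -> (size w).+2 = m ->
  \sum_(x <- plucker Q) lam (pm [:: A, x.1, x.2 & w]) = 0.
Proof.
move=> Q4 wp sm; have sm' : (size (Nil letter) + 2 + size w)%N = m by rewrite -sm.
have np : {subset Nil letter <= pairs} := @nil_subset _ pairs.
have /allP/(_ Q Q4)/elim_zero/(_ (pairs_exch22 np wp sm')) := pair_plucker_check.
by rewrite big_map.
Qed.

Lemma pairs_perm s t : {subset s <= pairs} -> size s = m -> perm_eq s t ->
  lam (pm (A :: s)) = lam (pm (A :: t)).
Proof. exact: (@perm_invariance _ _ (mem pairs) m (fun w => lam (pm (A :: w))) pairs_swap [::]). Qed.

Lemma pairs_dup p q v : {subset p :: q :: v <= pairs} -> size (p :: p :: q :: v) = m ->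
  lam (pm [:: A, p, p, q & v]) = lam (pm [:: A, p, q, q & v]).
Proof.
move=> sp sm; case: v sp sm => [|r v] sp sm; first by have := m4; rewrite -sm.
have pp : p \in pairs by apply: sp; rewrite mem_head.
have qp : q \in pairs by apply: sp; rewrite !in_cons eqxx !orbT.
have rp : r \in pairs by apply: sp; rewrite !in_cons eqxx !orbT.
have vp : {subset v <= pairs} by move=> z zv; apply: sp; rewrite !in_cons zv !orbT.
pose F w := lam (pm (A :: w ++ v)).
have F_sort w : {subset w <= pairs} -> size w = 4%N -> F (sort_pairs w) = F w.
  move=> wp w4; have ps := sort_pairs_perm wp; apply: pairs_perm.
  - by move=> z; rewrite mem_cat (perm_mem ps) => /orP[/wp|/vp].
  - by rewrite size_cat (perm_size ps) w4 -sm.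
  by rewrite perm_cat2r.
have sub4 a b c d : a \in pairs -> b \in pairs -> c \in pairs -> d \in pairs ->
  {subset [:: a; b; c; d] <= pairs}.
  move=> ap bp cp dp.
  exact: cons_subset ap (cons_subset bp (cons_subset cp (cons_subset dp (@nil_subset _ pairs)))).
have sv : size v = (m - 4)%N by rewrite -sm /= -[(size v).+4]addn4 addnK.
have F_rels s : s \in quad_rels -> \sum_(w <- s) F w = 0.
  rewrite mem_cat => /orP[/allpairsP[x [Rab /allpairsP[y [y1 y2 xE]] ->]]|].
    rewrite big_map xE /=.
    transitivity (\sum_(z <- x.1) F [:: z.1; z.2; y.1; y.2]).
      apply: eq_big_seq => z zR; have [z1 z2] := mem_rels2 Rab zR.
      exact: F_sort (sub4 _ _ _ _ z1 z2 y1 y2) erefl.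
    have vp' : {subset [:: y.1, y.2 & v] <= pairs} := cons_subset y1 (cons_subset y2 vp).
    have sm' : (size (Nil letter) + 2 + size [:: y.1, y.2 & v])%N = m.
      by rewrite /= sv; lia.
    have := pairs_exch22 (@nil_subset _ pairs) vp' sm' (map_f _ Rab).
    by rewrite big_map.
  case/mapP=> y /allpairsP[z [/allpairsP[w [w1 w2 zE]] z2 yE]] ->.
  rewrite big_map yE zE /=.
  have wR : sq1_rel w.1 w.2 \in rels2 2 2 := sq1_rel_in w1 w2.
  transitivity (\sum_(x <- sq1_rel w.1 w.2) F [:: x.1; x.1; x.2; z.2]).
    apply: eq_big_seq => x xR; have [x1 x2] := mem_rels2 wR xR.
    exact: F_sort (sub4 _ _ _ _ x1 x1 x2 z2) erefl.
  have := hitlow_app (o := [:: 3%N]) (pre := [:: A]) _ (sq1_cube_hitlow (z.2 :: v) w1 w2).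
  rewrite /= A3 => /(_ isT) hl.
  rewrite /F -(lam_sum lamD lamH); under eq_bigr do rewrite cat_cons -cat1s -app_pm.
  rewrite -app_sum; apply: (vanish_hitlow lamD lamH lamN _ hl).
  apply: (@vanish_prefix _ _ _ (nseq (m - 3) 2%N)); rewrite /= -[[:: 2, 2, 2 & _]%N]/(nseq (m - 3).+3 2%N).
  by have -> : (m - 3).+3 = m by lia.
have /allP/(_ p pp)/allP/(_ q qp)/allP/(_ r rp)/elim_zero/(_ F_rels) := pair_dup_check.
rewrite !big_cons big_nil addr0 => /F2_addr_eq.
by rewrite (F_sort _ (sub4 _ _ _ _ pp pp qp rp)) // (F_sort _ (sub4 _ _ _ _ pp qp qp rp)).
Qed.

Lemma pairs_support u v : {subset u <= pairs} -> size u = m -> size v = m -> u =i v ->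
  lam (pm (A :: u)) = lam (pm (A :: v)).
Proof. exact: (@support_invariance _ _ (mem pairs) m (fun w => lam (pm (A :: w))) pairs_swap pairs_dup). Qed.
End Pairs.

(** Sq^1 of a letter J with four elements followed by the letter d moves an
    element c of J to the pair c, d. *)
Lemma pairs_contract m J d w : vanish_below N lam (3 :: nseq m 2)%N ->
  J \in letters 4 -> d \in iota 0 5 -> {subset w <= pairs} -> (size w).+1 = m ->
  \sum_(c <- J | c != d) lam (pm [:: rem c J, srt [:: c; d] & w]) = 0.
Proof.
move=> v3 J4 d5 wp sw; have GE := lam_exch lamD lamH lamN v3.
have w2 : wd (nseq (size w) 2%N) w by apply/wd_nseq.
have mE : (3 :: nseq m 2 = [::] ++ 3 :: 2 :: nseq (size w) 2)%N by rewrite -sw.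
have := GE _ _ _ _ [::] w _ mE isT w2 (sq1_rel_in J4 (letters1 d5)).
rewrite big_map big_filter => e; rewrite -[RHS]e; apply: eq_bigl => c.
by rewrite in_cons orbF.
Qed.
End Words.

(** * The point and flag functionals *)

Section PointFunctional.
Variable v : letter.

Definition point_form (j : 'I_5) : {mpoly 'F_2[1]} :=
  \sum_(i <- [:: ord0] | (j : nat) \in v) 'X_i.

(** Restriction to the line spanned by the indicator vector of v, followed by the
    coefficient of the spike t^(2^n - 1). *)
Definition ev (n : nat) (f : P) : 'F_2 := (subst point_form f)@_(spike 1 n).

Lemma ev_functional n : A_functional (2 ^ n - 1)%N (ev n).
Proof.
have lin j := Sqt_linear_form (erefl (point_form j)).
split=> [f g|f fh|m mN].
- by rewrite /ev substD mcoeffD.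
- by apply/spike_hit/subst_hit => // j; case: (lin j).
have hm := subst_homog (fun j => proj2 (lin j)) m.
rewrite /ev (dhomog_nemf_coeff hm) //=.
by rewrite mdegE big_ord1 mnmE eq_sym.
Qed.

(** Each letter of the word contributes the value of its variable at v; the
    Kameko map peels off one letter at a time. *)
Lemma ev_singles n u : {subset u <= iota 0 5} -> size u = n ->
  ev n (pm (singles u)) = (all (mem v) u)%:R.
Proof.
move=> + <-; elim: u => [|c u IH] u5.
  by rewrite /ev /pm mpolyX0 subst1 mcoeff1 spike0 eqxx.
have c5 : (c < 5)%N by have := u5 c (mem_head _ _); rewrite mem_iota.
rewrite /ev pm_cons substM subst_sqr mcoeff_spikeS phi_mul_sqr.
rewrite XlmE // lm_nil mpolyX0 mulr1 substX /point_form inordK // big_mkcond big_seq1.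
have {}IH := IH (fun z zu => u5 z (mem_behead (s := c :: u) zu)); rewrite /ev in IH.
rewrite -[all _ _]/((c \in v) && all (mem v) u).
case: (c \in v); last by rewrite (linear0 (@phi 1)) mul0r mcoeff0.
rewrite phiX /phi_mon ifT; last by apply/forallP => j; rewrite (ord1 j) mnm1E eqxx.
rewrite (_ : [multinom _ | j < 1] = 0%MM); first by rewrite mpolyX0 mul1r IH.
by apply/mnmP => j; rewrite !mnmE (ord1 j) eqxx.
Qed.
End PointFunctional.

Section FlagFunctional.
Variable Lk : plane * nat.

(** The coordinates of the plane L: the linear form by which x_j restricts to
    it. *)
Definition plane_form (j : 'I_5) : {mpoly 'F_2[2]} :=
  \sum_(i <- [:: ord0; ord_max] | (j : nat) \in (if i == ord0 :> 'I_2 then Lk.1.1 else Lk.1.2)) 'X_i.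

(** The derivative lowers the degree 2^n - 1 to 2^n - 2, which is the degree
    of the spike with two exponents 2^(n-1) - 1. *)
Definition psi (n : nat) (f : P) : 'F_2 :=
  (subst plane_form (mderiv (inord Lk.2 : 'I_5) f))@_(spike 2 n.-1).

Lemma psi_functional n : (0 < n)%N -> A_functional (2 ^ n - 1)%N (psi n).
Proof.
move=> n0; have lin j := Sqt_linear_form (erefl (plane_form j)).
split=> [f g|f fh|m mN].
- by rewrite /psi mderivD substD mcoeffD.
- apply/spike_hit/subst_hit => [j|]; first by case: (lin j).
  elim/hit_ind: f / fh => [|g g' gh g'h|i g i0]; first by rewrite mderiv0 rpred0.
    by rewrite mderivD rpredD.
  by rewrite Sq_mderiv hit_Sq.
have hm := subst_homog (fun j => proj2 (lin j)).
rewrite /psi mderivX substZ mcoeffZ; set j := inord _.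
have [mj|mj] := posnP (m j); first by rewrite mj mul0r.
rewrite (dhomog_nemf_coeff (hm _)) ?mulr0 //=.
apply: contra mN; rewrite mdegE big_ord_recl big_ord1 !mnmE => /eqP e.
have := mdegD (m - U_(j)) U_(j); rewrite submK ?mdeg1; last first.
  by apply/mnm_lepP => i; rewrite mnm1E; case: eqP => // <-.
move=> ->; rewrite -e; case: (n) n0 => // n' _ /=; rewrite expnS.
by have := expn_gt0 2 n'; lia.
Qed.

Lemma mderiv_sqr (j : 'I_5) (f g : P) : mderiv j (f * g ^+ 2) = mderiv j f * g ^+ 2.
Proof.
rewrite mderivM expr2 mderivM [mderiv j g * g]mulrC mpoly2_addxx mulr0.
by rewrite addr0.
Qed.

Lemma mderiv_lm (L : letter) c : is_letter L -> (c < 5)%N ->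
  mderiv (inord c : 'I_5) ('X_[lm L] : P) = if c \in L then 'X_[lm (rem c L)] else 0.
Proof.
move=> Ll c5; rewrite mderivX mnmE /= inordK //; case: ifP => cL; last by rewrite scale0r.
rewrite scale1r; congr 'X_[_]; have Lu := is_letter_uniq Ll.
rewrite (eq_lm (perm_mem (perm_to_rem cL))) lm_cons ?mem_rem_uniqF //.
by rewrite addmC addmK.
Qed.

(** After differentiating the first letter, the polynomial is a square, while
    all exponents of the spike are odd because n > 1. *)
Lemma psi_singles n u : (Lk.2 < 5)%N -> {subset u <= iota 0 5} -> size u = n -> (1 < n)%N ->
  psi n (pm (singles u)) = 0.
Proof.
move=> k5 u5 <-; case: u u5 => [//|c u] u5 /= n0.
have c5 : c \in iota 0 5 := u5 c (mem_head _ _).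
rewrite /psi pm_cons mderiv_sqr mderiv_lm //; last by rewrite /is_letter sub1seq.
case: ifP => ck; last by rewrite mul0r subst0 mcoeff0.
have -> : rem Lk.2 [:: c] = [::] by move: ck; rewrite inE => /eqP->; rewrite /= eqxx.
rewrite lm_nil mpolyX0 mul1r subst_sqr.
rewrite -(prednK n0) /=.
rewrite mcoeff_spikeS -[X in phi X]mul1r phi_mul_sqr -(mpolyX0 _ 'F_2) phiX /phi_mon ifF ?mul0r ?mcoeff0 //.
by apply/negbTE/forallPn; exists ord0; rewrite mnm0E.
Qed.

Lemma phi2_1 : phi (1 : {mpoly 'F_2[2]}) = 0.
Proof.
rewrite -(mpolyX0 2 'F_2) phiX /phi_mon ifF //.
by apply/negbTE/forallPn; exists ord0; rewrite mnm0E.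
Qed.

Lemma phi2_sqr (i : 'I_2) : phi ('X_i * 'X_i : {mpoly 'F_2[2]}) = 0.
Proof. by rewrite -expr2 -['X_i ^+ 2]mul1r phi_mul_sqr phi2_1 mul0r. Qed.

Lemma phi2_X01 : phi ('X_ord0 * 'X_ord_max : {mpoly 'F_2[2]}) = 1.
Proof.
rewrite -mpolyXD phiX /phi_mon ifT; last first.
  by apply/forallP => -[[|[|]] // i]; rewrite mnmDE !mnm1E.
rewrite (_ : [multinom _ | j < 2] = 0%MM) ?mpolyX0 //.
by apply/mnmP => -[[|[|]] // i]; rewrite mnmE mnmDE !mnm1E mnm0E.
Qed.

Lemma linear_forms_mul (R : comNzRingType) (a b c d x y : R) :
  (a * x + b * y) * (c * x + d * y) =
  a * c * (x * x) + (a * d + b * c) * (x * y) + b * d * (y * y).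
Proof. by ring. Qed.

Lemma phi2_linear_forms (a1 a2 b1 b2 : bool) :
  phi ((a1%:R * 'X_ord0 + a2%:R * 'X_ord_max) *
       (b1%:R * 'X_ord0 + b2%:R * 'X_ord_max) : {mpoly 'F_2[2]}) =
  ((a1 && b2) (+) (a2 && b1))%:R.
Proof.
have phi2D (f g : {mpoly 'F_2[2]}) : phi (f + g) = phi f + phi g by exact: linearD.
have phi2Z (a b : bool) (f : {mpoly 'F_2[2]}) :
    phi (a%:R * b%:R * f) = a%:R * b%:R * phi f.
  by case: a; case: b; rewrite ?mul1r // ?mul0r ?mulr0 ?mul0r linear0.
rewrite linear_forms_mul !mulrDl !phi2D !phi2Z phi2_X01 !phi2_sqr !mulr0 !mulr1.
by rewrite addr0 add0r; case: a1 a2 b1 b2 => [] [] [] [];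
  rewrite ?mul1r ?mul0r ?addr0 ?add0r ?mpoly2_addxx.
Qed.

Lemma plane_formE j : plane_form j =
  (val j \in Lk.1.1)%:R * 'X_ord0 + (val j \in Lk.1.2)%:R * 'X_ord_max.
Proof.
rewrite /plane_form big_mkcond big_cons big_seq1 /=.
by congr (_ + _); case: (_ \in _); rewrite ?mul1r ?mul0r.
Qed.

(** The coefficient of s t in a product of two linear forms on L is a minor of
    L. *)
Lemma phi_plane_pair a b : (a < 5)%N -> (b < 5)%N ->
  phi (plane_form (inord a) * plane_form (inord b)) = (minor Lk.1 [:: a; b])%:R.
Proof. by move=> a5 b5; rewrite !plane_formE phi2_linear_forms /= !inordK. Qed.

Lemma spike_pairs (w : word) : {subset w <= pairs} ->
  (subst plane_form (pm w))@_(spike 2 (size w)) = (minors Lk.1 w)%:R.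
Proof.
elim: w => [|p w IH] wp; first by rewrite /pm mpolyX0 subst1 mcoeff1 spike0 eqxx.
have [pl p2] := letters_is (wp p (mem_head _ _)).
have {}IH := IH (fun z zw => wp z (mem_behead (s := p :: w) zw)).
rewrite pm_cons substM subst_sqr mcoeff_spikeS phi_mul_sqr.
rewrite -[minors _ _]/(minor Lk.1 p && minors Lk.1 w).
case: p p2 pl {wp} => [|a [|b []]] // _ pl.
have a5 := is_letter_lt pl (mem_head a _).
have b5 : (b < 5)%N by apply: (is_letter_lt pl); rewrite !inE eqxx orbT.
have /andP[ab _] := is_letter_uniq pl.
rewrite XlmE // XlmE // lm_nil mpolyX0 mulr1 substM !substX phi_plane_pair //.
case: (minor _ _); first by rewrite mul1r IH.
by rewrite mul0r mcoeff0.
Qed.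

(** The derivative turns the first letter into a pair, and each pair
    contributes its minor on L. *)
Lemma psi_pairs n A w : (Lk.2 < 5)%N -> A \in letters 3 -> {subset w <= pairs} ->
  size w = (n - 2)%N -> (2 <= n)%N -> psi n (pm (A :: w)) = (contract Lk A && minors Lk.1 w)%:R.
Proof.
move=> k5 A3 wp wn n2; have [Al A3'] := letters_is A3.
rewrite /psi pm_cons mderiv_sqr mderiv_lm // /contract.
case: ifP => kA; last by rewrite mul0r subst0 mcoeff0.
have rp : rem Lk.2 A \in pairs.
  by rewrite mem_letters size_rem // A3' eqxx andbT; apply: is_letter_rem.
rewrite -pm_cons (_ : n.-1 = size (rem Lk.2 A :: w)); last first.
  by move: wn; rewrite -[size (_ :: _)]/(size w).+1; move: (size w) => sw; lia.
exact: (spike_pairs (cons_subset rp wp)).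
Qed.
End FlagFunctional.

(** * The functionals span *)

Lemma lexlt_irrefl s : lexlt s s = false.
Proof. by elim: s => //= x s ->; rewrite ltnn andbF. Qed.

Lemma lexlt_head s t : lexlt s t -> (head 0 s <= head 0 t)%N.
Proof. by case: s t => [|x s] [|y t] //= /orP[/ltnW//|/andP[/eqP->]]. Qed.

Lemma alpha_le1 i a : (alpha i a <= 1)%N.
Proof. by rewrite /alpha -ltnS ltn_mod. Qed.

Lemma omega_le5 (m : 'X_{1..5}) i : (omega m i <= 5)%N.
Proof.
apply: (@leq_trans (\sum_(j < 5) 1)%N); first by apply: leq_sum => j _; apply: alpha_le1.
by rewrite sum_nat_const card_ord muln1.
Qed.

Lemma pm_rcons_nil w : pm (rcons w [::]) = pm w.
Proof.
rewrite /pm; congr 'X_[_]; elim: w => [|L w /= ->] //=.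
by rewrite lm_nil; apply/mnmP => j; rewrite mnmDE mulmnE !mnmE.
Qed.

Section Span.
Variables (n : nat) (n7 : (7 <= n)%N).
Let N := (2 ^ n - 1)%N.

Lemma expn_N : (N + 1 = 2 ^ n)%N.
Proof. by rewrite subnK ?expn_gt0. Qed.

Lemma small_exponents (m : 'X_{1..5}) : mdeg m = N -> forall j, (m j < 2 ^ n)%N.
Proof.
move=> mN j; rewrite -expn_N addn1 ltnS -mN mdegE (bigD1 j) //=; exact: leq_addr.
Qed.

Lemma word_facts (m : 'X_{1..5}) : mdeg m = N ->
  [/\ m = wm (word_of n m), wd (weight n m) (word_of n m), size (weight n m) = n,
      (deg (weight n m) + 1 = 2 ^ n)%N & all (leq^~ 5) (weight n m)].
Proof.
move=> mN; have wE := wm_word_of (small_exponents mN).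
have w := wd_word_of n m; split=> //; first by rewrite size_mkseq.
  by rewrite -(mdeg_wm w) wE mN expn_N.
by apply/allP => a /mapP[i _ ->]; apply: omega_le5.
Qed.

Section Reduce.
Variable lam : P -> 'F_2.
Hypothesis lamA : A_functional N lam.

Definition good om := om = nseq n 1%N \/ om = generic3 n.

(** Induction on the weight: a functional that vanishes on lower weights
    vanishes on a killed one, and the only weights that are not killed are the
    good ones. *)
Lemma vanish_words om : size om = n -> all (leq^~ 5) om -> (deg om + 1 = 2 ^ n)%N ->
    (head 0 om <= 3)%N ->
    (forall om', good om' -> om' = om \/ lexlt om' om -> forall w, wd om' w -> lam (pm w) = 0) ->
  forall w, wd om w -> lam (pm w) = 0.
Proof.
have [lamD lamH lamN] := lamA.
have [k] := ubnP (lexkey 5 om); elim: k => // k IH in om *.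
rewrite ltnS => kom som om5 dom hom good0.
have v : vanish_below N lam om.
  move=> m mN; have [mE wdm sm dm m5] := word_facts mN; rewrite /lowm som => lt.
  have := IH (weight n m) _ sm m5 dm _ _ _ wdm; rewrite /pm -mE; apply.
  - by apply: leq_trans kom; apply: lexlt_key => //; rewrite sm som.
  - exact: leq_trans (lexlt_head lt) hom.
  by move=> om' g [e|lt']; apply: (good0 om') => //; right; [rewrite e | exact: lexlt_trans lt' lt].
move=> w wom; have [e|e|/(lam_killed lamD lamH lamN)/(_ v wom)//] := classify_weights n7 som dom om5 hom.
  by apply: (good0 om) => //; left.
by apply: (good0 om) => //; [right|left].
Qed.

Lemma vanish_below_reduce om : size om = n -> (head 0 om <= 3)%N ->
    (forall om', good om' -> lexlt om' om -> forall w, wd om' w -> lam (pm w) = 0) ->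
  vanish_below N lam om.
Proof.
move=> som hom good0 m mN; have [mE wdm sm dm m5] := word_facts mN; rewrite /lowm som => lt.
have := vanish_words sm m5 dm (leq_trans (lexlt_head lt) hom) _ wdm; rewrite /pm -mE; apply.
by move=> om' g [e|lt']; apply: (good0 om') => //; [rewrite e | exact: lexlt_trans lt' lt].
Qed.

Lemma vanish_all : (forall om, good om -> forall w, wd om w -> lam (pm w) = 0) ->
  forall m, (omega m 0 <= 3)%N -> lam 'X_[m] = 0.
Proof.
move=> good0 m m3; have [_ _ lamN] := lamA.
have [/eqP mN|/lamN//] := boolP (mdeg m == N).
have [mE wdm sm dm m5] := word_facts mN.
have := vanish_words sm m5 dm _ _ wdm; rewrite /pm -mE; apply.
  by rewrite /weight; case: (n) n7.
by move=> om' g _; apply: good0.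
Qed.
End Reduce.

Lemma A_functionalD lam mu : A_functional N lam -> A_functional N mu ->
  A_functional N (fun f => lam f + mu f).
Proof.
move=> [lD lH lN] [mD mH mN]; split=> [f g|f fh|m mn].
- by rewrite lD mD addrACA.
- by rewrite lH // mH // addr0.
by rewrite lN // mN // addr0.
Qed.

Lemma A_functional_sum (T : Type) (r : seq T) (c : T -> 'F_2) (lam : T -> P -> 'F_2) :
  (forall t, A_functional N (lam t)) -> A_functional N (fun f => \sum_(t <- r) c t * lam t f).
Proof.
move=> lA; elim: r => [|t r IH].
  by split=> *; rewrite !big_nil ?addr0.
have [tD tH tN] := lA t; have [rD rH rN] := IH; split=> [f g|f fh|m mn]; rewrite !big_cons.
- by rewrite tD rD mulrDr addrACA.
- by rewrite tH // rH // mulr0 addr0.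
by rewrite tN // rN // mulr0 addr0.
Qed.

Lemma generic3_words w : wd (generic3 n) w -> exists A w',
  [/\ w = rcons (A :: w') [::], A \in letters 3, {subset w' <= pairs} & size w' = (n - 2)%N].
Proof.
rewrite /generic3 -cat_cons cats1 => /wd_rcons[w1 [L [-> + /letters_is[_ /size0nil->]]]].
case: w1 => [//|A w'] /andP[A3 /wd_nseq[wp sw]].
by exists A, w'; split.
Qed.

Lemma ev_A v : A_functional N (ev v n).
Proof. exact: ev_functional. Qed.

Lemma psi_A Lk : A_functional N (psi Lk n).
Proof. by apply: psi_functional; apply: leq_trans n7. Qed.

Lemma psi_flag_singles Lk u : Lk \in flags -> {subset u <= iota 0 5} -> size u = n ->
  psi Lk n (pm (singles u)) = 0.
Proof.
case: Lk => L k /mem_flags[_ k5 _] u5 un; apply: psi_singles un _ => //; last exact: leq_trans n7.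
by move: k5; rewrite mem_iota.
Qed.

Lemma psi_flag_pairs Lk A w : Lk \in flags -> A \in letters 3 -> {subset w <= pairs} ->
  size w = (n - 2)%N -> psi Lk n (pm (A :: w)) = (contract Lk A && minors Lk.1 w)%:R.
Proof.
case: Lk => L k /mem_flags[_ k5 _] A3 wp wn; apply: (psi_pairs _ A3 wp wn); last exact: leq_trans n7.
by move: k5; rewrite mem_iota.
Qed.

Lemma sum_indicator (T : eqType) (r : seq T) (Q : pred T) (c : T -> 'F_2) (x : T -> 'F_2) :
  (forall t, t \in r -> x t = (Q t)%:R) -> \sum_(t <- r | Q t) c t = \sum_(t <- r) c t * x t.
Proof.
move=> xE; rewrite big_mkcond; apply: eq_big_seq => t /xE->.
by case: (Q t); rewrite ?mulr1 ?mulr0.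
Qed.

(** First lam is corrected by point functionals so that it vanishes on words
    of weight (1, ..., 1), the lower of the two. It then satisfies the relations
    of [grassmann_dual] on weight (3, 2, ..., 2, 0) and is corrected by flag
    functionals, which vanish on the first weight. What is left vanishes on
    both surviving weights, hence everywhere. *)
Theorem functional_span lam : A_functional N lam -> exists a b, forall m, (omega m 0 <= 3)%N ->
  lam 'X_[m] = \sum_(v <- points) a v * ev v n 'X_[m] + \sum_(Lk <- flags) b Lk * psi Lk n 'X_[m].
Proof.
move=> lamA.
have n5 : (5 <= n)%N by apply: leq_trans n7.
have head1 : (head 0 (nseq n 1) <= 3)%N by case: (n).
have v1 : vanish_below N lam (nseq n 1%N).
  apply: (vanish_below_reduce lamA) => //; first by rewrite size_nseq.
  by move=> om [->|->]; [rewrite lexlt_irrefl | case: (n) n7].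
have [a aP] := points_dual n5 (singles_support lamA v1).
pose lam1 f := lam f + \sum_(v <- points) a v * ev v n f.
have lam1A : A_functional N lam1 by apply: A_functionalD => //; apply: A_functional_sum => v; exact: ev_A.
have lam1_1 w : wd (nseq n 1%N) w -> lam1 (pm w) = 0.
  case/wd_singlesP=> u [-> u5 un]; rewrite /lam1 (aP u u5 un).
  by rewrite (sum_indicator _ (fun v _ => ev_singles v u5 un)) F2_addxx.
have v3 : vanish_below N lam1 (3 :: nseq (n - 2) 2)%N.
  (* the last letter, of weight 0, is dropped: it does not change the monomial *)
  apply: (@vanish_prefix _ _ _ [:: 0%N]); apply: (vanish_below_reduce lam1A) => //.
    by rewrite /= size_cat size_nseq /=; move: n7; lia.
  by move=> om [-> _|->]; [exact: lam1_1 | rewrite lexlt_irrefl].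
have m5 : (5 <= n - 2)%N by move: n7; lia.
have m4 : (4 <= n - 2)%N := ltnW m5.
have [b bP] := grassmann_dual (f := fun A w => lam1 (pm (A :: w))) m5
  (fun A u v A3 => pairs_support lam1A m4 v3 A3 (u := u) (v := v))
  (fun A Q w A3 Q4 => pairs_plucker lam1A v3 A3 Q4 (w := w))
  (fun J d w J4 d5 => pairs_contract lam1A v3 J4 d5 (w := w)).
pose lam2 f := lam1 f + \sum_(Lk <- flags) b Lk * psi Lk n f.
have lam2A : A_functional N lam2 by apply: A_functionalD => //; apply: A_functional_sum => Lk; exact: psi_A.
exists a, b => m m3.
have : lam2 'X_[m] = 0.
  apply: (vanish_all lam2A) => // om [->|->] w wom.
    rewrite /lam2 lam1_1 // add0r big_seq big1 // => Lk lk.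
    by case/wd_singlesP: wom => u [-> u5 un]; rewrite (psi_flag_singles lk u5 un) mulr0.
  have [A [w' [-> A3 wp sw]]] := generic3_words wom.
  rewrite pm_rcons_nil /lam2 bP // (sum_indicator _ (fun Lk lk => psi_flag_pairs lk A3 wp sw)).
  exact: F2_addxx.
rewrite /lam2 /lam1 -addrA => /F2_addr_eq; exact.
Qed.
End Span.

(** * The dimension count *)

Lemma A_functional_lin N lam : A_functional N lam ->
  forall (T : Type) (r : seq T) (c : T -> 'F_2) (F : T -> P),
  lam (\sum_(t <- r) c t *: F t) = \sum_(t <- r) c t * lam (F t).
Proof.
move=> [lD lH _] T r c F.
have l0 : lam 0 = 0 by apply: lH; apply: rpred0.
elim: r => [|t r IH]; first by rewrite !big_nil.
rewrite !big_cons lD IH; congr (_ + _).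
by have [->|->] := F2_01 (c t); rewrite ?scale1r ?mul1r // scale0r mul0r.
Qed.

(** The coordinates of the finite-dimensional space (QP_5)_N separate its
    elements. *)
Lemma separating_functional N f : f \is N.-homog -> f \notin @hit 5 ->
  exists2 lam, A_functional N lam & lam f != 0.
Proof.
move=> fN fh; pose b := vbasis {: QPdeg 5 N}.
have [i ci] : exists i, coord b i (qcls N f) != 0.
  apply: boolp.contrapT => /boolp.forallNP c0; case/negP: fh.
  apply/(qcls_eq0 fN); rewrite [qcls N f](coord_vbasis (memvf _)) big1 // => i _.
  by have /negP/negPn/eqP-> := c0 i; rewrite scale0r.
exists (fun g => coord b i (qcls N g)) => //; split=> [g h|g gh|m mN].
- by rewrite !linearD.
- by rewrite qcls_hit // linear0.
rewrite (_ : qcls N 'X_[m] = 0) ?linear0 //; apply: val_inj.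
rewrite /= (@pihomog_ne0 _ _ _ (mdeg m)) // ?dhomogX //.
exact: linear0.
Qed.

Lemma omega0_odd_deg k (x : 'X_{1..k}) : odd (omega x 0) = odd (mdeg x).
Proof.
rewrite omega0 mdegE !(big_morph odd oddD (erefl (odd 0))).
by apply: eq_bigr => j _; rewrite oddb.
Qed.

Lemma coef_fun (T : eqType) (x0 : T) (r : seq T) (u : 'I_(size r) -> 'F_2) : uniq r ->
  exists a : T -> 'F_2, forall j : 'I_(size r), a (nth x0 r j) = u j.
Proof.
move=> ru; exists (fun v => oapp u 0 (insub (index v r))) => j.
by rewrite index_uniq // valK.
Qed.

Section Rank.
Variables (n m0 : nat) (n7 : (7 <= n)%N) (nm0 : (2 * m0 + 5 = 2 ^ n - 1)%N).
Let N := (2 ^ n - 1)%N.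
Local Notation admissibles := (adm 5 m0).

Lemma mem_admissibles x : x \in admissibles <-> [/\ mdeg x = N, (omega x 0 <= 3)%N & admissible x].
Proof.
rewrite mem_adm nm0; split=> -[xN x3 xa]; split=> //; last by move: x3; lia.
have : odd (omega x 0).
  by rewrite omega0_odd_deg xN /N -nm0 oddD mul2n odd_double.
by move: x3; case: (omega x 0) => [|[|[|[|[|]]]]].
Qed.

(** Admissible monomials span, and the reduction of a monomial to them keeps
    the bound on the first weight. *)
Lemma vanish_admissibles lam : A_functional N lam ->
    {in admissibles, forall x, lam 'X_[x] = 0} ->
  forall m, mdeg m = N -> (omega m 0 <= 3)%N -> lam 'X_[m] = 0.
Proof.
move=> lamA l0 m mN m3; have [r rP rh] := admissible_span mN; have [lD lH _] := lamA.
have /F2_addr_eq -> : lam 'X_[m] + lam (\sum_(y <- r) 'X_[y]) = 0.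
  by rewrite -lD -[\sum_(y <- r) _]mpoly2_oppr; apply: lH.
rewrite (eq_bigr (fun y => (1 : 'F_2) *: 'X_[y])) => [|y _]; last by rewrite scale1r.
rewrite (A_functional_lin lamA) big_seq big1 // => y /rP[yN ya yx].
rewrite l0 ?mulr0 //; apply/mem_admissibles; split=> //.
case: yx => [->//|]; case=> [[[|i] [e lt]]|[e _]].
- exact: leq_trans (ltnW lt) m3.
- by rewrite e.
- by rewrite e.
Qed.

Lemma omega0_pm L w : is_letter L -> omega (wm (L :: w)) 0 = size L.
Proof. by move=> Ll; rewrite /= omega_add2 ?lm_sqfree //= mdeg_lm. Qed.

Lemma deg_nseq a r : deg (nseq r a) = (a * (2 ^ r - 1))%N.
Proof.
elim: r => [|r IH] /=; first by rewrite muln0.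
rewrite IH expnS; case: (2 ^ r)%N (expn_gt0 2 r) => [//|t] _.
by rewrite mulnCA -mulnS; congr (_ * _)%N; lia.
Qed.

(** On words of one-element letters the flag functionals vanish, which
    isolates the coefficients of the points; then words starting with a letter
    of 3 elements isolate those of the flags. *)
Lemma functionals_free (a : letter -> 'F_2) (b : plane * nat -> 'F_2) :
    (forall m, mdeg m = N -> (omega m 0 <= 3)%N ->
      \sum_(v <- points) a v * ev v n 'X_[m] + \sum_(Lk <- flags) b Lk * psi Lk n 'X_[m] = 0) ->
  (forall v, v \in points -> a v = 0) /\ (forall Lk, Lk \in flags -> b Lk = 0).
Proof.
move=> ab0; have n5 : (5 <= n)%N := leq_trans (isT : 5 <= 7)%N n7.
have a0 v : v \in points -> a v = 0.
  apply: (points_independent n5) => u u5 un.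
  have uN : mdeg (wm (singles u)) = N by rewrite (mdeg_wm (wd_singles u5)) deg_nseq un mul1n.
  have u3 : (omega (wm (singles u)) 0 <= 3)%N.
    case: u u5 un {uN} => [|c u] u5 un; first by move: n7; rewrite -un.
    rewrite omega0_pm // /is_letter sub1seq; exact: u5 (mem_head _ _).
  rewrite -[RHS](ab0 _ uN u3) -/(pm _) (sum_indicator _ (fun v _ => ev_singles v u5 un)).
  rewrite [X in _ = _ + X]big_seq [X in _ = _ + X]big1 ?addr0 // => Lk lk.
  by rewrite (psi_flag_singles n7 lk u5 un) mulr0.
split=> //; have m5 : (5 <= n - 2)%N by move: n7; lia.
apply: (flags_independent m5) => A w A3 wp wn.
have wA : wd (3 :: nseq (n - 2) 2)%N (A :: w).
  by apply/andP; split; [exact: A3 | apply/wd_nseq].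
have [Al A3'] := letters_is A3.
have wN : mdeg (wm (A :: w)) = N.
  rewrite (mdeg_wm wA) -[deg _]/(3 + 2 * deg (nseq (n - 2) 2))%N deg_nseq /N.
  have -> : (2 ^ n = 4 * 2 ^ (n - 2))%N by rewrite -[4%N]/(2 ^ 2)%N -expnD subnKC // (leq_trans _ n7).
  by have := expn_gt0 2 (n - 2); lia.
have w3 : (omega (wm (A :: w)) 0 <= 3)%N by rewrite omega0_pm // A3'.
rewrite -[RHS](ab0 _ wN w3) -/(pm _) (sum_indicator _ (fun Lk lk => psi_flag_pairs n7 lk A3 wp wn)).
rewrite [X in _ = X + _]big_seq [X in _ = X + _]big1 ?add0r // => v vp.
by rewrite a0 // mul0r.
Qed.

Local Notation basis_mon i := (nth 0%MM admissibles i).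

Definition point_matrix : 'M['F_2]_(size admissibles, size points) :=
  \matrix_(i, j) ev (nth [::] points j) n 'X_[basis_mon i].

Definition flag_matrix : 'M['F_2]_(size admissibles, size flags) :=
  \matrix_(i, j) psi (nth ([::], [::], 0%N) flags j) n 'X_[basis_mon i].

Lemma uniq_flags : uniq flags.
Proof. by vm_cast_no_check (erefl true). Qed.

Lemma sum_coef_fun (T : eqType) (x0 : T) (r : seq T) (u : 'I_(size r) -> 'F_2) (a F : T -> 'F_2) :
  (forall j : 'I_(size r), a (nth x0 r j) = u j) ->
  \sum_(t <- r) a t * F t = \sum_(j < size r) u j * F (nth x0 r j).
Proof. by move=> au; rewrite (big_nth x0) big_mkord; apply: eq_bigr => j _; rewrite au. Qed.

(** A vanishing combination of rows is a sum f of admissible monomials on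
    which all point and flag functionals vanish. By [functional_span] every
    linear form vanishes on f, so f is hit, and admissible monomials are
    independent. *)
Lemma pairing_row_free : row_free (row_mx point_matrix flag_matrix).
Proof.
apply: inj_row_free => u; rewrite mul_mx_row -[0]row_mx0 => /eq_row_mx[u1 u2].
apply/rowP => i; rewrite mxE; move: i.
apply: (@adm_comb_hit 5 m0); apply: boolp.contrapT => /negP fh.
set f := \sum_i _ in fh.
have fN : f \is N.-homog.
  apply: (big_ind (fun f => f \is N.-homog)) => [|g h|j _]; [exact: dhomog0|exact: dhomogD|].
  by rewrite dhomogZ // dhomogX; apply/eqP; case/mem_admissibles: (mem_nth 0%MM (ltn_ord j)).
have [lam lamA] := separating_functional fN fh; case/eqP.
have [a [b ab]] := functional_span n7 lamA.
rewrite (A_functional_lin lamA) (eq_bigr (fun i =>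
    \sum_(v <- points) a v * (u 0 i * ev v n 'X_[basis_mon i]) +
    \sum_(Lk <- flags) b Lk * (u 0 i * psi Lk n 'X_[basis_mon i]))); last first.
  move=> i _; have [_ x3 _] := (mem_admissibles _).1 (mem_nth 0%MM (ltn_ord i)).
  by rewrite ab // mulrDr !mulr_sumr; congr (_ + _); apply: eq_bigr => t _; rewrite mulrCA.
rewrite big_split /= exchange_big [X in _ + X]exchange_big /=.
rewrite !big_seq !big1 ?addr0 // => [Lk lk|v vp]; rewrite -mulr_sumr.
  have li : (index Lk flags < size flags)%N by rewrite index_mem.
  rewrite (_ : \sum_(i < _) _ = (u *m flag_matrix) 0 (Ordinal li)); first by rewrite u2 mxE mulr0.
  by rewrite mxE; apply: eq_bigr => i _; rewrite mxE nth_index.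
have li : (index v points < size points)%N by rewrite index_mem.
rewrite (_ : \sum_(i < _) _ = (u *m point_matrix) 0 (Ordinal li)); first by rewrite u1 mxE mulr0.
by rewrite mxE; apply: eq_bigr => i _; rewrite mxE nth_index.
Qed.

(** A combination of functionals that vanishes on the admissible monomials
    vanishes on all monomials with an even exponent, and [functionals_free]
    applies. *)
Lemma pairing_col_free : row_free (row_mx point_matrix flag_matrix)^T.
Proof.
rewrite tr_row_mx; apply: inj_row_free => u; rewrite -[u]hsubmxK mul_row_col => u0.
have [a aE] := coef_fun [::] (fun j => lsubmx u 0 j) uniq_points.
have [b bE] := coef_fun ([::], [::], 0%N) (fun j => rsubmx u 0 j) uniq_flags.
pose mu f := \sum_(v <- points) a v * ev v n f + \sum_(Lk <- flags) b Lk * psi Lk n f.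
have muA : A_functional N mu.
  by apply: A_functionalD; apply: A_functional_sum => t; [exact: ev_A|exact: (psi_A n7)].
have mu0 : {in admissibles, forall x, mu 'X_[x] = 0}.
  move=> x xa; have li : (index x admissibles < size admissibles)%N by rewrite index_mem.
  transitivity ((lsubmx u *m point_matrix^T + rsubmx u *m flag_matrix^T) 0 (Ordinal li)); last first.
    by rewrite u0 mxE.
  rewrite /mu (sum_coef_fun _ aE) (sum_coef_fun _ bE) mxE; congr (_ + _);
    by rewrite mxE; apply: eq_bigr => j _; rewrite ![X in _ = _ * X]mxE nth_index.
have [a0 b0] := functionals_free (vanish_admissibles muA mu0).
rewrite (_ : lsubmx u = 0) 1?(_ : rsubmx u = 0) ?row_mx0 //; apply/rowP => j; rewrite [RHS]mxE.
  by rewrite -bE b0 // mem_nth.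
by rewrite -aE a0 // mem_nth.
Qed.

Lemma size_admissibles : size admissibles = 496%N.
Proof.
have /eqP r := pairing_row_free; have /eqP := pairing_col_free.
by rewrite mxrank_tr r size_points size_flags.
Qed.
End Rank.

Theorem theorem1p4 (d : nat) (hd : (6 <= d)%N) :
  (exists s : seq (QPdeg 5 (2 * (2 ^ d - 3) + 5)%N),
     [/\ uniq s, size s = 496%N
       & forall c, c \in s <->
           c \in lker (kameko_deg 5 (2 ^ d - 3)%N) /\
           exists x : 'X_{1..5},
             [/\ mdeg x = (2 ^ d.+1 - 1)%N, admissible x
               & c = cls 'X_[x] :> QP 5]])
  /\ \dim (lker (kameko_deg 5 (2 ^ d - 3)%N)) = 496%N.
Proof.
have nd : (2 * (2 ^ d - 3) + 5 = 2 ^ d.+1 - 1)%N.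
  have d3 : (3 <= 2 ^ d)%N by apply: (@leq_trans (2 ^ 6)); rewrite ?leq_exp2l.
  by rewrite expnS; move: d3; lia.
have s496 := size_admissibles (n := d.+1) hd nd.
split; last by rewrite dim_kbasis.
exists (kbasis 5 (2 ^ d - 3)); split.
- exact: free_uniq (free_kbasis _ _).
- by rewrite size_map.
by move=> c; rewrite -nd; apply: mem_kbasis.
Qed.
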